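(* Let $p$ be a prime and let $G$ be a virtually free pro-$p$ group in which the centralizer of every non-trivial torsion element is finite. Then $G$ embeds into a free pro-$p$ product $G_0=F_0\amalg H$ of a finite $p$-group $H$ and a free pro-$p$ group $F_0$.
   Context: A virtually free pro-$p$ group is a pro-$p$ group containing an open free pro-$p$ subgroup. $\amalg$ denotes the free pro-$p$ product (coproduct in the category of pro-$p$ groups). An embedding is an injective continuous homomorphism. No countability assumption is made. *)

(* Defs.v *)
From HB Require Import structures.
From mathcomp Require Import all_boot fingroup pgroup.
From mathcomp Require Import all_classical topology.

Set Implicit Arguments.
Unset Strict Implicit.
Unset Printing Implicit Defensive.

Local Open Scope classical_set_scope.
Local Open Scope group_scope.

HB.structure Definition PreTopologicalGroup :=
  {G of monoid.Group G & Topological G}.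

HB.mixin Record PreTopologicalGroup_isTopologicalGroup G
    of PreTopologicalGroup G := {
  mulg_continuous : continuous (fun xy : G * G => xy.1 * xy.2);
  invg_continuous : continuous (fun x : G => x^-1)
}.

#[short(type="topologicalGroupType")]
HB.structure Definition TopologicalGroup :=
  {G of PreTopologicalGroup_isTopologicalGroup G & PreTopologicalGroup G}.

Definition is_subgroup (G : groupType) (A : set G) : Prop :=
  group_closed (mem A).

Definition is_normal_subgroup (G : groupType) (N : set G) : Prop :=
  is_subgroup N /\ forall x y : G, N x -> N (x ^ y).

Definition left_cosets (G : groupType) (N : set G) : set (set G) :=
  [set [set x * n | n in N] | x in [set: G]].

(* A subgroup of a topological group, with the subspace topology. *)
Section SubgroupType.
Variables (G : topologicalGroupType) (A : set G).

Definition subgroup_type (hA : is_subgroup A) : Type := set_type A.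

Variable hA : is_subgroup A.

HB.instance Definition _ := SubChoice.on (subgroup_type hA).
HB.instance Definition _ := Topological.on (subgroup_type hA).
HB.instance Definition _ :=
  SubChoice_isSubGroup.Build G _ (subgroup_type hA) hA.

Lemma subgroup_val_continuous : continuous (val : subgroup_type hA -> G).
Proof. by apply/continuousP => V oV; exists V. Qed.

Lemma continuous_to_subgroup (X : topologicalType) (f : X -> subgroup_type hA) :
  continuous (val \o f) -> continuous f.
Proof.
by move=> /continuousP cf; apply/continuousP => _ [V oV <-]; exact: cf.
Qed.

Lemma subgroup_mulg_continuous :
  continuous (fun xy : subgroup_type hA * subgroup_type hA => xy.1 * xy.2).
Proof.
apply: continuous_to_subgroup => -[x y] U nU.
have [[V W] /= [nV nW] sVW] := @mulg_continuous G (val x, val y) U nU.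
exists (val @^-1` V, val @^-1` W) => /=.
  by split; exact: subgroup_val_continuous.
by move=> [a b] /= [Va Wb]; exact: (sVW (val a, val b)).
Qed.

Lemma subgroup_invg_continuous :
  continuous (fun x : subgroup_type hA => x^-1).
Proof.
apply: continuous_to_subgroup => x U nU.
by have := subgroup_val_continuous (@invg_continuous G (val x) U nU).
Qed.

HB.instance Definition _ :=
  PreTopologicalGroup_isTopologicalGroup.Build (subgroup_type hA)
    subgroup_mulg_continuous subgroup_invg_continuous.

End SubgroupType.

(* An abstract group, viewed as a topological group with the discrete
   topology. *)
Definition discrete_group (H : groupType) : Type := H.

Section DiscreteGroup.
Variable H : groupType.

HB.instance Definition _ := monoid.Group.on (discrete_group H).
HB.instance Definition _ :=
  DiscreteTopology.copy (discrete_group H) (discrete_topology H).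

Lemma discrete_mulg_continuous :
  continuous (fun xy : discrete_group H * discrete_group H => xy.1 * xy.2).
Proof.
move=> [x y] U /nbhs_singleton /= Uxy.
exists ([set x], [set y]).
  by split; exact: (@discrete_set1 (discrete_group H)).
by move=> [a b] /= [-> ->].
Qed.

Lemma discrete_invg_continuous :
  continuous (fun x : discrete_group H => x^-1).
Proof.
move=> x U /nbhs_singleton Ux.
by apply: (filterS _ (@discrete_set1 (discrete_group H) x)) => _ ->.
Qed.

HB.instance Definition _ :=
  PreTopologicalGroup_isTopologicalGroup.Build (discrete_group H)
    discrete_mulg_continuous discrete_invg_continuous.

End DiscreteGroup.

Definition profinite_space (X : topologicalType) : Prop :=
  [/\ compact [set: X], hausdorff_space X & totally_disconnected [set: X]].

Definition is_pro_p (p : nat) (G : topologicalGroupType) : Prop :=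
  profinite_space G /\
  forall N : set G, open N -> is_normal_subgroup N ->
    exists k : nat, (left_cosets N #= `I_(p ^ k))%card.

Definition continuous_hom (G K : topologicalGroupType) (f : G -> K) : Prop :=
  {morph f : x y / x * y} /\ continuous f.

Definition is_embedding (G K : topologicalGroupType) (f : G -> K) : Prop :=
  continuous_hom f /\ injective f.

(* F is the free pro-p group on the pointed profinite space X via i. The free
   pro-p groups on sets converging to 1 are those where X is the one-point
   compactification of a discrete space, pointed at infinity. *)
Definition is_free_pro_p_on (p : nat) (X : ptopologicalType)
    (F : topologicalGroupType) (i : X -> F) : Prop :=
  [/\ is_pro_p p F, continuous i, i point = 1 &
    forall (K : topologicalGroupType) (phi : X -> K),
      is_pro_p p K -> continuous phi -> phi point = 1 ->
      exists! h : F -> K, continuous_hom h /\ h \o i = phi].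

Definition is_free_pro_p (p : nat) (F : topologicalGroupType) : Prop :=
  exists (X : ptopologicalType) (i : X -> F),
    profinite_space X /\ is_free_pro_p_on p i.

Definition is_virtually_free_pro_p (p : nat) (G : topologicalGroupType) :
    Prop :=
  is_pro_p p G /\
  exists (U : set G) (hU : is_subgroup U),
    open U /\ is_free_pro_p p (subgroup_type hU).

(* P, with the maps iA and iB, is the coproduct of A and B in the category of
   pro-p groups; meaningful when A and B are pro-p groups. *)
Definition is_free_pro_p_product (p : nat) (A B P : topologicalGroupType)
    (iA : A -> P) (iB : B -> P) : Prop :=
  [/\ is_pro_p p P, continuous_hom iA, continuous_hom iB &
    forall (K : topologicalGroupType) (f : A -> K) (g : B -> K),
      is_pro_p p K -> continuous_hom f -> continuous_hom g ->
      exists! h : P -> K, [/\ continuous_hom h, h \o iA = f & h \o iB = g]].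

Definition torsion (G : groupType) (x : G) : Prop :=
  exists n : nat, (0 < n)%N /\ x ^+ n = 1.

Definition centralizer (G : groupType) (x : G) : set G :=
  [set y | commute x y].

(* Main.v *)
Require Import Defs.
From HB Require Import structures.
From mathcomp Require Import all_boot all_fingroup all_solvable all_algebra.
From mathcomp Require Import all_classical topology.

(* Let [F] be an open normal subgroup of [G] contained in a free pro-p open
   subgroup [U], and [H = G/F]. Non-trivial finite subgroups meet [F] trivially
   and, as centralizers of torsion elements are finite, each lies in a unique
   maximal one; so there is a profinite [G]-space [Y] on which [F] acts freely
   and every non-trivial finite subgroup fixes exactly one point.

   The key fact is [H^1(G, C(Y, F_p)/F_p) = 0]. The group [G] acts on [U^H] by
   tensor induction, with [F] acting freely, and functions on [U^H] are recovered from
   their differences along the basis of [U]. By induction on the degree of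
   functions, cocycles of functions on [U^H] modulo constants are coboundaries
   if the coefficients have no [H^1] on finite subgroups. Dimension shifting
   with [F_p^H] reduces the key fact to this and to a local-global principle
   for cocycles of functions on a [G]-space.

   Let [G_0] be the free pro-p product of [H] and of the free pro-p group on
   [Y] and a base point, and [r : G -> H -> G_0]. The tautological map
   [Y -> G_0] can be corrected, one central extension of order [p] at a time,
   to a map [b] such that [e g = b (g y) (r g) (b y)^-1] does not depend on
   [y]; this is a homomorphism. The [F]-equivariant maps [Y -> G/N] give
   homomorphisms from [G_0] to the wreath products of [G/N] with [H] which
   detect [e g] modulo [N], hence [e] is injective. *)

Set Implicit Arguments.
Unset Strict Implicit.
Unset Printing Implicit Defensive.

Local Open Scope classical_set_scope.
Local Open Scope group_scope.
Import GRing.Theory.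

(** * Profinite spaces *)

(** Why [U^H]: the free group [U] need not be normal, so [G] does not act on it. A section of
    [G -> H] gives a cocycle with values in [F], read inside [U], and with it an action of [G] on
    the [H]-tuples of [U]. Why functions modulo constants: if [H^1(G, C(U^H, L)/L) = 0], then
    [H^2(G, L)] injects into [H^2(G, C(U^H, L))]. So the obstruction to lifting a cocycle to a
    larger module with kernel [L] vanishes once a lift exists over [U^H], where stabilizers are
    finite and lifts are explicit. Only 1-cocycles are ever written down. Two lifts are made in this
    way: along the sum map from [F_p^H] to [F_p], and from functions on [Y] modulo constants to
    functions on [Y]. The regular coefficients [F_p^H] have no [H^1] on finite subgroups, so the
    lifted cocycle is a coboundary by the local-global principle on [Y] itself. Why Zorn: without
    countability there is no sequence of open normal subgroups along which to correct the map to
    [G_0]. The maps are instead ordered by agreement modulo the subgroups already dealt with, and a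
    maximal one is taken. *)

Lemma compact_fin_cover (X : topologicalType) (I : Type) (K : set X)
    (U : I -> set X) :
    compact K -> (forall i, open (U i)) ->
    (forall x, K x -> exists i, U i x) ->
  exists n (u : 'I_n -> I), forall x, K x -> exists k, U (u k) x.
Proof.
move=> cK oU covU; apply: contrapT => nfin.
pose V (s : seq {classic I}) := [set x | K x /\ forall i, i \in s -> ~ U i x].
have V0 s : V s !=set0.
  apply: contrapT => /nonemptyPn V0; apply: nfin.
  exists (size s), (tnth (in_tuple s)) => x Kx.
  apply: contrapT => nUx; suff : set0 x by [].
  rewrite -V0; split=> // i si Ux; apply: nUx.
  have /tnthP[k ik] : i \in in_tuple s by [].
  by exists k; rewrite -ik.
have FF : ProperFilter (filter_from [set: seq {classic I}] V).
  apply: filter_from_proper; last by [].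
  apply: filter_from_filter; first by exists [::].
  move=> s t _ _; exists (s ++ t) => // x [Kx H].
  by split; split=> // i si; apply: H; rewrite mem_cat si ?orbT.
have FK : filter_from [set: seq {classic I}] V K by exists [::] => // x [].
have [x [Kx clx]] := cK _ FF FK.
have [i Uix] := covU _ Kx.
have FV : filter_from [set: seq {classic I}] V (V [:: (i : {classic I})]).
  by exists [:: (i : {classic I})].
have nU : nbhs x (U i) by apply: open_nbhs_nbhs; split; [exact: oU|].
have [y [[_ +] Uy]] := clx _ _ FV nU.
by move=> /(_ i (mem_head _ _)).
Qed.

Lemma open_forall (X : topologicalType) (I : finType) (U : I -> set X) :
  (forall i, open (U i)) -> open [set x | forall i, U i x].
Proof.
move=> oU; rewrite openE => x Ux.
have : nbhs x (fun y => forall i, U i y).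
  by apply: filter_forall => i; apply: open_nbhs_nbhs; split.
by [].
Qed.

Lemma closed_forall (X : topologicalType) (I : Type) (U : I -> set X) :
  (forall i, closed (U i)) -> closed [set x | forall i, U i x].
Proof.
move=> cU; rewrite (_ : mkset _ = \bigcap_(i in [set: I]) U i).
  by apply: closed_bigI => i _.
by apply/seteqP; split=> x Ux i //; exact: Ux.
Qed.

Lemma clopen_forall (X : topologicalType) (I : finType) (U : I -> set X) :
  (forall i, clopen (U i)) -> clopen [set x | forall i, U i x].
Proof.
by move=> cU; split; [apply: open_forall|apply: closed_forall] => i; case: (cU i).
Qed.

Lemma clopen_exists (X : topologicalType) (I : finType) (U : I -> set X) :
  (forall i, clopen (U i)) -> clopen [set x | exists i, U i x].
Proof.
move=> cU; have := clopenC setT (@clopen_forall X I (fun i => ~` U i) (fun i => clopenC setT (cU i))).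
rewrite (_ : ~` _ = [set x | exists i, U i x]) //.
by apply/seteqP; split=> x /=; [move/existsNP => [i /contrapT Ui]; exists i|move=> [i Ui] /(_ i)].
Qed.

Section ZeroDim.
Variable X : topologicalType.
Hypothesis cX : compact [set: X].
Hypothesis hX : hausdorff_space X.

Lemma disjoint_closed_nbhs (A B : set X) :
  closed A -> closed B -> A `&` B = set0 ->
  exists C D : set X, [/\ open C, open D, A `<=` C, B `<=` D & C `&` D = set0].
Proof.
move=> cA cB AB0.
have nA : set_nbhs A (~` B).
  have AB : A `<=` ~` B by move=> x Ax Bx; have : set0 x by rewrite -AB0.
  by apply/set_nbhsP; exists (~` B); split=> //; exact: closed_openC.
have [W /set_nbhsP [V [oV AV VW]] WB] := compact_normal hX cX cA nA.
exists V, (~` closure W); split=> //.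
- by apply: closed_openC; exact: closed_closure.
- by move=> x Bx /WB.
- by apply/disjoints_subset => x /VW /subset_closure nx /(_ nx).
Qed.

Hypothesis tX : totally_disconnected [set: X].

(** In a compact Hausdorff space quasi-components are connected. [Q] is the quasi-component of [x];
    if it contained [y], total disconnectedness would force [y = x]. *)
Lemma profinite_zero_dimensional : zero_dimensional X.
Proof.
move=> x y xy; apply: contrapT => nsep.
pose Q := [set z | forall C : set X, clopen C -> C x -> C z].
have Qx : Q x by [].
have Qy : Q y.
  by move=> C cC Cx; apply: contrapT => nCy; apply: nsep; exists C.
have cQ : closed Q.
  rewrite (_ : Q = \bigcap_(C in [set C : set X | clopen C /\ C x]) C).
    by apply: closed_bigI => C [[]].
  by apply/seteqP; split=> [z Qz C [cC Cx]|z Qz C cC Cx]; apply: Qz.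
suff conQ : connected Q.
  have : connected_component [set: X] x y by exists Q.
  by rewrite tX// => yx; move: xy; rewrite yx eqxx.
move=> B [b Bb] [C oC BC] [D cD BD].
have cB : closed B by rewrite BD; exact: closedI.
have cA : closed (Q `\` B).
  rewrite (_ : Q `\` B = Q `&` ~` C); first by apply: closedI => //; exact: open_closedC.
  rewrite BC; apply/seteqP; split=> z [Qz nz]; split=> //.
  - by move=> Cz; exact: nz.
  - by case.
have [V [W [oV oW BV AW VW]]] := disjoint_closed_nbhs cB cA (setDIK _ _).
(* By compactness finitely many clopen neighbourhoods of [x] already have their intersection [C0]
   inside the union of [V] and [W]. The traces of [V] and [W] on [C0] are then clopen, and [Q] lies
   in the one that contains [x]. *)
have [n [u ucov]] : exists n (u : 'I_n -> {C : set X | clopen C /\ C x}),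
    forall z, (~` (V `|` W)) z -> exists k, (~` sval (u k)) z.
  apply: (@compact_fin_cover X _ _ (fun c : {C : set X | clopen C /\ C x} => ~` sval c)).
  - by apply: subclosed_compact cX _ => //; apply: open_closedC; exact: openU.
  - by case=> c [[oc cc] cx] /=; exact: closed_openC.
  - move=> z nz; apply: contrapT => nc.
    have Qz : Q z.
      move=> c cc cx; apply: contrapT => ncz; apply: nc.
      by exists (exist _ c (conj cc cx)).
    apply: nz; have [/BV|nB] := pselect (B z); first by left.
    by right; apply: AW.
pose C0 := [set z | forall k, sval (u k) z].
have C0x : C0 x by move=> k; case: (u k) => c [].
have C0VW : C0 `<=` V `|` W.
  by move=> z C0z; apply: contrapT => /ucov [k]; apply; exact: C0z.
have cC0 : clopen C0 by apply: clopen_forall => k; case: (u k) => c [].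
have cl (V' W' : set X) : open V' -> open W' -> V' `&` W' = set0 ->
    C0 `<=` V' `|` W' -> clopen (C0 `&` V').
  move=> oV' oW' VW' C0'; split; first by apply: openI => //; case: cC0.
  rewrite (_ : C0 `&` V' = C0 `&` ~` W').
    by apply: closedI; [case: cC0|exact: open_closedC].
  apply/seteqP; split=> z [C0z]; split=> //.
    by move=> W'z; have : set0 z by rewrite -VW'.
  by case: (C0' _ C0z).
have [Bx|nBx] := pselect (B x).
- apply/seteqP; split=> [|z Qz]; first by rewrite BC => ? [].
  apply: contrapT => nBz.
  have [_ Vz] : (C0 `&` V) z by apply: Qz; [exact: cl oW _ _|split=> //; exact: BV].
  by have : set0 z; first by rewrite -VW; split=> //; apply: AW.
- have Qb : Q b by move: Bb; rewrite BC => -[].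
  have [_ Wb] : (C0 `&` W) b.
    apply: Qb; first by apply: cl oV _ _ => //; [rewrite setIC|rewrite setUC].
    by split=> //; apply: AW.
  by have : set0 b by rewrite -VW; split=> //; exact: BV.
Qed.

Lemma clopen_separate (A B : set X) :
  closed A -> closed B -> A `&` B = set0 ->
  exists C : set X, [/\ clopen C, A `<=` C & C `&` B = set0].
Proof.
move=> cA cB AB0.
have sep x : A x -> exists C : set X, [/\ clopen C, C x & C `&` B = set0].
  move=> Ax; have nBx : nbhs x (~` B).
    apply: open_nbhs_nbhs; split; first exact: closed_openC.
    by move=> Bx; have : set0 x by rewrite -AB0.
  have [C [Cx cC] CB] := zero_dimensional_cvg hX profinite_zero_dimensional cX nBx.
  by exists C; split=> //; apply/disjoints_subset.
pose I := {C : set X | clopen C /\ C `&` B = set0}.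
have [|||n [u uA]] := @compact_fin_cover X I A sval.
- exact: subclosed_compact cX _.
- by case=> C [[]].
- by move=> x /sep [C [cC Cx CB]]; exists (exist _ C (conj cC CB)).
exists [set x | exists k, sval (u k) x]; split.
- by apply: clopen_exists => k; case: (u k) => C [].
- by move=> x /uA.
- apply/disjoints_subset => x [k]; case: (u k) => C [cC /= /disjoints_subset]; apply.
Qed.
End ZeroDim.

(** * Locally constant functions and open normal subgroups *)

Definition lc (X : topologicalType) (T : Type) (f : X -> T) :=
  forall x, nbhs x [set y | f y = f x].

Lemma lc_comp (X : topologicalType) (T T' : Type) (h : T -> T') (f : X -> T) :
  lc f -> lc (h \o f).
Proof. by move=> lf x; apply: filterS (lf x) => y /= ->. Qed.

Lemma lc_comp2 (X : topologicalType) (T T' T'' : Type) (h : T -> T' -> T'')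
    (f : X -> T) (g : X -> T') :
  lc f -> lc g -> lc (fun x => h (f x) (g x)).
Proof.
by move=> lf lg x; apply: filterS2 (lf x) (lg x) => y /= -> ->.
Qed.

Lemma lc_cst (X : topologicalType) (T : Type) (t : T) : lc (fun _ : X => t).
Proof. by move=> x; apply: (@filterS _ (nbhs x) _ setT) => //; exact: filterT. Qed.

Lemma lc_continuous (X Y : topologicalType) (T : Type) (h : X -> Y) (f : Y -> T) :
  continuous h -> lc f -> lc (f \o h).
Proof. by move=> ch lf x; exact: (ch x _ (lf (h x))). Qed.

Lemma lc_preimage_open (X : topologicalType) (T : Type) (f : X -> T) (P : T -> Prop) :
  lc f -> open [set x | P (f x)].
Proof.
by move=> lf; rewrite openE => x Px; apply: filterS (lf x) => y /= ->.
Qed.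

Lemma lc_preimage_clopen (X : topologicalType) (T : Type) (f : X -> T) (P : T -> Prop) :
  lc f -> clopen [set x | P (f x)].
Proof.
move=> lf; split; first exact: lc_preimage_open.
rewrite -openC (_ : ~` _ = [set x | ~ P (f x)]); last by [].
exact: (@lc_preimage_open _ _ f (fun t => ~ P t)).
Qed.

Lemma continuous_pair (X Y Z : topologicalType) (f : X -> Y) (g : X -> Z) :
  continuous f -> continuous g -> continuous (fun x => (f x, g x)).
Proof. by move=> cf cg x; apply: cvg_pair; [exact: cf|exact: cg]. Qed.

Lemma continuous_compose (X Y Z : topologicalType) (f : X -> Y) (g : Y -> Z) :
  continuous f -> continuous g -> continuous (fun x => g (f x)).
Proof. by move=> cf cg x; exact: (continuous_comp (cf x) (cg (f x))). Qed.

Lemma continuous_fst (X Y : topologicalType) : continuous (fun z : X * Y => z.1).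
Proof. by move=> z; exact: cvg_fst. Qed.

Lemma continuous_snd (X Y : topologicalType) : continuous (fun z : X * Y => z.2).
Proof. by move=> z; exact: cvg_snd. Qed.

Lemma compact_open_forall (X Y : topologicalType) (W : set (X * Y)) :
  compact [set: Y] -> open W -> open [set x | forall y, W (x, y)].
Proof.
move=> /compact_near_coveringP cY oW; rewrite openE => x Wx.
have cov y : [set: Y] y -> \forall y' \near y & x' \near x, W (x', y').
  move=> _; have : nbhs (x, y) W.
    by apply: open_nbhs_nbhs; split; [exact: oW|exact: Wx].
  move=> [[A B] /= [nA nB] AB]; exists (B, A) => //= -[b a] [/= Bb Aa].
  exact: (AB (a, b)).
by apply: filterS (cY X (nbhs x) (fun x y => W (x, y)) _ cov) => x' H y; exact: H.
Qed.

Section TopGroup.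
Variable G : topologicalGroupType.

Lemma continuousM (X : topologicalType) (f g : X -> G) :
  continuous f -> continuous g -> continuous (fun x => f x * g x).
Proof.
move=> cf cg x.
have H1 : (fun x => (f x, g x)) @ x --> (f x, g x) by exact: continuous_pair.
have H2 : (fun z : G * G => z.1 * z.2) @ (f x, g x) --> f x * g x.
  exact: (@mulg_continuous G (f x, g x)).
exact: (cvg_comp _ _ H1 H2).
Qed.

Lemma continuousV (X : topologicalType) (f : X -> G) :
  continuous f -> continuous (fun x => (f x)^-1).
Proof. by move=> cf x; exact: (cvg_comp _ _ (cf x) (@invg_continuous G (f x))). Qed.

Lemma continuous_id (X : topologicalType) : continuous (fun x : X => x).
Proof. by move=> x. Qed.

Lemma subgroupP (A : set G) :
  is_subgroup A <-> A 1 /\ forall x y, A x -> A y -> A (x * y^-1).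
Proof.
split=> [[A1 AD]|[A1 AD]].
  split; first by move: A1; rewrite inE.
  by move=> x y Ax Ay; have := AD x y; rewrite !inE; apply.
by split=> [|x y]; rewrite !inE //; exact: AD.
Qed.

Lemma sub1 (A : set G) : is_subgroup A -> A 1.
Proof. by case/subgroupP. Qed.
Lemma subV (A : set G) x : is_subgroup A -> A x -> A x^-1.
Proof. by case/subgroupP => A1 AD Ax; rewrite -[x^-1]mul1g; exact: AD. Qed.
Lemma subM (A : set G) x y : is_subgroup A -> A x -> A y -> A (x * y).
Proof.
move=> sA Ax Ay; rewrite -[y]invgK; case/subgroupP: (sA) => _; apply=> //.
exact: subV.
Qed.

Definition opn (N : set G) := open N /\ is_normal_subgroup N.

Lemma opn1 N : opn N -> N 1. Proof. by case=> _ [/sub1]. Qed.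
Lemma opnM N x y : opn N -> N x -> N y -> N (x * y).
Proof. by case=> _ [sN _]; exact: subM. Qed.
Lemma opnV N x : opn N -> N x -> N x^-1.
Proof. by case=> _ [sN _]; exact: subV. Qed.
Lemma opnJ N x y : opn N -> N x -> N (y^-1 * (x * y)).
Proof. by case=> _ [_ sN]; exact: sN. Qed.
Lemma opnJV N x y : opn N -> N x -> N (y * x * y^-1).
Proof. by move=> oN Nx; have := opnJ y^-1 oN Nx; rewrite invgK mulgA. Qed.

Lemma opnI N N' : opn N -> opn N' -> opn (N `&` N').
Proof.
move=> oN oN'; split; first by apply: openI; [case: oN|case: oN'].
split; first by apply/subgroupP; split=> [|x y [Nx N'x] [Ny N'y]];
  split; try exact: opn1; apply: opnM => //; exact: opnV.
by move=> x y [Nx N'x]; split; exact: opnJ.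
Qed.

Lemma opn_forall (I : finType) (N : I -> set G) :
  (forall i, opn (N i)) -> opn [set x | forall i, N i x].
Proof.
move=> oN; split; first by apply: open_forall => i; case: (oN i).
split; first by apply/subgroupP; split=> [i|x y Nx Ny i]; [exact: opn1|
  apply: opnM => //; exact: opnV].
by move=> x y Nx i; exact: opnJ.
Qed.

Lemma opnT : opn setT.
Proof. by split; [exact: openT|split=> //; apply/subgroupP]. Qed.

Lemma nbhs_coset (A : set G) (x : G) : open A -> A 1 -> nbhs x [set y | A (x^-1 * y)].
Proof.
move=> oA A1; apply: open_nbhs_nbhs; split; last by rewrite /= mulVg.
apply: (@open_comp G G (fun y => x^-1 * y)) => // y _.
apply: continuousM; [exact: cst_continuous|exact: continuous_id].
Qed.

Lemma nbhs_rcoset (A : set G) (x : G) : open A -> A 1 -> nbhs x [set y | A (y * x^-1)].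
Proof.
move=> oA A1; apply: open_nbhs_nbhs; split; last by rewrite /= mulgV.
apply: (@open_comp G G (fun y => y * x^-1)) => // y _.
apply: continuousM; [exact: continuous_id|exact: cst_continuous].
Qed.

Lemma opn_closed N : opn N -> closed N.
Proof.
move=> oN; rewrite -openC openE => x nNx.
apply: filterS (@nbhs_coset N x (proj1 oN) (opn1 oN)) => y Nxy Ny; apply: nNx.
have := opnM oN Ny (opnV oN Nxy); rewrite invgM invgK mulgA mulgV mul1g //.
Qed.

Hypothesis pG : profinite_space G.
Let cG : compact [set: G]. Proof. by case: pG. Qed.

(** For a clopen [C] inside [U] containing 1, the [x] with [x C] inside [C] form a monoid [V]
    contained in [C]; its invertible part [S] is a subgroup and [N] is the intersection of the
    conjugates of [S]. Both quantifications over [G] preserve openness because [G] is compact. *)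
Lemma opn_basis (U : set G) : open U -> U 1 -> exists N, opn N /\ N `<=` U.
Proof.
move=> oU U1.
have [hG tG] : hausdorff_space G /\ totally_disconnected [set: G] by case: pG.
have nU : nbhs 1 U by exact: open_nbhs_nbhs.
have [C [C1 [oC cC]] CU] :=
  zero_dimensional_cvg hG (profinite_zero_dimensional cG hG tG) cG nU.
pose V := [set x | forall c, C c -> C (x * c)].
have oV : open V.
  have := @compact_open_forall G G [set z | C z.2 -> C (z.1 * z.2)] cG.
  apply; rewrite (_ : mkset _ = (snd @^-1` (~` C)) `|`
                   ((fun z : G * G => z.1 * z.2) @^-1` C)).
    apply: openU.
      apply: open_comp => [z _|]; last exact: closed_openC.
      exact: cvg_snd.
    by apply: open_comp => // z _; exact: mulg_continuous.
  apply/seteqP; split=> z /=; last by case.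
  by have [Cz|nCz] := pselect (C z.2); [move=> /(_ Cz); right|left].
pose S := V `&` [set x | V x^-1].
have oS : open S.
  apply: openI => //; apply: (@open_comp G G (fun x => x^-1)) => // x _.
  exact: invg_continuous.
have V1 : V 1 by move=> c; rewrite mul1g.
have VM x y : V x -> V y -> V (x * y).
  by move=> Vx Vy c Cc; rewrite -mulgA; apply: Vx; exact: Vy.
have S1 : S 1 by split=> //=; rewrite invg1.
have SM x y : S x -> S y -> S (x * y).
  by move=> [Vx Vx'] [Vy Vy']; split; [exact: VM|rewrite /= invgM; exact: VM].
have SV x : S x -> S x^-1 by move=> [Vx Vx']; split=> //=; rewrite invgK.
pose N := [set x | forall g, S (g^-1 * (x * g))].
exists N; split; last first.
  by move=> x /(_ 1) [/(_ 1 C1)]; rewrite invg1 mul1g !mulg1 => /CU.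
split.
  have := @compact_open_forall G G [set z | S (z.2^-1 * (z.1 * z.2))] cG.
  apply; apply: (@open_comp _ G (fun z : G * G => z.2^-1 * (z.1 * z.2))) => // z _.
  apply: continuousM; first by apply: continuousV => ?; exact: cvg_snd.
  by apply: continuousM => ?; [exact: cvg_fst|exact: cvg_snd].
split.
  apply/subgroupP; split=> [g|x y Nx Ny g]; first by rewrite mul1g mulVg.
  rewrite (_ : _ * _ = (g^-1 * (x * g)) * (g^-1 * (y * g))^-1).
    by apply: SM => //; exact: SV.
  by rewrite !invgM invgK !mulgA mulgK.
by move=> x y Nx g; have := Nx (y * g); rewrite /conjg invgM !mulgA.
Qed.

Lemma opn_sep (x : G) : x != 1 -> exists N, opn N /\ ~ N x.
Proof.
move=> x1; have [hG tG] : hausdorff_space G /\ totally_disconnected [set: G] by case: pG.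
have [|C [[oC _] C1 nCx]] := @profinite_zero_dimensional G cG hG tG 1 x.
  by rewrite eq_sym.
by have [N [oN NC]] := opn_basis oC C1; exists N; split=> // /NC.
Qed.

Lemma opn_fin_cover (N : set G) : opn N ->
  exists n (u : 'I_n -> G), forall x, exists k, N (x * (u k)^-1).
Proof.
move=> oN.
have [|||n [u H]] := @compact_fin_cover G G setT (fun g => [set y | N (y * g^-1)]).
- exact: cG.
- move=> g; apply: (@open_comp G G (fun y => y * g^-1)) => [y _|]; last by case: oN.
  by apply: continuousM; [exact: continuous_id|exact: cst_continuous].
- by move=> x _; exists x; rewrite /= mulgV; exact: opn1.
by exists n, u => x; apply: H.
Qed.

(** As [O] is compact, the tube lemma shows that the elements of [G] leaving [f] invariant form an
    open set. *)
Lemma lc_smooth (O : topologicalType) (act : G -> O -> O) (T : Type) (f : O -> T) :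
    compact [set: O] -> continuous (fun z : G * O => act z.1 z.2) ->
    (forall o, act 1 o = o) -> lc f ->
  exists N, opn N /\ forall n o, N n -> f (act n o) = f o.
Proof.
move=> cO ca a1 lf.
pose U := [set x | forall o, f (act x o) = f o].
have oU : open U.
  have := @compact_open_forall G O [set z | f (act z.1 z.2) = f z.2] cO.
  apply; have l1 : lc (fun z : G * O => f (act z.1 z.2)) by exact: lc_continuous ca lf.
  have l2 : lc (fun z : G * O => f z.2) by apply: lc_continuous lf => z; exact: cvg_snd.
  exact: (lc_preimage_open (fun z => z.1 = z.2) (lc_comp2 pair l1 l2)).
have [|N [oN NU]] := opn_basis oU; first by move=> o; rewrite a1.
by exists N; split=> // n o /NU.
Qed.

Lemma lc_opn (T : Type) (f : G -> T) : lc f ->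
  exists N, opn N /\ forall n x, N n -> f (n * x) = f x /\ f (x * n) = f x.
Proof.
move=> lf.
have [||N [oN fN]] := @lc_smooth G (fun x y => x * y) T f cG _ _ lf.
- exact: (@mulg_continuous G).
- exact: mul1g.
exists N; split=> // n x Nn; split; first exact: fN.
rewrite (_ : x * n = (x * n * x^-1) * x); last by rewrite mulgVK.
by apply: fN; exact: opnJV.
Qed.

Lemma lc_hom (E : finGroupType) (q : G -> E) (N : set G) : opn N ->
  {morph q : x y / x * y} -> (forall x, N x -> q x = 1) -> lc q.
Proof.
move=> oN qM qN x; apply: filterS (@nbhs_coset N x (proj1 oN) (opn1 oN)) => y /= Nxy.
by rewrite -[y](mulKVg x) qM (qN _ Nxy) mulg1.
Qed.

End TopGroup.

(** * Finite quotients and wreath products *)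

Lemma left_cosetE (G : groupType) (N : set G) (x y : G) : is_subgroup N ->
  [set x * n | n in N] = [set y * n | n in N] <-> N (x^-1 * y).
Proof.
move=> sN; have [N1 ND] : N 1 /\ forall u v, N u -> N v -> N (u * v^-1).
  by case: sN => N1 ND; split; [move: N1; rewrite inE|move=> u v Nu Nv; have := ND u v; rewrite !inE; apply].
have NV u : N u -> N u^-1 by move=> Nu; rewrite -[u^-1]mul1g; exact: ND.
have NM u v : N u -> N v -> N (u * v) by move=> Nu Nv; rewrite -[v]invgK; apply: ND => //; exact: NV.
split=> [xy|Nxy].
  have : [set x * n | n in N] y by rewrite xy; exists 1; rewrite ?mulg1.
  by case=> n Nn <-; rewrite mulKg.
apply/seteqP; split=> _ [n Nn <-].
  exists (y^-1 * x * n); first by apply: NM => //; rewrite -[y^-1 * x]invgK invgM invgK; exact: NV.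
  by rewrite !mulgA mulgV mul1g.
by exists (x^-1 * y * n); [exact: NM|rewrite !mulgA mulgV mul1g].
Qed.

(** The definition of pro-p groups only provides a bijection of the cosets with ['I_(p ^ k)]. The
    quotient is realized as the image [E] of [G] in the permutations of these numbers; it acts
    regularly, which gives its order. *)
Lemma opn_quotient (p : nat) (G : topologicalGroupType) (N : set G) : prime p ->
    is_pro_p p G -> opn N ->
  exists (E : finGroupType) (q : G -> E),
    [/\ p.-group [set: E]%G, {morph q : x y / x * y},
        forall x, q x = 1 <-> N x & forall e, exists x, q x = e].
Proof.
move=> pp [_ pG] oN; have [oN' nN] := oN; have sN := nN.1.
have [k /card_set_bijP [f [fI finj fsurj]]] := pG N oN' nN.
pose cos x : set G := [set x * n | n in N].
have lcos x : left_cosets N (cos x) by exists x.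
have c_lt x : (f (cos x) < p ^ k)%N by exact: fI.
pose c x : 'I_(p ^ k) := Ordinal (c_lt x).
have cE x y : c x = c y <-> N (x^-1 * y).
  rewrite -left_cosetE //; split=> [[/finj]|xy]; first by apply; rewrite inE.
  by apply: val_inj; rewrite /= /cos xy.
have /choice [r rK] : forall i : 'I_(p ^ k), exists x, c x = i.
  move=> i; have [|C [x _ <-] fC] := fsurj i; first exact: ltn_ord.
  by exists x; apply: val_inj.
have crM x y : c (x * r (c y)) = c (x * y).
  apply/cE; rewrite invgM -mulgA mulKg; apply/cE; exact: rK.
have a_inj x : injective (fun i => c (x^-1 * r i)).
  move=> i j /cE; rewrite invgM -mulgA mulKg => /cE; by rewrite !rK.
(* Permutations compose from left to right, so it is the action of [x^-1] by left multiplication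
   that makes [a] a morphism. *)
pose a x := perm (a_inj x).
have aE x y : a x (c y) = c (x^-1 * y) by rewrite permE crM.
have aM : {morph a : x y / x * y}.
  move=> x y; apply/permP => i; rewrite permM -[i]rK !aE invgM mulgA //.
have aN x : a x = 1 <-> N x.
  split=> [/permP /(_ (c 1))|Nx].
    by rewrite aE perm1 mulg1 => /cE; rewrite invgK mulg1.
  apply/permP => i; rewrite -[i]rK aE perm1; apply/cE.
  by rewrite invgM invgK -mulgA; exact: opnJ.
pose im := [set s | `[< exists x, a x = s >]]%SET.
have imP s : reflect (exists x, a x = s) (s \in im) by rewrite inE; exact: asboolP.
have a_im x : a x \in im by apply/imP; exists x.
have gim : group_set im.
  apply/group_setP; split.
    by apply/imP; exists 1; apply/aN; exact: opn1.
  by move=> _ _ /imP [x <-] /imP [y <-]; apply/imP; exists (x * y).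
pose E := Group gim.
have aEinj x y : a x (c 1) = a y (c 1) -> a x = a y.
  rewrite !aE !mulg1 => /cE; rewrite invgK => Nxy.
  have : a (x * y^-1) = 1 by apply/aN.
  by move=> axy; rewrite -[x](mulgVK y) aM axy mul1g.
have cardE : #|E| = (p ^ k)%N.
  rewrite -[RHS]card_ord -(card_in_imset (D := E) (f := fun s : 'S_(p ^ k) => s (c 1))).
    rewrite -cardsT; congr #|pred_of_set _|; apply/setP => i; rewrite inE.
    apply/imsetP; exists (a (r i)^-1) => //; rewrite aE invgK mulg1; exact/esym/rK.
  move=> _ _ /imP [x <-] /imP [y <-]; exact: aEinj.
exists (subg_of E), (fun x => subg E (a x)); split.
- rewrite /pgroup cardsT (_ : #|{: subg_of E}| = #|E|); last first.
    by rewrite card_sub; apply: eq_card => s.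
  by rewrite cardE pnatX pnat_id.
- by move=> x y; rewrite aM subgM.
- move=> x; rewrite -aN; split=> [/(congr1 sgval)|ax].
    by rewrite subgK.
  by apply: val_inj; rewrite /= subgK // ax.
- move=> e; have /imP [x ax] := subgP e.
  by exists x; apply: val_inj; rewrite /= subgK.
Qed.

(** Since [N] contains the kernel of [th], its cosets correspond to those of [th N] in [th G], and
    this index divides a power of [p]. *)
Lemma cosets_card (p : nat) (G : groupType) (N : set G) (E : finGroupType) (th : G -> E) :
    p.-group [set: E]%G -> is_subgroup N -> {morph th : x y / x * y} ->
    (forall x, th x = 1 -> N x) ->
  exists k, (left_cosets N #= `I_(p ^ k))%card.
Proof.
move=> pE sN thM thN.
have [N1 ND] : N 1 /\ forall u v, N u -> N v -> N (u * v^-1).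
  by case: sN => N1 ND; split; [move: N1; rewrite inE|move=> u v Nu Nv; have := ND u v; rewrite !inE; apply].
have NM u v : N u -> N v -> N (u * v).
  move=> Nu Nv; rewrite -[v]invgK; apply: (ND) => //.
  by rewrite -[_^-1]mul1g; exact: ND.
have th1 : th 1 = 1 by apply: (mulgI (th 1)); rewrite -thM !mulg1.
have thV x : th x^-1 = (th x)^-1.
  by apply: (mulgI (th x)); rewrite -thM !mulgV.
pose im (A : set G) := [set e | `[< exists2 x, A x & th x = e >]]%SET.
have imP (A : set G) e : reflect (exists2 x, A x & th x = e) (e \in im A).
  by rewrite inE; exact: asboolP.
have gim (A : set G) : A 1 -> (forall x y, A x -> A y -> A (x * y)) -> group_set (im A).
  move=> A1 AM; apply/group_setP; split; first by apply/imP; exists 1.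
  move=> _ _ /imP [x Ax <-] /imP [y Ay <-]; apply/imP; exists (x * y) => //.
  exact: AM.
pose D := Group (gim setT I (fun _ _ _ _ => I)).
pose M := Group (gim N N1 NM).
have [k kE] : {k | #|lcosets M D| = (p ^ k)%N}.
  apply: p_natP; rewrite card_lcosets; apply: pnat_dvd (dvdn_indexg D M) _.
  by apply: pnat_dvd pE; exact/cardSg/finset.subsetT.
exists k; rewrite -kE.
pose phi (C : set G) := im C.
have phiE x : phi [set x * n | n in N] = th x *: M.
  apply/setP => e; apply/imP/lcosetP => [[_ [n Nn <-] <-]|[_ /imP [n Nn <-] ->]].
    by exists (th n); [apply/imP; exists n|rewrite thM].
  by exists (x * n); [exists n|rewrite thM].
have phiL x : phi [set x * n | n in N] \in lcosets M D.
  by rewrite phiE; apply/lcosetsP; exists (th x) => //; apply/imP; exists x.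
apply/card_set_bijP; exists (fun C => index (phi C) (enum (lcosets M D))); split.
- by move=> _ [x _ <-] /=; rewrite cardE index_mem mem_enum.
- move=> _ _ /set_mem [x _ <-] /set_mem [y _ <-] ixy.
  have : phi [set x * n | n in N] = phi [set y * n | n in N].
    rewrite -[LHS](nth_index (M : {set E}) (s := enum (lcosets M D))) ?mem_enum // ixy.
    by rewrite nth_index ?mem_enum.
  rewrite !phiE => /lcoset_eqP; rewrite mem_lcoset => /imP [n Nn thn].
  apply/esym/left_cosetE => //; rewrite -[y^-1 * x](mulgVK n); apply: (NM) => //.
  by apply: thN; rewrite !thM !thV thn mulgV.
- move=> i /=; rewrite cardE => ilt.
  have /lcosetsP [_ /imP [x _ <-] ex] : nth (M : {set E}) (enum (lcosets M D)) i \in lcosets M D.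
    by rewrite -mem_enum mem_nth.
  exists [set x * n | n in N]; first by exists x.
  by rewrite phiE -ex index_uniq // enum_uniq.
Qed.

Lemma discrete_profinite (E : finGroupType) : profinite_space (discrete_group E).
Proof.
split.
- by apply: finite_compact; exact: (@finite_finset E).
- exact: discrete_hausdorff.
- apply: zero_dimension_totally_disconnected; exact: discrete_zero_dimension.
Qed.

Lemma discrete_is_pro_p (p : nat) (E : finGroupType) :
  p.-group [set: E]%G -> is_pro_p p (discrete_group E).
Proof.
move=> pE; split; first exact: discrete_profinite.
move=> N _ [sN _]; apply: (@cosets_card p (discrete_group E) N E id) => //.
by move=> x ->; move: sN => []; rewrite inE.
Qed.

Lemma lc_discrete (X : topologicalType) (E : finGroupType) (f : X -> discrete_group E) :
  lc f -> continuous f.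
Proof.
move=> lf x A /nbhs_singleton Afx; apply: filterS (lf x) => y /= fy.
by rewrite /= fy.
Qed.

Lemma discrete_lc (X : topologicalType) (E : finGroupType) (f : X -> discrete_group E) :
  continuous f -> lc f.
Proof. by move=> cf x; exact: (cf x _ (@discrete_set1 (discrete_group E) (f x))). Qed.

Section Wreath.
Variables H B : finGroupType.

(** [H] permutes the coordinates by right translation. In a product [x * y] the coordinate at 1 is
    [x.2 1 * y.2 x.1]: the new factor is evaluated at the place reached so far, which is how
    [integrate_scalar] reads off an integral. *)
Definition wreath := (H * {ffun H -> B})%type.
HB.instance Definition _ := Finite.on wreath.

Definition wr_mul (x y : wreath) : wreath :=
  (x.1 * y.1, [ffun h => x.2 h * y.2 (h * x.1)]).
Definition wr_one : wreath := (1, [ffun=> 1]).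
Definition wr_inv (x : wreath) : wreath :=
  (x.1^-1, [ffun h => (x.2 (h * x.1^-1))^-1]).

Lemma wr_mulA : associative wr_mul.
Proof.
move=> x y z; congr pair => /=; first exact: mulgA.
by apply/ffunP => h; rewrite !ffunE !mulgA.
Qed.
Lemma wr_mul1 : left_id wr_one wr_mul.
Proof.
case=> a f; congr pair => /=; first exact: mul1g.
by apply/ffunP => h; rewrite !ffunE mul1g mulg1.
Qed.
Lemma wr_mulV : left_inverse wr_one wr_inv wr_mul.
Proof.
case=> a f; congr pair => /=; first exact: mulVg.
by apply/ffunP => h; rewrite !ffunE /= mulVg.
Qed.
HB.instance Definition _ := Finite_isGroup.Build wreath wr_mulA wr_mul1 wr_mulV.

Lemma wr_mulE (x y : wreath) :
  x * y = ((x.1 * y.1, [ffun h => x.2 h * y.2 (h * x.1)]) : wreath).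
Proof. by []. Qed.

Lemma wr_pgroup (p : nat) :
  p.-group [set: H]%G -> p.-group [set: B]%G -> p.-group [set: wreath]%G.
Proof.
rewrite /pgroup !cardsT => pH pB.
by rewrite card_prod card_ffun pnatM pH pnatX pB.
Qed.
End Wreath.

(** * Integration on free pro-p groups *)

Lemma lc_fin_range (Y : topologicalType) (T : Type) (f : Y -> T) :
  compact [set: Y] -> lc f -> exists n (v : 'I_n -> T), forall y, exists k, f y = v k.
Proof.
move=> cY lf.
have [|||n [u H]] := @compact_fin_cover Y Y setT (fun y => [set z | f z = f y]).
- exact: cY.
- by move=> y; exact: (@lc_preimage_open _ _ f (fun t => t = f y)).
- by move=> y _; exists y.
by exists n, (f \o u) => y; have [k fy] := H y I; exists k.
Qed.

Lemma hom1 (G G' : groupType) (f : G -> G') : {morph f : x y / x * y} -> f 1 = 1.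
Proof. by move=> fM; apply: (mulgI (f 1)); rewrite -fM !mulg1. Qed.

Lemma homV (G G' : groupType) (f : G -> G') : {morph f : x y / x * y} ->
  forall x, f x^-1 = (f x)^-1.
Proof. by move=> fM x; apply: (mulgI (f x)); rewrite -fM !mulgV (hom1 fM). Qed.

Section FreeProP.
Variables (p : nat) (X : ptopologicalType) (U : topologicalGroupType) (i : X -> U).
Hypothesis pp : prime p.
Hypothesis cX : compact [set: X].
Hypothesis Ufree : is_free_pro_p_on p i.

Let pU : is_pro_p p U. Proof. by case: Ufree. Qed.
Let ci : continuous i. Proof. by case: Ufree. Qed.
Let i1 : i point = 1. Proof. by case: Ufree. Qed.
Let cU : compact [set: U]. Proof. by case: pU => -[]. Qed.

Lemma free_extend (E : finGroupType) (phi : X -> E) :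
    p.-group [set: E]%G -> lc phi -> phi point = 1 ->
  exists h : U -> E,
    [/\ {morph h : x y / x * y}, lc h & forall x, h (i x) = phi x].
Proof.
move=> pE lphi phi1; case: Ufree => _ _ _ /(_ (discrete_group E) phi).
case=> [|||h [[[hM hc] hi] _]].
- exact: discrete_is_pro_p.
- exact: lc_discrete.
- exact: phi1.
exists h; split=> //; first exact: discrete_lc.
by move=> x; rewrite -[RHS](congr1 (fun g => g x) hi).
Qed.

(** Generation comes from the uniqueness half of the universal property. If the image of [S] in
    [U/N] were proper, it would lie in a maximal, hence normal, subgroup [M]; the projection to the
    quotient by [M] and the trivial homomorphism would then be two different extensions of the same
    map on [X]. *)
Lemma free_gen (S N : set U) :
  is_subgroup S -> opn N -> N `<=` S -> (forall x, S (i x)) -> forall u, S u.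
Proof.
move=> sS oN NS Si.
have [E [q [pE qM qN qs]]] := opn_quotient pp pU oN.
pose im := [set e | `[< exists2 x, S x & q x = e >]]%SET.
have imP e : reflect (exists2 x, S x & q x = e) (e \in im) by rewrite inE; exact: asboolP.
have gim : group_set im.
  apply/group_setP; split; first by apply/imP; exists 1; [exact: sub1|exact: hom1].
  by move=> _ _ /imP [x Sx <-] /imP [y Sy <-]; apply/imP; exists (x * y); [exact: subM|].
pose D := Group gim.
case: (maximal_exists (finset.subsetT D)) => [DT|[M maxM DM]].
  move=> u; have /imP [s Ss qs'] : q u \in D by rewrite DT inE.
  rewrite -[u](mulgVK s); apply: subM => //; apply: NS; apply/qN.
  by rewrite qM (homV qM) qs' mulgV.
have nM : M <| [set: E]%G by exact: p_maximal_normal pE maxM.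
pose c (u : U) := coset M (q u).
have nME e : e \in 'N(M) by apply: (fintype.subsetP (normal_norm nM)); rewrite inE.
have cM : {morph c : x y / x * y} by move=> x y; rewrite /c qM morphM.
have cc : continuous (c : U -> discrete_group (coset_of M)).
  apply: lc_discrete; apply: (lc_hom oN cM) => x Nx.
  by rewrite /c (iffRL (qN x) Nx) coset_id.
have pQ : p.-group [set: coset_of M]%G.
  by have := quotient_pgroup M pE; rewrite /pgroup quotientT.
case: Ufree => _ _ _ /(_ (discrete_group (coset_of M)) (fun=> 1)).
case=> [|||h [_ hun]].
- exact: discrete_is_pro_p.
- exact: cst_continuous.
- by [].
have h1 : h = c.
  apply: hun; split; first by split.
  apply/funext => x /=; apply: coset_id; apply: (fintype.subsetP DM).
  by apply/imP; exists (i x).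
have h2 : h = fun=> 1.
  apply: hun; split; last by [].
  split; last exact: cst_continuous.
  by move=> x y; rewrite mulg1.
suff : [set: E]%SET \subset M by move=> EM; have := maxgroupp maxM; rewrite properE EM andbF.
apply/fintype.subsetP => e _; have [u <-] := qs e.
by apply: coset_idr; [exact: nME|rewrite -/(c u) -h1 h2].
Qed.

(** The right periods of [f - g] form a subgroup that contains an open normal subgroup and the
    generators, so [f - g] is constant. *)
Lemma integral_unique (M : zmodType) (f g : U -> M) : lc f -> lc g -> f 1 = g 1 ->
  (forall u x, f (u * i x)%g - f u = g (u * i x)%g - g u)%R -> f = g.
Proof.
move=> lf lg fg1 fg; pose e u := (f u - g u)%R.
have le : lc e by exact: (lc_comp2 (fun a b => (a - b)%R) lf lg).
have [N [oN eN]] := lc_opn pU.1 le.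
pose S := [set s | forall u, e (u * s) = e u].
have sS : is_subgroup S.
  apply/subgroupP; split=> [u|s t Ss St u]; first by rewrite mulg1.
  by rewrite -[RHS]Ss -(St (u * _)) -!mulgA mulVg mulg1.
have ST : forall u, S u.
  apply: (free_gen sS oN) => [n Nn u|x u]; first by case: (eN n u Nn).
  rewrite /e -[f _](subrK (f u)) fg.
  by rewrite addrC !addrA addNr add0r addrC.
apply/funext => u; apply/eqP; rewrite -subr_eq0; apply/eqP.
have := ST u 1; rewrite mul1g /e => ->; by rewrite fg1 subrr.
Qed.

Lemma integral_in (M : zmodType) (L : M -> Prop) (f : U -> M) :
  L 0%R -> (forall a b, L a -> L b -> L (a - b)%R) -> lc f ->
  (forall u x, L (f (u * i x)%g - f u)%R) -> forall u, L (f u - f 1%g)%R.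
Proof.
move=> L0 LB lf fL.
have LN a : L a -> L (- a)%R by move=> La; rewrite -sub0r; exact: LB.
have LD a b : L a -> L b -> L (a + b)%R by move=> La Lb; rewrite -[b]opprK; apply: LB => //; exact: LN.
have [N [oN fN]] := lc_opn pU.1 lf.
pose S := [set s | forall u, L (f (u * s)%g - f u)%R].
have sS : is_subgroup S.
  apply/subgroupP; split=> [u|s t Ss St u]; first by rewrite mulg1 subrr.
  have := LD _ _ (Ss u) (LN _ (St (u * (s * t^-1)))).
  rewrite -!mulgA mulVg mulg1 opprB.
  by rewrite addrC !addrA subrK.
have ST : forall u, S u.
  by apply: (free_gen sS oN) => [n Nn u|x u] //; case: (fN n u Nn) => _ ->; rewrite subrr.
by move=> u; have := ST u 1; rewrite mul1g.
Qed.

(** [phi] factors through [E = U/N] in its first argument. By freeness there is a homomorphism to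
    the wreath product of [E] and ['F_p] that sends [i x] to [(q (i x), phi _ x)]. Its coordinate at
    1 is the integral, because a factor [i x] to the right of [u] contributes the value of [phi] at
    the class of [u]. *)
Lemma integrate_scalar (phi : U -> X -> 'F_p) :
  lc (fun z : U * X => phi z.1 z.2) -> (forall u, phi u point = 0%R) ->
  exists f : U -> 'F_p,
    [/\ lc f, f 1 = 0%R & forall u x, f (u * i x)%g = (f u + phi u x)%R].
Proof.
move=> lphi phi0.
have [|||N [oN phiN]] := @lc_smooth U pU.1 (U * X)%type
    (fun u z => (u * z.1, z.2)) _ (fun z => phi z.1 z.2) _ _ _ lphi.
- by have := compact_setX cU cX; rewrite setXTT.
- apply: continuous_pair; last by move=> z; apply: (cvg_comp _ _ cvg_snd cvg_snd).
  apply: continuousM => z; first exact: cvg_fst.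
  by apply: (cvg_comp _ _ cvg_snd cvg_fst).
- by case=> u x /=; rewrite mul1g.
have [E [q [pE qM qN qs]]] := opn_quotient pp pU oN.
have [r rK] := choice qs.
have phir u x : phi (r (q u)) x = phi u x.
  have := phiN (r (q u) * u^-1) (u, x); rewrite /= mulgVK; apply.
  by apply/qN; rewrite qM (homV qM) rK mulgV.
have lphix e : lc (fun x => phi e x).
  apply: (@lc_continuous _ _ _ (fun x => (e, x)) (fun z : U * X => phi z.1 z.2)) => //.
  by apply: continuous_pair; [exact: cst_continuous|exact: continuous_id].
pose psi x : wreath E 'F_p := (q (i x), [ffun e => phi (r e) x]).
have lq : lc q by apply: (lc_hom oN qM) => x /qN.
have lpsi : lc psi.
  move=> x; have H1 : nbhs x [set y | q (i y) = q (i x)] by exact: (lc_continuous ci lq x).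
  have H2 : nbhs x [set y | forall e, phi (r e) y = phi (r e) x].
    by apply: filter_forall => e; exact: lphix.
  apply: filterS2 H1 H2 => y /= H1 H2; congr pair; first exact: H1.
  by apply/ffunP => e; rewrite !ffunE.
have [||h [hM lh hi]] := @free_extend (wreath E 'F_p) psi _ lpsi.
- apply: wr_pgroup => //; rewrite /pgroup cardsT card_Fp // pnat_id //.
- congr pair; first by rewrite i1 (hom1 qM).
  by apply/ffunP => e; rewrite !ffunE phi0.
have h1 u : (h u).1 = q u.
  have [N' [oN' hN']] := lc_opn pU.1 lh.
  have oNN := opnI oN oN'.
  apply: (@free_gen [set u | (h u).1 = q u] _ _ oNN) => [|n [Nn N'n] /=|x /=].
  - apply/subgroupP; split; first by rewrite /= (hom1 hM) (hom1 qM).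
    by move=> x y /= hx hy; rewrite !hM !qM (homV hM) (homV qM) /= hx hy.
  - have [_] := hN' n 1 N'n; rewrite mul1g => ->; rewrite (hom1 hM) /=.
    by rewrite (iffRL (qN n)).
  - by rewrite hi.
exists (fun u => (h u).2 1); split.
- exact: (lc_comp (fun w : wreath E 'F_p => w.2 1) lh).
- by rewrite (hom1 hM) /= ffunE.
- move=> u x; rewrite hM hi /= !ffunE mul1g h1 phir; by [].
Qed.

Lemma integrate (P : Type) (phi : U -> X -> P -> 'F_p) :
  lc (fun z : U * X => phi z.1 z.2) -> (forall u, phi u point = 0%R) ->
  exists f : U -> P -> 'F_p,
    [/\ lc f, f 1 = 0%R & forall u x, f (u * i x)%g = (f u + phi u x)%R].
Proof.
move=> lphi phi0.
have [n [v vP]] : exists n (v : 'I_n -> P -> 'F_p), forall z : U * X, exists k, phi z.1 z.2 = v k.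
  by apply: (lc_fin_range _ lphi); have := compact_setX cU cX; rewrite setXTT.
pose idx (m : P -> 'F_p) := [pick k | `[< m = v k >]].
(* Indicator of the value [v k]: [idx] selects one index when [v] repeats a value, and the value
   zero is left out so that the indicator vanishes at the base point. *)
pose phi' k u x : 'F_p := (if (idx (phi u x) == Some k) && ~~ `[< v k = 0%R >] then 1 else 0)%R.
have /choice [f fP] : forall k, exists f : U -> 'F_p,
    [/\ lc f, f 1 = 0%R & forall u x, f (u * i x)%g = (f u + phi' k u x)%R].
  move=> k; apply: integrate_scalar.
    exact: (lc_comp (fun m => if (idx m == Some k) && ~~ `[< v k = 0%R >] then 1 else 0)%R lphi).
  move=> u; rewrite /phi' /idx; case: pickP => [k' /asboolP|_] //.
  rewrite phi0 => vk'; case: eqP => // -[<-]; rewrite -vk'.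
  by rewrite asboolT.
exists (fun u m => \sum_k (f k u * v k m))%R; split.
- have lff : lc (fun u => [ffun k => f k u]).
    move=> u; have : nbhs u [set u' | forall k, f k u' = f k u].
      by apply: filter_forall => k; case: (fP k) => lf _ _; exact: lf.
    by apply: filterS => u' /= H; apply/ffunP => k; rewrite !ffunE.
  have := lc_comp (fun g : {ffun 'I_n -> 'F_p} => fun m : P => \sum_k (g k * v k m))%R lff.
  congr lc; apply/funext => u; apply/funext => m /=.
  by apply: eq_bigr => k _; rewrite ffunE.
- apply/funext => m; rewrite big1 // => k _.
  by case: (fP k) => _ -> _; rewrite mul0r.
- move=> u x; apply/funext => m.
  have [k0 phik0] := vP (u, x); rewrite /= in phik0.
  have [k [ik vk]] : exists k, idx (phi u x) = Some k /\ phi u x = v k.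
    rewrite /idx; case: pickP => [k /asboolP ->|/(_ k0)]; first by exists k.
    by rewrite asboolT.
  rewrite (_ : (_ + _)%R m = (\sum_k f k u * v k m + phi u x m)%R) //.
  under eq_bigr => k' _ do (case: (fP k') => _ _ ->; rewrite mulrDl).
  rewrite big_split /=; congr (_ + _)%R.
  rewrite (bigD1 k) //= big1 => [|k' kk'].
    rewrite addr0 /phi' ik eqxx /=; case: asboolP => [vk0|_]; last by rewrite mul1r vk.
    by rewrite mul0r vk vk0.
  by rewrite /phi' ik; case: eqP => [[kk]|_]; rewrite ?mul0r //; move: kk'; rewrite kk eqxx.
Qed.

Lemma integral_exists (P : Type) (phi : U -> X -> P -> 'F_p) :
    lc (fun z : U * X => phi z.1 z.2) /\ (forall u, phi u point = 0%R) ->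
  exists f : U -> P -> 'F_p,
    [/\ lc f, f 1 = 0%R & forall u x, f (u * i x)%g = (f u + phi u x)%R].
Proof. by case; exact: integrate. Qed.

End FreeProP.

(* If [t] has order [p], a function [f] with [f (t * u) = f u + 1] has
   differences invariant under [t]; these are traces over [<t>] of some
   differences, hence [f] is a trace up to a constant and [f (t * u) = f u]. *)
Section TorsionFree.
Variables (p : nat) (X : ptopologicalType) (U : topologicalGroupType) (i : X -> U).
Hypothesis pp : prime p.
Hypothesis cX : compact [set: X].
Hypothesis Ufree : is_free_pro_p_on p i.

Let pU : is_pro_p p U. Proof. by case: Ufree. Qed.
Let ci : continuous i. Proof. by case: Ufree. Qed.
Let cU : compact [set: U]. Proof. by case: pU => -[]. Qed.

Lemma no_order_p (t : U) : t ^+ p = 1 -> t = 1.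
Proof.
move=> tp; apply/eqP/negPn/negP => t1.
have [N [oN Nt]] := opn_sep pU.1 t1.
have [E [q [pE qM qN qs]]] := opn_quotient pp pU oN.
have qX n : q (t ^+ n) = q t ^+ n.
  by elim: n => [|n IH]; [rewrite !expg0 (hom1 qM)|rewrite !expgS qM IH].
set s := q t in qX.
have s1 : s != 1 by apply/eqP => /qN.
have sp : s ^+ p = 1 by rewrite -qX tp (hom1 qM).
have os : #[s] = p.
  have : #[s] %| p by rewrite order_dvdn sp.
  by case/primeP: pp => _ H /H /orP [|/eqP //]; rewrite order_eq1 (negbTE s1).
(* [J e] is the exponent of [s] separating [e] from the representative of its coset. Read modulo
   [p], it gives a function [f] that grows by one under left multiplication by [t]. *)
pose rep e : E := repr (<[s]> :* e).
have repM e : rep (s * e) = rep e.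
  by rewrite /rep; congr repr; apply/rcoset_eqP; rewrite mem_rcoset mulgK cycle_id.
have /choice [J JP] : forall e, exists j : nat, e = s ^+ j * rep e.
  move=> e; rewrite /rep; case: repr_rcosetP => g /cycleP [j ->].
  by exists (#[s] - j %% #[s])%N; rewrite mulgA -expgD -[X in X * e](expg_mod_order s)
     -modnDmr subnK ?modnn ?mul1g // ltnW // ltn_mod order_gt0.
pose f u : 'F_p := ((J (q u))%:R)%R.
have eqF m n : m = n %[mod p] -> (m%:R = n%:R :> 'F_p)%R.
  by move=> mn; rewrite -(Fp_nat_mod pp m) mn Fp_nat_mod.
have ft u : f (t * u) = (f u + 1)%R.
  rewrite /f qM -/s natr1; apply: eqF; apply/eqP; rewrite -os -eq_expg_mod_order.
  apply/eqP; apply: (mulIg (rep (q u))).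
  by rewrite -[in LHS](repM (q u)) -JP expgS -mulgA -JP.
have lq : lc q by apply: (lc_hom oN qM) => x /qN.
have lf : lc f by exact: (lc_comp (fun e => (J e)%:R : 'F_p)%R lq).
pose phi u x := (f (u * i x)%g - f u)%R.
(* Among the [p] translates of [u] by powers of [t] exactly one, numbered [j0] below, has [f = 0].
   Keeping the differences only there gives a function with trace [phi]. *)
pose phi' u x : unit -> 'F_p := fun=> if f u == 0%R then phi u x else 0%R.
have lphi' : lc (fun z : U * X => phi' z.1 z.2).
  have l1 : lc (fun z : U * X => f z.1) by apply: lc_continuous lf => z; exact: cvg_fst.
  have l2 : lc (fun z : U * X => f (z.1 * i z.2)).
    apply: (@lc_continuous _ _ _ (fun z : U * X => z.1 * i z.2) f) => //.
    apply: continuousM; first exact: continuous_fst.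
    exact: (continuous_compose (@continuous_snd U X) ci).
  exact: (lc_comp2 (fun a b (_ : unit) => if a == 0 then b - a else 0)%R l1 l2).
have i1 : i point = 1 by case: Ufree.
have [|f' [lf' f'1 f'P]] := integrate pp cX Ufree lphi'.
  by move=> u; apply/funext => m; rewrite /phi' /phi i1 mulg1 subrr if_same.
pose F u := (\sum_(j < p) f' (t ^+ j * u)%g tt)%R.
have FP u x : (F (u * i x)%g - F u = phi u x)%R.
  have phit j : phi (t ^+ j * u) x = phi u x.
    elim: j => [|j IH]; first by rewrite expg0 mul1g.
    rewrite -IH expgS /phi -!mulgA !ft; by rewrite opprD addrACA subrr addr0.
  have ftj j : f (t ^+ j * u) = (f u + j%:R)%R.
    elim: j => [|j IH]; first by rewrite expg0 mul1g addr0.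
    by rewrite expgS -mulgA ft IH -addrA natr1.
  rewrite -sumrB.
  pose j0 : 'I_p := Ordinal (leq_trans (ltn_ord (- f u)%R) (eq_leq (Fp_cast pp))).
  rewrite (bigD1 j0) //= big1 => [|j jj0].
    rewrite addr0 mulgA f'P addrC addKr /phi' ftj phit.
    by rewrite (natr_Zp (- f u)%R) addrN eqxx.
  rewrite mulgA f'P addrC addKr /phi' ftj phit; case: eqP => // fj.
  case/eqP: jj0; apply: val_inj => /=.
  have : (j%:R = - f u :> 'F_p)%R by apply/eqP; rewrite -addr_eq0 addrC fj.
  move/(congr1 val); rewrite /= val_Fp_nat // modn_small //.
have lF : lc F.
  have l j : lc (fun u => f' (t ^+ j * u) tt).
    apply: (@lc_continuous _ _ _ (fun u => t ^+ j * u) (fun u => f' u tt)).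
      by apply: continuousM; [exact: cst_continuous|exact: continuous_id].
    exact: (lc_comp (fun m => m tt) lf').
  move=> u; have : nbhs u [set v | forall j : 'I_p, f' (t ^+ j * v) tt = f' (t ^+ j * u) tt].
    by apply: filter_forall => j; exact: l.
  by apply: filterS => v /= H; apply: eq_bigr.
have Ff : (fun u => F u - F 1%g)%R = (fun u => f u - f 1%g)%R.
  apply: (integral_unique pp Ufree).
  - exact: (lc_comp (fun a => a - F 1%g)%R lF).
  - exact: (lc_comp (fun a => a - f 1%g)%R lf).
  - by rewrite !subrr.
  - by move=> u x; rewrite !opprB !addrA !subrK FP.
have Ft : F t = F 1.
  have cyc (g : nat -> 'F_p) n : g n = g 0%N -> (\sum_(j < n) g j.+1 = \sum_(j < n) g j)%R.
    by case: n => [|n] gn; rewrite ?big_ord0 // big_ord_recr big_ord_recl /= gn addrC.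
  rewrite /F -(cyc (fun j => f' (t ^+ j * 1) tt)); last by rewrite tp expg0.
  by apply: eq_bigr => j _; rewrite mulg1 expgSr.
have := congr1 (fun g => g t) Ff; rewrite /= Ft subrr.
rewrite -[t in f t]mulg1 ft -addrA [(1 + _)%R]addrC addrA subrr add0r.
by move/eqP; rewrite eq_sym oner_eq0.
Qed.

(** A non-trivial torsion element has a power of prime order [l]. That power survives in some finite
    p-quotient, so [l = p], which is the case of [no_order_p]. *)
Lemma free_torsion_free (x : U) : torsion x -> x = 1.
Proof.
move=> [n [n0 xn]]; apply: contrapT => x1.
have [|m /andP [m0 /eqP xm] mmin] := @ex_minnP (fun n => (0 < n)%N && (x ^+ n == 1)).
  by exists n; rewrite n0 xn eqxx.
have m1 : (1 < m)%N.
  by case: m m0 xm {mmin} => // -[|//] _; rewrite expg1.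
set l := pdiv m; have pl : prime l by exact: pdiv_prime.
have ld : l %| m by exact: pdiv_dvd.
pose y := x ^+ (m %/ l).
have yl : y ^+ l = 1 by rewrite /y -expgnA divnK.
have y1 : y != 1.
  apply/negP => y1; have := mmin (m %/ l)%N; rewrite y1 divn_gt0 ?prime_gt0 //.
  by rewrite dvdn_leq // leqNgt ltn_Pdiv ?prime_gt1 // => /(_ isT).
have [N [oN Ny]] := opn_sep pU.1 y1.
have [E [q [pE qM qN qs]]] := opn_quotient pp pU oN.
have qX k : q (y ^+ k) = q y ^+ k.
  by elim: k => [|k IH]; [rewrite !expg0 (hom1 qM)|rewrite !expgS qM IH].
have : #[q y] %| l by rewrite order_dvdn -qX yl (hom1 qM).
case/primeP: (pl) => _ H /H /orP []; first by rewrite order_eq1 => /eqP /qN.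
move/eqP => oy.
have : p.-nat l by rewrite -oy; apply: pnat_dvd pE; apply: order_dvdG; rewrite finset.in_setT.
rewrite pnatE // => /eqP lp; move: yl y1; rewrite lp => /no_order_p ->.
by rewrite eqxx.
Qed.
End TorsionFree.

(** * Profinite G-spaces *)

(* A profinite [G]-space presented by its algebra [B] of clopen sets: points
   that [B] does not separate are identified, so quotients of [O] are covered
   without changing the carrier. *)
Record bspace (G : topologicalGroupType) (O : Type) (act : G -> O -> O)
    (B : set (set O)) : Prop := BSpace {
  bsT : B setT;
  bsC : forall A, B A -> B (~` A);
  bsI : forall A A', B A -> B A' -> B (A `&` A');
  bs_cover : forall (I : Type) (W : I -> set O),
    (forall i, B (W i)) -> (forall o, exists i, W i o) ->
    exists n (u : 'I_n -> I), forall o, exists k, W (u k) o;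
  bs_act1 : forall o, act 1 o = o;
  bs_actM : forall g h o, act (g * h) o = act g (act h o);
  bs_act : forall g A, B A -> B [set o | A (act g o)];
  bs_smooth : forall A, B A ->
    exists N, opn N /\ forall n o, N n -> (A (act n o) <-> A o)
}.

Definition lcB (O T : Type) (B : set (set O)) (f : O -> T) :=
  forall o, exists A, [/\ B A, A o & forall o', A o' -> f o' = f o].

Definition indist (O : Type) (B : set (set O)) (o o' : O) :=
  forall A, B A -> A o -> A o'.

Section BSpaceTheory.
Variables (G : topologicalGroupType) (O : Type) (act : G -> O -> O).
Variable B : set (set O).
Hypothesis bO : bspace act B.

Lemma bs0 : B set0.
Proof. by rewrite -setCT; apply: (bsC bO); exact: (bsT bO). Qed.

Lemma bs_forall (I : finType) (W : I -> set O) :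
  (forall i, B (W i)) -> B [set o | forall i, W i o].
Proof.
move=> bW.
suff H (s : seq I) : B [set o | forall i, i \in s -> W i o].
  rewrite (_ : mkset _ = [set o | forall i, i \in enum I -> W i o]) //.
  by apply/seteqP; split=> o /= Ho i; [move=> _; exact: Ho|apply: Ho; rewrite mem_enum].
elim: s => [|j s IH].
  by rewrite (_ : mkset _ = setT); [exact: (bsT bO)|apply/seteqP; split].
rewrite (_ : mkset _ = W j `&` [set o | forall i, i \in s -> W i o]).
  exact: (bsI bO).
apply/seteqP; split=> o /=.
  by move=> Ho; split=> [|i si]; apply: Ho; rewrite inE ?eqxx ?si ?orbT.
by move=> [Wj Ws] i /[!inE] /orP [/eqP ->|] //; exact: Ws.
Qed.

Lemma bs_exists (I : finType) (W : I -> set O) :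
  (forall i, B (W i)) -> B [set o | exists i, W i o].
Proof.
move=> bW; have := bsC bO (bs_forall (fun i => bsC bO (bW i))).
rewrite (_ : ~` _ = [set o | exists i, W i o]) //.
by apply/seteqP; split=> o /=; [move/existsNP => [i /contrapT]; exists i|move=> [i Wi] /(_ i)].
Qed.

Lemma indist_sym o o' : indist B o o' -> indist B o' o.
Proof.
move=> oo' A bA Ao'; apply: contrapT => nAo.
exact: (oo' _ (bsC bO bA) nAo).
Qed.

Lemma indist_trans o o' o'' : indist B o o' -> indist B o' o'' -> indist B o o''.
Proof. by move=> oo' o'o'' A bA /(oo' _ bA) /(o'o'' _ bA). Qed.

Lemma indist_act g o o' : indist B o o' -> indist B (act g o) (act g o').
Proof. by move=> oo' A bA; exact: (oo' _ (bs_act bO g bA)). Qed.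

Lemma lcB_indist (T : Type) (f : O -> T) o o' : lcB B f -> indist B o o' -> f o' = f o.
Proof. by move=> lf oo'; have [A [bA Ao fA]] := lf o; apply: fA; exact: oo'. Qed.

Lemma lcB_comp (T T' : Type) (h : T -> T') (f : O -> T) : lcB B f -> lcB B (h \o f).
Proof. by move=> lf o; have [A [bA Ao fA]] := lf o; exists A; split=> // o' /fA /= ->. Qed.

Lemma lcB_comp2 (T T' T'' : Type) (h : T -> T' -> T'') (f : O -> T) (f' : O -> T') :
  lcB B f -> lcB B f' -> lcB B (fun o => h (f o) (f' o)).
Proof.
move=> lf lf' o; have [A [bA Ao fA]] := lf o; have [A' [bA' Ao' fA']] := lf' o.
exists (A `&` A'); split=> //; first exact: (bsI bO).
by move=> o' [/fA -> /fA' ->].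
Qed.

Lemma lcB_cst (T : Type) (t : T) : lcB B (fun=> t).
Proof. by move=> o; exists setT; split=> //; exact: (bsT bO). Qed.

Lemma lcB_act (T : Type) (f : O -> T) g : lcB B f -> lcB B (f \o act g).
Proof.
move=> lf o; have [A [bA Ao fA]] := lf (act g o).
by exists [set o | A (act g o)]; split=> //; [exact: (bs_act bO)|move=> o' /fA].
Qed.

Lemma lcB_forall (I : finType) (T : Type) (f : I -> O -> T) o :
  (forall i, lcB B (f i)) ->
  exists A, [/\ B A, A o & forall o', A o' -> forall i, f i o' = f i o].
Proof.
move=> lf; have /choice [W WP] := fun i => lf i o.
exists [set o' | forall i, W i o']; split.
- by apply: bs_forall => i; case: (WP i).
- by move=> i; case: (WP i).
- by move=> o' Wo' i; case: (WP i) => _ _; apply; exact: Wo'.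
Qed.

Lemma lcB_blocks (T : Type) (f : O -> T) : lcB B f ->
  exists n (u : 'I_n -> set O),
    [/\ forall k, B (u k), forall o, exists k, u k o &
        forall k o o', u k o -> u k o' -> f o = f o'].
Proof.
move=> lf.
pose I := {A : set O | B A /\ forall o o', A o -> A o' -> f o = f o'}.
have [||n [u uP]] := @bs_cover _ _ _ _ bO I sval.
- by case=> A [].
- move=> o; have [A [bA Ao fA]] := lf o.
  have HA : B A /\ forall o1 o2, A o1 -> A o2 -> f o1 = f o2.
    by split=> // o1 o2 /fA -> /fA ->.
  by exists (exist _ A HA).
exists n, (sval \o u); split=> //.
- by move=> k /=; case: (u k) => A [].
- by move=> k o o' /=; case: (u k) => A [] /= _; exact.
Qed.

Lemma lcB_smooth (T : Type) (f : O -> T) : lcB B f ->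
  exists N, opn N /\ forall n o, N n -> f (act n o) = f o.
Proof.
move=> /lcB_blocks [n [u [bu uc uf]]].
have /choice [N NP] := fun k => bs_smooth bO (bu k).
exists [set x | forall k, N k x]; split; first by apply: opn_forall => k; case: (NP k).
move=> x o Nx; have [k uk] := uc o; apply: (uf k) => //.
by apply/(proj2 (NP k)).
Qed.

Hypothesis pG : profinite_space G.
Variable Gam : set G.
Hypothesis sGam : is_subgroup Gam.
Hypothesis cGam : closed Gam.

Definition stab o : set G := [set e | Gam e /\ indist B o (act e o)].

Lemma coset_reps (N : set G) : opn N ->
  exists m (v : 'I_m -> G), (forall j, Gam (v j)) /\
    forall g, Gam g -> exists j n, [/\ N n, Gam n & g = v j * n].
Proof.
move=> oN; have [m [u uP]] := opn_fin_cover pG oN.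
have /choice [v vP] : forall j, exists v, Gam v /\
    forall g, Gam g -> N (g^-1 * (u j)^-1) -> N (v^-1 * (u j)^-1).
  move=> j; have [[g [Gg Ng]]|ng] := pselect (exists g, Gam g /\ N (g^-1 * (u j)^-1)).
    by exists g.
  by exists 1; split=> [|g Gg Ng]; [exact: sub1|case: ng; exists g].
exists m, v; split=> [j|g Gg]; first by case: (vP j).
have [j Nj] := uP g^-1; have [Gv Nv] := vP j.
exists j, ((v j)^-1 * g); split; last by rewrite mulKVg.
  have := opnM oN (Nv _ Gg Nj) (opnV oN Nj).
  by rewrite invgM !invgK mulgA mulgVK.
by apply: subM => //; exact: subV.
Qed.

(** The [g] in [Gam] outside [stab o] times [N0] form a compact set [K]. Each of them moves [o] off
    some member of [B], so a single [B0] around [o] serves for all of [K]. As [B0] is invariant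
    under an open [N], only finitely many cosets of [N] matter, and [W] leaves out the points of
    [B0] that their representatives bring back to [B0]. *)
Lemma slice o (N0 : set G) : opn N0 ->
  exists W, [/\ B W, W o & forall g w, Gam g -> W w -> W (act g w) ->
    exists e n, [/\ stab o e, N0 n, Gam n & g = e * n]].
Proof.
move=> oN0.
pose S := [set g | exists2 e, stab o e & N0 (e^-1 * g)].
have oS : open S.
  rewrite (_ : S = \bigcup_(e in stab o) [set g | N0 (e^-1 * g)]).
    apply: bigcup_open => e _; apply: (@open_comp G G (fun g => e^-1 * g)); last by case: oN0.
    by move=> g _; apply: continuousM; [exact: cst_continuous|exact: continuous_id].
  by apply/seteqP; split=> g [e] *; exists e.
pose K := Gam `&` ~` S.
have cK : compact K.
  case: pG => cG _ _; apply: subclosed_compact cG _ => //.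
  by apply: closedI => //; exact: open_closedC.
pose I := {A : set O | B A /\ A o}.
have [|A|g [Gg nSg]|m [u uP]] := @compact_fin_cover G I K (fun A => [set g | ~ sval A (act g o)]).
- exact: cK.
- case: A => A [bA Ao] /=; have [N [oN NA]] := bs_smooth bO bA.
  rewrite openE => g nAg.
  apply: filterS (@nbhs_rcoset G N g (proj1 oN) (opn1 oN)) => g' /= Ng'.
  by rewrite -[g'](mulgVK g) (bs_actM bO) (NA _ _ Ng').
- apply: contrapT => nA; apply: nSg; exists g; last by rewrite mulVg; exact: opn1.
  split=> // A bA Ao; apply: contrapT => nAg; apply: nA.
  by exists (exist _ A (conj bA Ao)).
pose B0 := [set w | forall k, sval (u k) w].
have bB0 : B B0 by apply: bs_forall => k; case: (u k) => A [].
have B0o : B0 o by move=> k; case: (u k) => A [].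
have B0K g : K g -> ~ B0 (act g o) by move=> /uP [k nk] /(_ k).
have [N [oN NB]] := bs_smooth bO bB0.
have [m' [v vP]] := opn_fin_cover pG oN.
pose J j := exists2 g, K g & N (g * (v j)^-1).
pose W := B0 `&` [set w | forall j, ~ (J j /\ B0 (act (v j) w))].
exists W; split.
- apply: (bsI bO) => //.
  apply: (@bs_forall _ (fun j => ~` [set w | J j /\ B0 (act (v j) w)])) => j; apply: (bsC bO).
  have [Jj|nJ] := pselect (J j).
    rewrite (_ : mkset _ = [set w | B0 (act (v j) w)]); first exact: (bs_act bO).
    by apply/seteqP; split=> w //=; case.
  rewrite (_ : mkset _ = set0); first exact: bs0.
  by apply/seteqP; split=> w //=; case.
- split=> // j [[g Kg Ng] B0v]; apply: (B0K _ Kg).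
  by rewrite -[g](mulgVK (v j)) (bs_actM bO); apply/NB.
- move=> g w Gg [B0w nw] [B0gw _].
  have [[e se Ne]|nSg] := pselect (S g).
    exists e, (e^-1 * g); split=> //; last by rewrite mulKVg.
    by apply: subM => //; apply: subV => //; case: se.
  have [j Nj] := vP g; case: (nw j); split; first by exists g.
  by move: B0gw; rewrite -[g](mulgVK (v j)) (bs_actM bO) => /NB; apply.
Qed.

Definition invariant_set (V : set O) := forall g o, Gam g -> (V (act g o) <-> V o).

(** From a finite cover by invariant pieces, each point uses the solution of a piece picked among
    those containing it. The points lying in the same pieces form an invariant member of [B] on
    which this choice is constant, so [locW] carries the property over to the glued function. *)
Lemma bs_glue (A : Type) (Loc : (O -> A) -> O -> Prop) :
    (forall V w w' o, B V -> invariant_set V -> (forall o', V o' -> w o' = w' o') ->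
       V o -> Loc w o -> Loc w' o) ->
    (forall o, exists V w, [/\ B V, invariant_set V, V o & forall o', V o' -> Loc w o']) ->
  exists w, forall o, Loc w o.
Proof.
move=> locW loc.
pose I := {V : set O | [/\ B V, invariant_set V & exists w, forall o, V o -> Loc w o]}.
have [||n [u uP]] := @bs_cover _ _ _ _ bO I sval.
- by case=> V [].
- move=> o; have [V [w [bV iV Vo Vw]]] := loc o.
  have HV : [/\ B V, invariant_set V & exists w, forall o, V o -> Loc w o].
    by split=> //; exists w.
  by exists (exist _ V HV).
have /choice [w wP] : forall k, exists w, forall o, sval (u k) o -> Loc w o.
  by move=> k; case: (u k) => V [].
pose c o := [pick k | `[< sval (u k) o >]].
have cP o : exists k, c o = Some k /\ sval (u k) o.
  rewrite /c; case: pickP => [k /asboolP|no]; first by exists k.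
  by have [k uk] := uP o; move: (no k); rewrite asboolT.
case: (pselect (exists o : O, True)) => [[o0 _]|nO]; last first.
  have f (o : O) : A by case: nO; exists o.
  by exists f => o; case: nO; exists o.
have [k0 _] := cP o0.
exists (fun o => if c o is Some k then w k o else w k0 o) => o.
have [k [ck uk]] := cP o.
pose V := [set o' | forall k', sval (u k') o' <-> sval (u k') o].
apply: (locW V (w k)) => //.
- apply: (@bs_forall _ (fun k' => [set o' | sval (u k') o' <-> sval (u k') o])) => k'.
  case: (u k') => V' [bV' _ _] /=.
  have [V'o|nV'o] := pselect (V' o).
    by rewrite (_ : mkset _ = V') //; apply/seteqP; split=> o' /= H; [exact/H|split].
  rewrite (_ : mkset _ = ~` V'); first exact: (bsC bO).
  by apply/seteqP; split=> o' /= H; [move/H|split=> // /H].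
- move=> g o' Gg; split=> H k'; rewrite -H; case: (u k') => V' [_ iV' _] /=.
    by split=> /(iV' _ _ Gg).
  by split=> /(iV' _ _ Gg).
- move=> o' Vo'; suff -> : c o' = c o by rewrite ck.
  by rewrite /c; apply: eq_pick => k'; apply: asbool_equiv_eq; exact: Vo'.
- exact: wP.
Qed.

End BSpaceTheory.

Lemma stab_subgroup (G : topologicalGroupType) (O : Type) (act : G -> O -> O)
    (B : set (set O)) (Gam : set G) (o : O) :
  bspace act B -> is_subgroup Gam -> is_subgroup (stab act B Gam o).
Proof.
move=> bO sG; apply/subgroupP; split.
  by split; [exact: sub1|move=> A bA; rewrite (bs_act1 bO)].
move=> e e' [Ge oe] [Ge' oe']; split; first by apply: subM => //; exact: subV.
rewrite (bs_actM bO); apply: indist_trans oe _; apply: (indist_act bO); apply: (indist_sym bO).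
have := indist_act bO (g := e'^-1) oe'.
by rewrite -(bs_actM bO) mulVg (bs_act1 bO).
Qed.

(** * A local-global principle for cocycles *)

(* [L] is a discrete [G]-submodule of the [G]-module [M]. *)
Record gmodule (G : topologicalGroupType) (M : zmodType) (a : G -> M -> M)
    (L : M -> Prop) : Prop := GModule {
  gm_1 : forall m, a 1 m = m;
  gm_M : forall g h m, a (g * h) m = a g (a h m);
  gm_B : forall g m m', a g (m - m')%R = (a g m - a g m')%R;
  gm_L0 : L 0%R;
  gm_LB : forall m m', L m -> L m' -> L (m - m')%R;
  gm_La : forall g m, L m -> L (a g m);
  gm_smooth : forall m, L m -> exists N, opn N /\ forall n, N n -> a n m = m
}.

Section GModuleTheory.
Variables (G : topologicalGroupType) (M : zmodType) (a : G -> M -> M) (L : M -> Prop).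
Hypothesis gM : gmodule a L.

Lemma gm_0 g : a g 0%R = 0%R.
Proof. by rewrite -[X in a g X](subrr 0%R) (gm_B gM) subrr. Qed.
Lemma gm_N g m : a g (- m)%R = (- a g m)%R.
Proof. by rewrite -sub0r (gm_B gM) gm_0 sub0r. Qed.
Lemma gm_D g m m' : a g (m + m')%R = (a g m + a g m')%R.
Proof. by rewrite -[m' in LHS]opprK (gm_B gM) gm_N opprK. Qed.
Lemma gm_LN m : L m -> L (- m)%R.
Proof. by move=> Lm; rewrite -sub0r; apply: (gm_LB gM) => //; exact: (gm_L0 gM). Qed.
Lemma gm_LD m m' : L m -> L m' -> L (m + m')%R.
Proof. by move=> Lm Lm'; rewrite -[m']opprK; apply: (gm_LB gM) => //; exact: gm_LN. Qed.
Lemma gm_Lsum (I : finType) (P : pred I) (f : I -> M) :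
  (forall i, P i -> L (f i)) -> L (\sum_(i | P i) f i)%R.
Proof. by move=> Lf; apply: big_ind => //; [exact: (gm_L0 gM)|exact: gm_LD]. Qed.

(** No continuity is imposed on [al]: this is applied to subgroups on which [rho] is injective, and
    these are finite. *)
Definition H1van (E : set G) := forall al : G -> M,
  (forall e, E e -> L (al e)) ->
  (forall e e', E e -> E e' -> al (e * e') = (al e + a e (al e'))%R) ->
  exists d, L d /\ forall e, E e -> al e = (a e d - d)%R.

Lemma H1van_trivial (E : set G) : (forall e, E e -> e = 1) -> H1van E.
Proof.
move=> E1 al alL alM; exists 0%R; split=> [|e Ee]; first exact: (gm_L0 gM).
rewrite gm_0 subr0; have := E1 _ Ee => e1; rewrite e1 in Ee *.
have := alM 1 1 Ee Ee; rewrite mulg1 (gm_1 gM) => al1.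
by apply: (addrI (al 1)); rewrite -al1 addr0.
Qed.

End GModuleTheory.

Section LocalGlobal.
Variables (G : topologicalGroupType) (O : Type) (act : G -> O -> O) (B : set (set O)).
Hypothesis bO : bspace act B.
Hypothesis pG : profinite_space G.
Variable Gam : set G.
Hypothesis sGam : is_subgroup Gam.
Hypothesis cGam : closed Gam.
Variables (M : zmodType) (a : G -> M -> M) (L : M -> Prop).
Hypothesis gM : gmodule a L.
Variable Os : set O.
Hypothesis Os_closed :
  forall o, ~ Os o -> exists A, [/\ B A, A o & forall o', A o' -> ~ Os o'].
Hypothesis Os_inv : forall g o, Gam g -> Os o -> Os (act g o).
Variable c : G -> O -> M.
Hypothesis c_lc : forall g, Gam g -> lcB B (c g).
Hypothesis c_L : forall g o, Gam g -> L (c g o).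
Hypothesis c_Os : forall g o, Gam g -> Os o -> c g o = 0%R.
Hypothesis c_M : forall g h o, Gam g -> Gam h ->
  c (g * h) o = (c g o + a g (c h (act g^-1%g o)))%R.
Hypothesis c_smooth : exists N, opn N /\ forall n o, N n -> Gam n -> c n o = 0%R.
Hypothesis c_van : forall o, ~ Os o -> H1van a L (stab act B Gam o).

Let actK g o : act g (act g^-1%g o) = o.
Proof. by rewrite -(bs_actM bO) mulgV (bs_act1 bO). Qed.
Let actVK g o : act g^-1%g (act g o) = o.
Proof. by rewrite -(bs_actM bO) mulVg (bs_act1 bO). Qed.
Let GV g : Gam g -> Gam g^-1. Proof. exact: subV. Qed.
Let GM g h : Gam g -> Gam h -> Gam (g * h). Proof. exact: subM. Qed.

Let Loc (w : O -> M) (o : O) :=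
  [/\ exists A, [/\ B A, A o & forall o', A o' -> w o' = w o], L (w o),
      Os o -> w o = 0%R &
      forall g, Gam g -> c g o = (a g (w (act g^-1%g o)) - w o)%R].

Let Loc_local V w w' o : B V -> invariant_set act Gam V ->
  (forall o', V o' -> w o' = w' o') -> V o -> Loc w o -> Loc w' o.
Proof.
move=> bV iV ww' Vo [[A [bA Ao wA]] Lw wOs wc]; split.
- exists (A `&` V); split=> //; first exact: (bsI bO).
  by move=> o' [Ao' Vo']; rewrite -!ww' // wA.
- by rewrite -ww'.
- by rewrite -ww'.
- move=> g Gg; rewrite -!ww' //; first exact: wc.
  by apply/iV => //; exact: GV.
Qed.

Let cN N g n o : opn N -> (forall n o, N n -> Gam n -> c n o = 0%R) ->
  Gam g -> N n -> Gam n -> c (g * n) o = c g o.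
Proof. by move=> oN NP Gg Nn Gn; rewrite c_M // (NP n) // (gm_0 gM) addr0. Qed.

Let delta o : exists d, [/\ L d, Os o -> d = 0%R &
  forall e, stab act B Gam o e -> c e o = (a e d - d)%R].
Proof.
have [Oo|nOo] := pselect (Os o).
  exists 0%R; split=> //; first exact: (gm_L0 gM).
  by move=> e [Ge _]; rewrite c_Os // (gm_0 gM) subr0.
have [||d [Ld dP]] := c_van nOo (al := fun e => c e o).
- by move=> e [Ge _]; exact: c_L.
- move=> e e' [Ge oe] [Ge' oe']; rewrite c_M //; congr (_ + a e _)%R.
  apply: (lcB_indist (c_lc Ge')).
  have := indist_act bO (g := e^-1) oe; rewrite actVK; exact: (indist_sym bO).
by exists d; split.
Qed.

(** Let [d] be the solution on the stabilizer of [o]. Demanding [w = d] on the slice [W'] forces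
    [w o' = a g d - c g o'] whenever [g^-1] carries [o'] into [W']. Two such [g] differ by a product
    [e * n] with [e] in the stabilizer and [n] in [N0]; [e] is harmless by the choice of [d], and
    [n] fixes [d] and has [c n = 0]. *)
Let local o : exists V w, [/\ B V, invariant_set act Gam V, V o & forall o', V o' -> Loc w o'].
Proof.
have [d [Ld dOs dP]] := delta o.
have [N1 [oN1 N1d]] := gm_smooth gM Ld.
have [N2 [oN2 N2c]] := c_smooth.
have oN0 := opnI oN1 oN2; set N0 := N1 `&` N2 in oN0.
have [W [bW Wo Wsl]] := slice bO pG sGam cGam o oN0.
have [m [v [Gv vP]]] := coset_reps pG sGam oN0.
have [A1 [bA1 A1o cA1]] := lcB_forall bO o (fun j => c_lc (Gv j)).
(* [c e] depends only on the class of [e] modulo [N2], so the finitely many [v j] suffice to find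
   one neighbourhood for all [e]. *)
have cW e z : Gam e -> A1 z -> c e z = c e o.
  move=> Ge A1z; have [j [n [[_ N2n] Gn ->]]] := vP e Ge.
  by rewrite !(cN _ oN2) // cA1.
have [A2 [bA2 A2o A2Os]] : exists A, [/\ B A, A o & forall o', A o' -> Os o' -> Os o].
  have [Oo|nOo] := pselect (Os o); first by exists setT; split=> //; exact: (bsT bO).
  by have [A [bA Ao nA]] := Os_closed nOo; exists A; split=> // o' /nA.
pose W' := W `&` (A1 `&` A2).
have bW' : B W' by apply: (bsI bO) => //; exact: (bsI bO).
have [N3 [oN3 N3W]] := bs_smooth bO bW'.
have [m' [v' [Gv' v'P]]] := coset_reps pG sGam oN3.
pose V := [set o' | exists g, Gam g /\ W' (act g^-1%g o')].
have bV : B V.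
  rewrite (_ : V = [set o' | exists j, W' (act (v' j)^-1 o')]).
    by apply: (bs_exists bO (W := fun j => [set o' | W' (act (v' j)^-1 o')])) => j; exact: (bs_act bO).
  apply/seteqP; split=> o' /=; last by move=> [j Wj]; exists (v' j).
  move=> [g [Gg]]; have [j [n [Nn Gn ->]]] := v'P g Gg.
  by rewrite invgM (bs_actM bO) => /N3W Wj; exists j; apply: Wj; exact: opnV.
have iV : invariant_set act Gam V.
  move=> h o' Gh; split=> [] [g [Gg Wg]].
    by exists (h^-1 * g); split; [apply: GM => //; exact: GV|rewrite invgM invgK (bs_actM bO)].
  by exists (h * g); split; [exact: GM|rewrite invgM (bs_actM bO) actVK].
have Vo : V o.
  by exists 1; split; [exact: sub1|rewrite invg1 (bs_act1 bO)].
pose val g o' := (a g d - c g o')%R.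
have key o' g g1 : Gam g -> Gam g1 -> W' (act g^-1%g o') -> W' (act g1^-1%g o') ->
    val g o' = val g1 o'.
  move=> Gg Gg1 [Wg [A1g _]] [Wg1 _].
  have [||e [n [se [N1n N2n] Gn gen]]] := Wsl (g^-1 * g1) (act g1^-1%g o') _ Wg1.
  - by apply: GM => //; exact: GV.
  - by rewrite (bs_actM bO) actK.
  have -> : g1 = g * e * n by rewrite -mulgA -gen mulKVg.
  have Ge : Gam e by case: se.
  rewrite /val (cN _ oN2) //; last exact: GM.
  rewrite (gm_M gM) (N1d _ N1n) (gm_M gM) c_M // (cW e) // (dP e se) (gm_B gM).
  by rewrite opprD opprB addrCA (addrCA (a g (a e d))) subrr addr0 addrC.
pose w o' : M := if pselect (V o') is left Vo' then val (sval (cid Vo')) o' else 0%R.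
have wE o' g : Gam g -> W' (act g^-1%g o') -> w o' = val g o'.
  move=> Gg Wg; rewrite /w; case: pselect => [Vo'|]; last by case; exists g.
  by case: (cid Vo') => g' [Gg' Wg'] /=; exact: key.
exists V, w; split=> // o' [g [Gg Wg]]; split.
- have [A [bA Ao' cA]] := c_lc Gg o'.
  exists (A `&` [set o'' | W' (act g^-1%g o'')]); split=> //.
    by apply: (bsI bO) => //; exact: (bs_act bO).
  by move=> o'' [Ao'' Wo'']; rewrite !(wE _ g) // /val cA.
- rewrite (wE _ g) //; apply: (gm_LB gM); last exact: c_L.
  exact: (gm_La gM).
- move=> Oo'; have Oz : Os (act g^-1%g o') by apply: Os_inv => //; exact: GV.
  have Oo : Os o by apply: A2Os Oz; case: Wg => _ [].
  by rewrite (wE _ g) // /val (dOs Oo) (gm_0 gM) c_Os // subrr.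
- move=> h Gh; have Wgh : W' (act (h^-1 * g)^-1%g (act h^-1%g o')).
    by rewrite invgM invgK (bs_actM bO) actK.
  have Ghg : Gam (h^-1 * g) by apply: GM => //; exact: GV.
  rewrite (wE o' g) // (wE _ (h^-1 * g)%g) // /val (gm_B gM) -(gm_M gM) mulKVg.
  have -> : c g o' = (c h o' + a h (c (h^-1 * g)%g (act h^-1%g o')))%R.
    by rewrite -c_M // mulKVg.
  by rewrite opprB addrC addrA subrK addrK.
Qed.

(** Stabilizers of points outside [Os] decide whether the cocycle is trivial. [Os] takes up the
    points where vanishing is imposed: in [lower] those with a direction at the base point, so that
    the solution can be integrated, and in [H1van_DL] a fixed point at which the cocycle has been
    normalized. *)
Theorem local_coboundary : exists w : O -> M,
  [/\ lcB B w, forall o, L (w o), forall o, Os o -> w o = 0%R &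
      forall g o, Gam g -> c g o = (a g (w (act g^-1%g o)) - w o)%R].
Proof.
have [w wP] := bs_glue bO Loc_local local.
by exists w; split=> [o|o|o|g o]; case: (wP o) => // ? ? ? H; exact: H.
Qed.

End LocalGlobal.

(** * Differences of functions on a power of a group *)

Section Differences.
Variables (H : finGroupType) (U : groupType) (M : zmodType).
Implicit Types (z : H -> U) (f : (H -> U) -> M) (t : H) (v : U) (s : seq H).

Definition upd (T : Type) (z : H -> T) (t : H) (u : T) : H -> T :=
  fun t' => if t' == t then u else z t'.

Definition mulz z t v := upd z t (z t * v).

Definition diff t v f : (H -> U) -> M := fun z => (f (mulz z t v) - f z)%R.

(* [diffs s y f] is the mixed difference of [f] in the directions [t \in s]
   with increments [y t]. *)
Definition diffs s (y : H -> U) f := foldr (fun t f => diff t (y t) f) f s.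

Definition indep f t := forall z u, f (upd z t u) = f z.

Lemma updK (T : Type) (z : H -> T) t : upd z t (z t) = z.
Proof. by apply/funext => t'; rewrite /upd; case: eqP => [->|]. Qed.

Lemma upd_upd (T : Type) (z : H -> T) t u u' : upd (upd z t u) t u' = upd z t u'.
Proof. by apply/funext => t'; rewrite /upd; case: eqP. Qed.

Lemma updC (T : Type) (z : H -> T) t t' u u' : t != t' ->
  upd (upd z t u) t' u' = upd (upd z t' u') t u.
Proof.
move=> tt'; apply/funext => t''; rewrite /upd; case: eqP => [->|//].
by rewrite eq_sym (negbTE tt').
Qed.

Lemma upd_same (T : Type) (z : H -> T) t u : upd z t u t = u.
Proof. by rewrite /upd eqxx. Qed.

Lemma upd_other (T : Type) (z : H -> T) t t' u : t' != t -> upd z t u t' = z t'.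
Proof. by rewrite /upd => /negbTE ->. Qed.

Lemma diffC t t' v v' f : t != t' -> diff t v (diff t' v' f) = diff t' v' (diff t v f).
Proof.
move=> tt'; apply/funext => z; rewrite /diff /mulz.
rewrite [upd z t _ t']upd_other 1?eq_sym // [upd z t' _ t]upd_other //.
rewrite updC // !opprB [LHS]addrACA [RHS]addrACA.
by congr (_ + _)%R; rewrite addrC.
Qed.

Lemma diffs_rem s y f t : uniq s -> t \in s ->
  diffs s y f = diff t (y t) (diffs (rem t s) y f).
Proof.
elim: s => [//|t' s IH] /= /andP [nt' us]; rewrite inE.
case: (eqVneq t' t) => [->//|t't] /= ts.
by rewrite IH // diffC.
Qed.

Lemma diffs_perm s s' y f : uniq s -> perm_eq s s' -> diffs s y f = diffs s' y f.
Proof.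
elim: s s' => [|t s IH] s' us ss'.
  by move: ss'; rewrite perm_sym => /perm_nilP ->.
have ts' : t \in s' by rewrite -(perm_mem ss') mem_head.
have us' : uniq s' by rewrite -(perm_uniq ss').
rewrite (diffs_rem _ _ us' ts') /=; congr diff; apply: IH; first by case/andP: us.
by rewrite -(perm_cons t) (perm_trans ss') // perm_to_rem.
Qed.

Lemma diffsB s y f f' : diffs s y (fun z => f z - f' z)%R =
  (fun z => diffs s y f z - diffs s y f' z)%R.
Proof.
elim: s => [//|t s IH] /=; rewrite IH; apply/funext => z; rewrite /diff.
by rewrite !opprB [LHS]addrACA [RHS]addrACA; congr (_ + _)%R; exact: addrC.
Qed.

Lemma diffsD s y f f' : diffs s y (fun z => f z + f' z)%R =
  (fun z => diffs s y f z + diffs s y f' z)%R.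
Proof. by elim: s => [//|t s IH] /=; rewrite IH; apply/funext => z; rewrite /diff opprD addrACA. Qed.

Lemma diffs_sum (I : finType) (P : pred I) s y (F : I -> (H -> U) -> M) :
  diffs s y (fun z => \sum_(k | P k) F k z)%R = (fun z => \sum_(k | P k) diffs s y (F k) z)%R.
Proof.
elim: s => [//|t s IH] /=; rewrite IH; apply/funext => z.
by rewrite /diff -sumrB.
Qed.

Lemma indep_diffs s y f t : indep f t -> t \notin s -> indep (diffs s y f) t.
Proof.
move=> ft; elim: s => [//|t' s IH] /=; rewrite inE negb_or => /andP [tt' /IH fs] z u.
rewrite /diff /mulz upd_other 1?eq_sym // updC // !fs //.
Qed.

Lemma diffs_indep s y f t : uniq s -> t \in s -> indep f t -> diffs s y f = fun=> 0%R.
Proof.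
move=> us ts ft; rewrite (diffs_rem _ _ us ts).
have fr : indep (diffs (rem t s) y f) t by apply: indep_diffs; rewrite ?mem_rem_uniq ?inE ?eqxx.
by apply/funext => z; rewrite /diff /mulz fr subrr.
Qed.

Lemma diffs_1 s y f t : uniq s -> t \in s -> y t = 1 -> diffs s y f = fun=> 0%R.
Proof.
move=> us ts yt; rewrite (diffs_rem _ _ us ts) yt.
by apply/funext => z; rewrite /diff /mulz mulg1 updK subrr.
Qed.

Lemma diffs_const s y f t : t \in s -> (forall z z', f z = f z') ->
  diffs s y f = fun=> 0%R.
Proof.
case: s => [//|t' s] _ fc; have E : diffs [:: t'] y f = fun=> 0%R.
  by apply/funext => z; rewrite /= /diff (fc _ z) subrr.
have : forall s z z', diffs s y f z = diffs s y f z'.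
  by elim=> [//|t'' s' IH] z z'; rewrite /= /diff (IH (mulz z _ _) z) (IH (mulz z' _ _) z') !subrr.
by move=> C; apply/funext => z; rewrite /= /diff (C s _ z) subrr.
Qed.

Lemma indep_off (A : pred H) f z z' : (forall t, ~~ A t -> indep f t) ->
  (forall t, A t -> z t = z' t) -> f z = f z'.
Proof.
move=> fA zA.
have E (s : seq H) : f (fun t => if (t \in s) then z' t else z t) = f z.
  elim: s => [//|t s IH].
  case: (boolP (A t)) => At.
    rewrite -IH; congr f; apply/funext => t'; rewrite inE.
    by case: eqP => //= ->; rewrite zA //; case: ifP.
  rewrite -IH -(fA t At (fun t' => if t' \in s then z' t' else z t') (z' t)); congr f.
  by apply/funext => t'; rewrite inE /upd; case: eqP => [->|].
rewrite -(E (enum H)); congr f; apply/funext => t; by rewrite mem_enum.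
Qed.

Lemma diffs_eq_in s y y' f : {in s, y =1 y'} -> diffs s y f = diffs s y' f.
Proof.
elim: s => [//|t s IH] yy' /=; rewrite yy' ?mem_head // IH // => t' ts'.
by apply: yy'; rewrite inE ts' orbT.
Qed.

End Differences.

(** * Tensor induction *)

Lemma compact_prod_topology (H : finType) (V : topologicalType) :
  compact [set: V] -> compact [set: prod_topology (fun _ : H => V)].
Proof.
move=> cV; have := @tychonoff H (fun _ => V) (fun _ => setT) (fun _ => cV).
by rewrite (_ : mkset _ = setT) //; apply/seteqP; split.
Qed.

Lemma continuous_eval (I : eqType) (V : I -> topologicalType) (t : I) :
  continuous (fun f : prod_topology V => f t).
Proof. exact: (@proj_continuous I V t). Qed.

(* [G] acts on [H -> U] by tensor induction along the cocycle [kappa], and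
   the kernel of [rho] acts freely. In a point [(A, (z, x))] the values of [z]
   and [x] outside [A] are irrelevant: [BO] only sees those on [A]. *)
Section PartialSections.
Variables (G U : topologicalGroupType) (X : topologicalType) (H : finGroupType).
Variables (rho : G -> H) (F : set G) (kappa : G -> H -> U).
Hypothesis rhoM : {morph rho : x y / x * y}.
Hypothesis rhoF : forall n, F n -> rho n = 1.
Hypothesis pU : profinite_space U.
Hypothesis cX : compact [set: X].
Hypothesis kappaM : forall g g' h, kappa (g * g') h = kappa g (rho g' * h) * kappa g' h.
Hypothesis kappa_smooth : forall N, opn N ->
  exists N', [/\ opn N', N' `<=` F & forall n h, N' n -> N (kappa n h)].
Hypothesis kappa_inj : forall g h, rho g = 1 -> kappa g h = 1 -> g = 1.

Let T := ((H -> U) * (H -> X))%type.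
Let O := ({set H} * T)%type.

(** For a section [s] of [rho] and [kappa g h = (s (rho g * h))^-1 * g * s h], the tuple [z] stands
    for the family of the [s h * z h], and the action is left multiplication by [g] on this
    family. *)
Definition actZ (g : G) (z : H -> U) : H -> U :=
  fun h => kappa g ((rho g)^-1 * h) * z ((rho g)^-1 * h).

Definition actO (g : G) (o : O) : O :=
  ([set rho g * t | t in o.1]%SET, (actZ g o.2.1, fun h => o.2.2 ((rho g)^-1 * h))).

Definition level (N : set U) (K : finType) (c : X -> K) (A : {set H}) (v v' : T) :=
  forall t, t \in A -> N ((v.1 t)^-1 * v'.1 t) /\ c (v.2 t) = c (v'.2 t).

(** A point records a place [z] in [U^H] and, for each [t] in [A], the generator [x t] along which a
    difference is taken in coordinate [t]. The mixed differences of a function on [U^H] are thus a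
    function on this space. *)
Definition BO : set (set O) := [set W | exists N (K : finType) (c : X -> K),
  [/\ opn N, lc c & forall A v v', level N c A v v' -> W (A, v) -> W (A, v')]].

Lemma level_sym N (K : finType) (c : X -> K) A v v' :
  opn N -> level N c A v v' -> level N c A v' v.
Proof.
move=> oN vv' t tA; have [Nv cv] := vv' t tA; split=> //.
by have := opnV oN Nv; rewrite invgM invgK.
Qed.

Lemma level_trans N (K : finType) (c : X -> K) A v v' v'' :
  opn N -> level N c A v v' -> level N c A v' v'' -> level N c A v v''.
Proof.
move=> oN vv' v'v'' t tA; have [Nv ->] := vv' t tA; have [Nv' ->] := v'v'' t tA.
by split=> //; have := opnM oN Nv Nv'; rewrite !mulgA mulgK.
Qed.

Lemma actZ_1 z : actZ 1 z = z.
Proof.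
apply/funext => h; rewrite /actZ (hom1 rhoM) invg1 mul1g.
have := kappaM 1 1 h; rewrite mulg1 (hom1 rhoM) mul1g => k1.
by rewrite (_ : kappa 1 h = 1) ?mul1g //; apply: (mulgI (kappa 1 h)); rewrite -k1 mulg1.
Qed.

Lemma actZ_M g g' z : actZ (g * g') z = actZ g (actZ g' z).
Proof.
apply/funext => h; rewrite /actZ rhoM kappaM invgM -!mulgA.
by rewrite mulKVg.
Qed.

Lemma actO_1 o : actO 1 o = o.
Proof.
case: o => A [z x]; rewrite /actO /= actZ_1 (hom1 rhoM) invg1.
congr (_, (_, _)); last by apply/funext => h; rewrite mul1g.
by rewrite -[RHS]imset_id; apply: eq_imset => t; rewrite mul1g.
Qed.

Lemma actO_M g g' o : actO (g * g') o = actO g (actO g' o).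
Proof.
case: o => A [z x]; rewrite /actO /= actZ_M rhoM.
congr (_, (_, _)); last by apply/funext => h; rewrite invgM mulgA.
by rewrite -imset_comp; apply: eq_imset => t; rewrite /= mulgA.
Qed.

Lemma level_act g N (K : finType) (c : X -> K) A v v' : level N c A v v' ->
  level N c [set rho g * t | t in A]%SET (actO g (A, v)).2 (actO g (A, v')).2.
Proof.
move=> vv' _ /imsetP [t tA ->] /=; rewrite /actZ mulKg.
by have [Nv cv] := vv' t tA; rewrite invgM -mulgA mulKg.
Qed.

Lemma level_near N (K : finType) (c : X -> K) : opn N -> exists N', [/\ opn N', N' `<=` F &
  forall n A v, N' n -> level N c A v (actO n (A, v)).2].
Proof.
move=> oN; have [N' [oN' N'F N'N]] := kappa_smooth oN.
exists N'; split=> // n A v Nn t tA /=; rewrite /actZ (rhoF (N'F _ Nn)) invg1 mul1g.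
by split=> //; have := opnJ (v.1 t) oN (N'N n t Nn).
Qed.

Lemma BO_bspace : bspace actO BO.
Proof.
split.
- exists setT, unit, (fun=> tt); split=> //; first exact: opnT.
  exact: lc_cst.
- move=> W [N [K [c [oN lcc WN]]]]; exists N, K, c; split=> // A v v' vv' nW Wv'.
  by apply: nW; apply: WN Wv'; exact: level_sym.
- move=> W W' [N [K [c [oN lcc WN]]]] [N' [K' [c' [oN' lcc' WN']]]].
  exists (N `&` N'), (K * K')%type, (fun x => (c x, c' x)); split.
  + exact: opnI.
  + exact: lc_comp2 lcc lcc'.
  + move=> A v v' vv' [Wv W'v]; split.
      by apply: (WN A v v' _ Wv) => t tA; case: (vv' t tA) => -[Nt _] [ct _].
    by apply: (WN' A v v' _ W'v) => t tA; case: (vv' t tA) => -[_ Nt] [_ ct].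
- move=> I W bW covW.
  pose TT := prod_topology (fun _ : H => (U * X)%type).
  pose vT (f : TT) : T := (fun t => (f t).1, fun t => (f t).2).
  have cUX : compact [set: U * X].
    by case: pU => cU _ _; have := compact_setX cU cX; rewrite setXTT.
  have fincov A : exists n (u : 'I_n -> I), forall v, exists k, W (u k) (A, v).
    have [|k|f _|n [u uP]] := @compact_fin_cover TT I setT (fun k => [set f | W k (A, vT f)]).
    + exact: compact_prod_topology.
    + have [N [K [c [oN lcc WN]]]] := bW k.
      rewrite openE => f Wf.
      pose Q t : set TT := [set f' | N ((f t).1^-1 * (f' t).1) /\ c (f' t).2 = c (f t).2].
      have nQ t : nbhs f (Q t).
        have nS : nbhs (f t) [set v : U * X | N ((f t).1^-1 * v.1) /\ c v.2 = c (f t).2].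
          exists ([set u | N ((f t).1^-1 * u)], [set x | c x = c (f t).2]) => //=.
          by split; [apply: nbhs_coset; [case: oN|exact: opn1]|exact: lcc].
        exact: (@continuous_eval _ (fun=> (U * X)%type) t f _ nS).
      apply: filterS (@filter_forall _ H Q _ _ nQ) => f' ff'.
      by apply: (WN _ _ _ _ Wf) => t _; case: (ff' t).
    + exact: covW.
    + exists n, u => -[z x]; have [k Wk] := uP (fun t => (z t, x t)) Logic.I.
      by exists k.
  have [n nP] := choice fincov.
  pose u A := sval (cid (nP A)).
  have uP A : forall v, exists k, W (u A k) (A, v) := svalP (cid (nP A)).
  pose J := {A : {set H} & 'I_(n A)}.
  exists #|{: J}|, (fun k => let: existT A l := enum_val k in u A l).
  move=> [A v]; have [l Wl] := uP A v.
  by exists (enum_rank (existT _ A l : J)); rewrite enum_rankK.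
- exact: actO_1.
- exact: actO_M.
- move=> g W [N [K [c [oN lcc WN]]]]; exists N, K, c; split=> // A v v' vv' /=.
  by apply: WN; exact: level_act.
- move=> W [N [K [c [oN lcc WN]]]].
  have [N' [oN' N'F N'N]] := level_near c oN.
  exists N'; split=> // n [A v] Nn.
  have nA : actO n (A, v) = (A, (actO n (A, v)).2).
    congr pair; rewrite /= (rhoF (N'F _ Nn)) -[RHS]imset_id.
    by apply: eq_imset => t; rewrite mul1g.
  have lv : level N c A v (actO n (A, v)).2 by exact: N'N.
  by rewrite nA; split; apply: WN => //; exact: level_sym.
Qed.

Lemma lcB_level (R : Type) (f : O -> R) : lcB BO f ->
  exists N (K : finType) (c : X -> K),
    [/\ opn N, lc c & forall A v v', level N c A v v' -> f (A, v) = f (A, v')].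
Proof.
move=> /(lcB_blocks BO_bspace) [n [u [bu uc uf]]].
have [N NP] := choice bu; have [K KP] := choice NP.
pose c k := sval (cid (KP k)).
have cP k : [/\ opn (N k), lc (c k) & forall A v v', level (N k) (c k) A v v' ->
  u k (A, v) -> u k (A, v')] := svalP (cid (KP k)).
exists [set x | forall k, N k x], {dffun forall k, K k}, (fun x => [ffun k => c k x]); split.
- by apply: opn_forall => k; case: (cP k).
- move=> x; have : nbhs x [set y | forall k, c k y = c k x].
    by apply: filter_forall => k; case: (cP k) => _ + _; apply.
  by apply: filterS => y /= yx; apply/ffunP => k; rewrite !ffunE.
- move=> A v v' vv'; have [k uk] := uc (A, v).
  apply: (uf k) => //; case: (cP k) => _ _; apply; last exact: uk.
  move=> t tA; have [Nv /ffunP cv] := vv' t tA; split; first exact: Nv.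
  by have := cv k; rewrite !ffunE.
Qed.

Lemma level_lcB (R : Type) (f : O -> R) N (K : finType) (c : X -> K) :
  opn N -> lc c -> (forall A v v', level N c A v v' -> f (A, v) = f (A, v')) ->
  lcB BO f.
Proof.
move=> oN lcc fN [A v].
exists [set o | o.1 = A /\ level N c A v o.2]; split.
- exists N, K, c; split=> // A' v' v'' v'v'' /= [A'A vv']; split=> //.
  by apply: level_trans vv' _ => //; rewrite -A'A.
- by split=> // t tA; split=> //; rewrite mulVg; exact: opn1.
- by move=> [A' v'] [/= -> vv']; rewrite -(fN _ _ _ vv').
Qed.

Lemma stab_free A z x e : A != finset.set0 -> stab actO BO setT (A, (z, x)) e ->
  rho e = 1 -> e = 1.
Proof.
move=> /finset.set0Pn [t tA] [_ ie] re; apply: (kappa_inj (h := t) re).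
apply: contrapT => /eqP k1; have [N [oN nN]] := opn_sep pU k1.
pose W := [set o : O | o.1 = A /\ level N (fun=> tt) A (z, x) o.2].
have bW : BO W.
  exists N, unit, (fun=> tt); split=> //; first exact: lc_cst.
  move=> A' v v' vv' /= [A'A lv]; split=> //; apply: level_trans lv _ => //.
  by rewrite -A'A.
have [|_ /(_ t tA) [/= Nk _]] := ie W bW.
  by split=> // t' _; split=> //; rewrite mulVg; exact: opn1.
apply: nN; move: Nk; rewrite /actZ re invg1 mul1g => Nk.
have := opnJV (z t) oN Nk; rewrite !mulgA mulgV mul1g mulgK //.
Qed.

End PartialSections.

(** Local constancy on a compact power of [U], stated with a uniform modulus [N] so that differences
    and restrictions to one coordinate are handled without the product topology. *)
Definition lcZ (U : topologicalGroupType) (H : finType) (R : Type) (f : (H -> U) -> R) :=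
  exists N : set U, opn N /\
    forall z z' : H -> U, (forall t, N ((z t)^-1 * z' t)) -> f z = f z'.

(** * Integration of mixed differences over several coordinates *)

Section Integration.
Variables (p : nat) (X : ptopologicalType) (U : topologicalGroupType) (i : X -> U).
Hypothesis pp : prime p.
Hypothesis cX : compact [set: X].
Hypothesis Ufree : is_free_pro_p_on p i.
Variables (H : finGroupType) (P : Type).
Let M : zmodType := (P -> 'F_p)%type.
Variable L : M -> Prop.
Hypothesis L0 : L 0%R.
Hypothesis LB : forall m m', L m -> L m' -> L (m - m')%R.

Let pU : is_pro_p p U. Proof. by case: Ufree. Qed.

Lemma lcZ_indep (f : (H -> U) -> M) t : lcZ f ->
  (forall z x, diff t (i x) f z = 0%R) -> indep f t.
Proof.
move=> [N [oN fN]] ft z u.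
have lf : lc (fun u => f (upd z t u)).
  move=> v; apply: filterS (@nbhs_coset _ N v (proj1 oN) (opn1 oN)) => w /= Nw.
  apply/esym/fN => t'; rewrite /upd; case: eqP => // _.
  by rewrite mulVg; exact: opn1.
have := @integral_unique p X U i pp Ufree M (fun u => f (upd z t u))
  (fun=> f (upd z t 1)) lf (@lc_cst _ _ _) erefl _.
have /[swap] /[apply] E : forall u x, (f (upd z t (u * i x)%g) - f (upd z t u) =
    f (upd z t 1%g) - f (upd z t 1%g))%R.
  move=> v x; rewrite subrr; have := ft (upd z t v) x.
  by rewrite /diff /mulz upd_same upd_upd.
have Eu := congr1 (fun g => g u) E; have Ez := congr1 (fun g => g (z t)) E.
by rewrite /= in Eu Ez; rewrite Eu -Ez updK.
Qed.

Let integrable (phi : U -> X -> M) :=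
  lc (fun z : U * X => phi z.1 z.2) /\ (forall u, phi u point = 0%R).

(** The integral is chosen as a function of the integrand alone, so equal integrands have equal
    integrals and independence of a parameter is inherited. *)
Let Jex : exists J : (U -> X -> M) -> U -> M, forall phi, integrable phi ->
  [/\ lc (J phi), J phi 1 = 0%R & forall u x, J phi (u * i x) = (J phi u + phi u x)%R].
Proof.
have /choice [J JP] : forall phi : U -> X -> M, exists f : U -> M, integrable phi ->
    [/\ lc f, f 1 = 0%R & forall u x, f (u * i x) = (f u + phi u x)%R].
  move=> phi; have [ip|nip] := pselect (integrable phi); last by exists (fun=> 0%R).
  by have [f fP] := integral_exists pp cX Ufree ip; exists f.
by exists J.
Qed.

(** Integrating [sigma] in the coordinate [t] gives data [sigma'] for the remaining directions. Its
    vanishing at the base point follows from uniqueness of integrals, and its values stay in [L]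
    because an integral that vanishes at 1 lies in the subgroup containing its differences. *)
Lemma integrate_many (s : seq H) (sigma : (H -> U) -> (H -> X) -> M) : uniq s ->
    (exists N (K : finType) (c : X -> K), [/\ opn N, lc c & forall z z' x x',
       (forall t, N ((z t)^-1 * z' t)) -> (forall t, t \in s -> c (x t) = c (x' t)) ->
       sigma z x = sigma z' x']) ->
    (forall z x t, t \in s -> x t = point -> sigma z x = 0%R) ->
    (forall z x, L (sigma z x)) ->
  exists f : (H -> U) -> M, [/\ lcZ f, forall z, L (f z),
    forall z x, diffs s (i \o x) f z = sigma z x &
    forall t, t \notin s -> (forall x, indep (sigma^~ x) t) -> indep f t].
Proof.
have [J JP] := Jex.
elim: s sigma => [|t s IH] sigma us [N [K [c [oN lcc sN]]]] s0 sL.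
  exists (fun z => sigma z (fun=> point)); split=> //.
  - by exists N; split=> // z z' zz'; apply: sN.
  - by move=> z x /=; apply: sN => // t; rewrite mulVg; exact: opn1.
have /andP [ts us'] := us.
pose phi z x : U -> X -> M := fun u y => sigma (upd z t u) (upd x t y).
have Nupd z z' u : (forall t, N ((z t)^-1 * z' t)) ->
    forall t', N ((upd z t u t')^-1 * upd z' t u t').
  by move=> zz' t'; rewrite /upd; case: eqP => // _; rewrite mulVg; exact: opn1.
have phi_eq z z' x x' : (forall t', t' != t -> N ((z t')^-1 * z' t')) ->
    (forall t', t' \in s -> c (x t') = c (x' t')) -> phi z x = phi z' x'.
  move=> zz' xx'; apply/funext => u; apply/funext => y; apply: sN => t'.
    rewrite /upd; case: eqP => [_|/eqP]; last exact: zz'.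
    by rewrite mulVg; exact: opn1.
  rewrite inE /upd; case: eqP => //= _; exact: xx'.
have iphi z x : integrable (phi z x).
  split; last by move=> u; apply: (s0 _ _ t); rewrite ?mem_head ?upd_same.
  move=> [u y]; exists ([set v | N (u^-1 * v)], [set y' | c y' = c y]) => /=.
    by split; [apply: nbhs_coset; [case: oN|exact: opn1]|exact: lcc].
  move=> [v y'] /= [Nv cy]; apply/esym/sN => t'.
    by rewrite /upd; case: eqP => // _; rewrite mulVg; exact: opn1.
  by rewrite /upd; case: eqP.
pose sigma' z x := J (phi z x) (z t).
have [E [q [pE qM qN qs]]] := opn_quotient pp pU oN.
(* The integrand [phi z x] depends only on this class, which takes finitely many values, so all the
   integrals share the modulus [N1]. *)
pose cl z x := ([ffun h => q (z h)], [ffun h => c (x h)]) : {ffun H -> E} * {ffun H -> K}.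
have cl_phi z x z' x' : cl z x = cl z' x' -> phi z x = phi z' x'.
  move=> [/ffunP qz /ffunP cx]; apply: phi_eq => t' _.
    by apply/qN; rewrite qM (homV qM); have := qz t'; rewrite !ffunE => ->; rewrite mulVg.
  by have := cx t'; rewrite !ffunE.
have /choice [N' N'P] : forall k : {ffun H -> E} * {ffun H -> K}, exists N', opn N' /\
    forall z x, cl z x = k -> forall u v, N' v -> J (phi z x) (u * v) = J (phi z x) u.
  move=> k; have [[z [x clk]]|no] := pselect (exists z x, cl z x = k); last first.
    by exists setT; split=> [|z x clk]; [exact: opnT|case: no; exists z, x].
  have [lJ _ _] := JP _ (iphi z x); have [N' [oN' JN']] := lc_opn pU.1 lJ.
  exists N'; split=> // z' x' clk' u v Nv.
  rewrite (cl_phi z' x' z x) ?clk //; by case: (JN' v u Nv).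
pose N1 := N `&` [set v | forall k, N' k v].
have oN1 : opn N1 by apply: opnI => //; apply: opn_forall => k; case: (N'P k).
have [|||f [lf Lf fs find]] := IH sigma' us'.
- exists N1, K, c; split=> // z z' x x' zz' xx'.
  rewrite /sigma' -(@phi_eq z z' x x') //; last by move=> t' _; case: (zz' t').
  have [_ zt] := zz' t; have := (N'P (cl z x)).2 z x erefl (z t) _ (zt _).
  by rewrite mulKVg.
- move=> z x t' t's x0; rewrite /sigma'.
  have tt' : t' != t by apply: contraNneq ts => <-.
  have [lJ J1 Ju] := JP _ (iphi z x).
  have := @integral_unique p X U i pp Ufree M (J (phi z x)) (fun=> 0%R) lJ (@lc_cst _ _ _) J1.
  move=> -> // u y; rewrite Ju subrr addrC addKr /phi.
  by apply: (s0 _ _ t'); rewrite ?inE ?t's ?orbT // upd_other.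
- move=> z x; have [lJ J1 Ju] := JP _ (iphi z x).
  rewrite /sigma' -[J _ _](subr0) -J1; apply: (integral_in pp Ufree L0 LB lJ).
  by move=> u y; rewrite Ju addrC addKr; exact: sL.
exists f; split=> //.
- move=> z x /=; rewrite (_ : diffs s _ f = sigma'^~ x); last exact/funext/(fun z => fs z x).
  rewrite /diff /sigma' /mulz upd_same (@phi_eq (upd z t _) z x x) //; last first.
    by move=> t' tt'; rewrite upd_other // mulVg; exact: opn1.
  by have [_ _ ->] := JP _ (iphi z x); rewrite addrC addKr /phi !updK.
- move=> t'; rewrite inE negb_or => /andP [t't t's] st'; apply: find => // x z u.
  rewrite /sigma' upd_other 1?eq_sym //; congr (J _ _).
  apply/funext => v; apply/funext => y; rewrite /phi updC //.
  exact: st'.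
Qed.

End Integration.

(** * Cocycles of functions on [U^H] modulo constants *)

Section TensorInduced.
Variables (p : nat) (G U : topologicalGroupType) (X : ptopologicalType) (i : X -> U).
Hypothesis pp : prime p.
Hypothesis pX : profinite_space X.
Hypothesis Ufree : is_free_pro_p_on p i.
Variables (H : finGroupType) (rho : G -> H) (F : set G) (kappa : G -> H -> U).
Hypothesis rhoM : {morph rho : x y / x * y}.
Hypothesis rhoF : forall n, F n -> rho n = 1.
Hypothesis pG : profinite_space G.
Hypothesis kappaM : forall g g' h, kappa (g * g') h = kappa g (rho g' * h) * kappa g' h.
Hypothesis kappa_smooth : forall N, opn N ->
  exists N', [/\ opn N', N' `<=` F & forall n h, N' n -> N (kappa n h)].
Hypothesis kappa_inj : forall g h, rho g = 1 -> kappa g h = 1 -> g = 1.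
Variable P : Type.
Let M : zmodType := (P -> 'F_p)%type.
Variables (a : G -> M -> M) (L : M -> Prop).
Hypothesis gM : gmodule a L.
Hypothesis van : forall E, is_subgroup E ->
  (forall e, E e -> rho e = 1 -> e = 1) -> H1van a L E.

Let pU : is_pro_p p U. Proof. by case: Ufree. Qed.
Let ci : continuous i. Proof. by case: Ufree. Qed.
Let i1 : i point = 1. Proof. by case: Ufree. Qed.
Let cX : compact [set: X]. Proof. by case: pX. Qed.
Let act := actO rho kappa (X := X).
Let BO' := @BO U X H.
Let bO : bspace act BO' := BO_bspace rhoM rhoF pU.1 cX kappaM kappa_smooth.
Let aZ := actZ rho kappa.
Let rhoV g : rho g^-1 = (rho g)^-1. Proof. exact: homV. Qed.

Let aZ_mulz g z t v : aZ g (mulz z t v) = mulz (aZ g z) (rho g * t) v.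
Proof.
apply/funext => h; rewrite /aZ /actZ /mulz /upd.
rewrite (_ : ((rho g)^-1 * h == t) = (h == rho g * t)).
  by case: eqP => // ->; rewrite !mulKg mulgA.
by apply/eqP/eqP => [<-|->]; rewrite ?mulKVg ?mulKg.
Qed.

Let diffs_act s y (f : (H -> U) -> M) g :
  diffs s y (fun z => a g (f (aZ g^-1 z))) =
  (fun z => a g (diffs [seq (rho g)^-1 * t | t <- s] (fun t => y (rho g * t)) f (aZ g^-1 z))).
Proof.
elim: s => [//|t s IH] /=; rewrite IH; apply/funext => z.
by rewrite /diff aZ_mulz (gm_B gM) rhoV mulKVg.
Qed.

Let lcZ_diffs_level (N : set U) (f : (H -> U) -> M) s y y' z z' : opn N ->
  (forall z z', (forall t, N ((z t)^-1 * z' t)) -> f z = f z') ->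
  (forall t, t \in s -> N ((y t)^-1 * y' t)) -> (forall t, N ((z t)^-1 * z' t)) ->
  diffs s y f z = diffs s y' f z'.
Proof.
move=> oN fN; elim: s z z' => [|t s IH] z z' yy' zz' /=; first exact: fN.
have yys t' : t' \in s -> N ((y t')^-1 * y' t') by move=> t's; apply: yy'; rewrite inE t's orbT.
rewrite /diff; congr (_ - _)%R; apply: (IH) => // t'.
rewrite /mulz /upd; case: eqP => // _.
have := opnM oN (opnJ (y t) oN (zz' t)) (yy' t (mem_head _ _)).
by rewrite invgM !mulgA mulgK.
Qed.

(** Degree counts coordinates: each direction is used at most once. Hence every function has degree
    at most [#|H|], and a locally constant function of degree 0 is constant. *)
Let deg_le j (f : (H -> U) -> M) := forall s, uniq s -> size s = j.+1 ->
  forall x z, diffs s (i \o x) f z = 0%R.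

Let perm_enum_imset (f : H -> H) (A : {set H}) : injective f ->
  perm_eq [seq f t | t <- enum A] (enum [set f t | t in A]%SET).
Proof.
move=> fI; apply: uniq_perm; rewrite ?map_inj_uniq ?enum_uniq // => t.
rewrite mem_enum; apply/mapP/imsetP => [] [t' tA ->]; exists t' => //.
  by rewrite -mem_enum.
by rewrite mem_enum.
Qed.

Let perm_enum_seq (s : seq H) : uniq s -> perm_eq s (enum [set t in s]%SET).
Proof.
by move=> us; apply: uniq_perm; rewrite ?enum_uniq // => t; rewrite mem_enum inE.
Qed.

Section Symbol.
Variables (k : nat) (f : (H -> U) -> M).
Hypothesis lf : lcZ f.
Hypothesis df : deg_le k.+1 f.

(* For [f] of degree at most [k.+1], the mixed differences of order [k.+1] in
   the directions [A] only depend on the coordinates in [A]. *)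
Definition symbol (o : {set H} * ((H -> U) * (H -> X))) : M :=
  if #|o.1| == k.+1 then diffs (enum o.1) (i \o o.2.2) f o.2.1 else 0%R.

Lemma symbol_lcB : lcB BO' symbol.
Proof.
have [N [oN fN]] := lf.
have [E [q [pE qM qN qs]]] := opn_quotient pp pU oN.
apply: (@level_lcB U X H _ _ N E (q \o i)) => //.
  by apply: lc_continuous ci _; apply: (lc_hom oN qM) => u /qN.
move=> A [z x] [z' x'] lv; rewrite /symbol /=; case: eqP => // cA.
have ii t : t \in A -> N ((i (x t))^-1 * i (x' t)).
  by move=> /lv [_ /= cx]; apply/qN; rewrite qM (homV qM) cx mulVg.
have zz t : t \in A -> N ((z t)^-1 * z' t) by move=> /lv [].
have ind t : t \notin A -> indep (diffs (enum A) (i \o x') f) t.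
  move=> tA; apply: (lcZ_indep pp Ufree).
    exists N; split=> // z1 z2 z12; apply: (lcZ_diffs_level oN) => // t' _.
    by rewrite mulVg; exact: opn1.
  move=> z1 y; have tA' : t \notin enum A by rewrite mem_enum.
  have := df (s := t :: enum A) _ _ (upd x' t y) z1; rewrite /= upd_same => df'.
  rewrite -{}df' //; last by rewrite -cardE cA.
    congr (diff _ _ _ _); apply: diffs_eq_in => t' t'A /=; rewrite upd_other //.
    by apply: contraNneq tA' => <-.
  by rewrite tA' enum_uniq.
pose z2 t := if t \in A then z' t else z t.
rewrite (@indep_off _ _ _ (mem A) _ z' z2) //; last by move=> t /= tA; rewrite /z2 tA.
apply: (lcZ_diffs_level oN) => // [t|t]; first by rewrite mem_enum; exact: ii.
by rewrite /z2; case: ifP => [/zz //|_]; rewrite mulVg; exact: opn1.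
Qed.

Lemma symbol_0 (A : {set H}) z (x : H -> X) t : t \in A -> x t = point -> symbol (A, (z, x)) = 0%R.
Proof.
move=> tA xt; rewrite /symbol; case: ifP => // _ /=.
by rewrite (@diffs_1 _ _ _ _ _ _ t) ?enum_uniq ?mem_enum //= xt.
Qed.

Lemma symbol_L : (forall z, L (f z)) -> forall o, L (symbol o).
Proof.
move=> Lf [A [z x]]; rewrite /symbol; case: ifP => _ /=; last exact: (gm_L0 gM).
by elim: (enum A) z => [|t s IH] z //=; apply: (gm_LB gM); exact: IH.
Qed.

End Symbol.

(** The symbol vanishes at these points. Prescribing zero there for the solution too yields the
    vanishing at the base point that [integrate_many] requires. *)
Let Os (k : nat) : set ({set H} * ((H -> U) * (H -> X))) :=
  [set o : {set H} * ((H -> U) * (H -> X)) | #|o.1| <> k.+1 \/ exists2 t, t \in o.1 & o.2.2 t = point].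

Let Os_closed k o : ~ Os k o -> exists A, [/\ BO' A, A o & forall o', A o' -> ~ Os k o'].
Proof.
case: o => A [z x] nO.
have cA : #|A| = k.+1 by apply: contrapT => cA; apply: nO; left.
have xt t : t \in A -> x t != point.
  by move=> tA; apply/eqP => xt; apply: nO; right; exists t.
have /choice [C CP] : forall t, exists C : set X, clopen C /\
    (t \in A -> C (x t) /\ ~ C point).
  move=> t; case: (boolP (t \in A)) => tA; last by exists setT; split=> //; exact: clopenT.
  have [cX' hX tX] := pX.
  have [C [cC Cx nC]] := profinite_zero_dimensional cX' hX tX (xt t tA).
  by exists C; split.
have lC t : lc (fun y => `[< C t y >]).
  move=> y; have [[oC cC] _] := CP t.
  have [Cy|nCy] := pselect (C t y).
    have : nbhs y (C t) by apply: open_nbhs_nbhs.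
    by apply: filterS => y' Cy' /=; rewrite !asboolT.
  have : nbhs y (~` C t) by apply: open_nbhs_nbhs; split=> //; exact: closed_openC.
  by apply: filterS => y' Cy' /=; rewrite !asboolF.
exists [set o : {set H} * ((H -> U) * (H -> X)) | o.1 = A /\ forall t, t \in A -> C t (o.2.2 t)]; split.
- exists setT, {ffun H -> bool}, (fun y => [ffun t => `[< C t y >]]); split.
  + exact: opnT.
  + move=> y; have : nbhs y [set y' | forall t, `[< C t y' >] = `[< C t y >]].
      by apply: filter_forall => t; exact: lC.
    by apply: filterS => y' yy'; apply/ffunP => t; rewrite !ffunE.
  + move=> A' v v' lv /= [A'A Cv]; split=> // t tA.
    have tA' : t \in A' by rewrite A'A.
    have [_ /ffunP /(_ t)] := lv t tA'.
    rewrite !ffunE => Ct; apply/asboolP; rewrite -Ct; apply/asboolP; exact: Cv.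
- by split=> // t tA; case: (CP t) => _ /(_ tA) [].
- move=> [A' [z' x']] /= [-> Cx] [//|/= [t tA xt']].
  by have := Cx t tA; rewrite xt'; case: (CP t) => _ /(_ tA) [].
Qed.

Let Os_inv k g o : Os k o -> Os k (act g o).
Proof.
case: o => A [z x] [nA|[t /= tA xt]]; [left|right] => /=.
  by rewrite card_imset //; exact: mulgI.
by exists (rho g * t); [exact: imset_f|rewrite mulKg].
Qed.


Let cobound (c : G -> (H -> U) -> M) (S : (H -> U) -> M) :=
  forall g, exists k, forall z, c g z = (a g (S (aZ g^-1%g z)) - S z + k)%R.

Lemma lcZ_smooth (f : (H -> U) -> M) : lcZ f -> (forall z, L (f z)) ->
  exists N, opn N /\ forall n z, N n -> a n (f (aZ n^-1 z)) = f z.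
Proof.
move=> [N [oN fN]] Lf; have [E [q [pE qM qN qs]]] := opn_quotient pp pU oN.
have /choice [V VP] : forall k : {ffun H -> E}, exists V, opn V /\
    forall z n, [ffun h => q (z h)] = k -> V n -> a n (f z) = f z.
  move=> k; have [[z zk]|no] := pselect (exists z, [ffun h => q (z h)] = k); last first.
    by exists setT; split=> [|z n zk]; [exact: opnT|case: no; exists z].
  have [V [oV Va]] := gm_smooth gM (Lf z).
  exists V; split=> // z' n z'k Vn; rewrite -(fN z z') ?Va // => t.
  apply/qN; rewrite qM (homV qM); move: z'k; rewrite -zk => /ffunP /(_ t).
  by rewrite !ffunE => ->; rewrite mulVg.
have [N' [oN' N'F N'N]] := kappa_smooth oN.
exists ([set n | forall k, V k n] `&` N'); split.
  by apply: opnI => //; apply: opn_forall => k; case: (VP k).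
move=> n z [Vn N'n]; have fE : f (aZ n^-1 z) = f z.
  apply/esym/fN => t; rewrite /aZ /actZ rhoV (rhoF (N'F _ N'n)) !invg1 mul1g.
  apply: (opnJ (z t) oN); apply: N'N; exact: opnV.
by rewrite fE; case: (VP [ffun h => q (z h)]) => _ /(_ z n erefl (Vn _)).
Qed.

Lemma lcZB (f f' : (H -> U) -> M) : lcZ f -> lcZ f' -> lcZ (fun z => f z - f' z)%R.
Proof.
move=> [N [oN fN]] [N' [oN' fN']]; exists (N `&` N'); split; first exact: opnI.
by move=> z z' zz'; rewrite (fN z z') ?(fN' z z') // => t; case: (zz' t).
Qed.

Lemma lcZ_act g (f : (H -> U) -> M) : lcZ f -> lcZ (fun z => a g (f (aZ g^-1%g z)))%R.
Proof.
move=> [N [oN fN]]; exists N; split=> // z z' zz'; congr (a g _); apply: fN => t.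
by rewrite /aZ /actZ invgM -mulgA mulKg.
Qed.

Lemma cocycle_shift (x y k u v w : M) :
  (x + y + k - (u - v) = (x - (w - v)) + (y - (u - w)) + k)%R.
Proof.
rewrite !opprB [(x + y + k)%R]addrC -addrA [RHS]addrC; congr (_ + _)%R.
rewrite [RHS]addrACA; congr (_ + _)%R.
by rewrite addrA subrK.
Qed.

(* The symbol of [c] is an exact cocycle; by the local-global principle it is
   the coboundary of some [w], and integrating [w] over each [A] gives [S]
   such that subtracting the coboundary of [S] kills the symbol. *)
Let lower k (c : G -> (H -> U) -> M) :
  (forall g, lcZ (c g)) -> (forall g z, L (c g z)) ->
  (forall g h, exists k, forall z, c (g * h) z = (c g z + a g (c h (aZ g^-1%g z)) + k)%R) ->
  (exists N, opn N /\ forall n z z', N n -> c n z = c n z') ->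
  (forall g, deg_le k.+1 (c g)) ->
  exists S, [/\ lcZ S, forall z, L (S z) &
    forall g, deg_le k (fun z => c g z - (a g (S (aZ g^-1%g z)) - S z))%R].
Proof.
move=> lc_c Lc cM [N [oN cN]] dc.
have sne (A : {set H}) : #|A| = k.+1 -> exists t, t \in enum A.
  move=> cA; have /card_gt0P [t tA] : (0 < #|A|)%N by rewrite cA.
  by exists t; rewrite mem_enum.
have [||||||||w [lw Lw Osw wc]] := local_coboundary bO pG (Gam := setT) _ _ gM
  (@Os_closed k) (fun g o _ => @Os_inv k g o) (c := fun g => symbol k (c g)).
- by apply/subgroupP.
- exact: closedT.
- by move=> g _; apply: symbol_lcB.
- by move=> g o _; apply: symbol_L.
- move=> g [A [z x]] _ [cA|[t tA xt]]; last exact: symbol_0 tA xt.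
  by rewrite /symbol; case: eqP.
- move=> g h [A [z x]] _ _; rewrite /symbol /= card_imset; last exact: mulgI.
  case: eqP => [cA|_]; last by rewrite (gm_0 gM) addr0.
  have [t tA] := sne A cA; have [k' cgh] := cM g h.
  have -> : c (g * h) = (fun z => c g z + a g (c h (aZ g^-1%g z)) + k')%R by exact/funext.
  rewrite diffsD diffsD (@diffs_const _ _ _ _ _ (fun=> k') _ tA) //= addr0; congr (_ + _)%R.
  rewrite diffs_act; congr (a g _).
  rewrite (diffs_perm _ _ _ (perm_enum_imset A (mulgI (rho g)^-1)));
    last by rewrite map_inj_uniq ?enum_uniq //; exact: mulgI.
  rewrite rhoV; congr (diffs _ _ _ _); apply/funext => t' /=.
  by rewrite invgK.
- exists N; split=> // n [A [z x]] Nn _; rewrite /symbol /=; case: eqP => // cA.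
  have [t tA] := sne A cA.
  by rewrite (diffs_const _ tA) // => z1 z2; exact: cN.
- move=> [A [z x]] nO; apply: van; first by apply: (stab_subgroup _ bO); apply/subgroupP.
  move=> e; apply: (stab_free pU.1 kappa_inj); apply/eqP => A0; apply: nO; left.
  by rewrite /= A0 cards0.
have [N1 [K [cl [oN1 lcl wN]]]] := lcB_level rhoM rhoF pU.1 cX kappaM kappa_smooth lw.
have /choice [f fP] : forall A : {set H}, exists f : (H -> U) -> M,
    [/\ lcZ f, forall z, L (f z),
    forall z x, diffs (enum A) (i \o x) f z = w (A, (z, x)) &
    forall t, t \notin A -> indep f t].
  move=> A; have [||||f [lf Lf df indf]] := @integrate_many p X U i pp cX Ufree H P L
    (gm_L0 gM) (gm_LB gM) (enum A) (fun z x => w (A, (z, x))).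
  - exact: enum_uniq.
  - exists N1, K, cl; split=> // z z' x x' zz' xx'; apply: wN => t tA.
    by split=> //; apply: xx'; rewrite mem_enum.
  - move=> z x t; rewrite mem_enum => tA xt; apply: Osw; right; exists t => //.
  - by move=> z x.
  exists f; split=> // t tA; apply: indf; first by rewrite mem_enum.
  move=> x z u; apply: wN => t' t'A; split=> //=; rewrite upd_other ?mulVg; first exact: opn1.
  by apply: contraNneq tA => <-.
pose S z := (\sum_(A : {set H} | #|A| == k.+1) f A z)%R.
have dS (A : {set H}) z x : #|A| = k.+1 -> diffs (enum A) (i \o x) S z = w (A, (z, x)).
  move=> cA; rewrite diffs_sum (bigD1 A) ?cA //= [X in (_ + X)%R]big1 ?addr0.
    by case: (fP A).
  (* Two different sets of the same size: some [t] of [A] lies outside [A'], [f A'] is independent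
     of that coordinate, and its mixed difference in the directions [A] is zero. *)
  move=> A' /andP [/eqP cA' A'A].
  have /subsetPn [t tA tA'] : ~~ (A \subset A').
    by apply: contraNN A'A => sAA'; rewrite eq_sym eqEcard sAA' cA cA' leqnn.
  by rewrite (@diffs_indep _ _ _ _ _ _ t) ?enum_uniq ?mem_enum //; case: (fP A') => _ _ _; apply.
have lS : lcZ S.
  have /choice [V VP] : forall A, exists V, opn V /\ forall z z' : H -> U,
      (forall t, V ((z t)^-1 * z' t)) -> f A z = f A z' by move=> A; case: (fP A).
  exists [set u | forall A, V A u]; split; first by apply: opn_forall => A; case: (VP A).
  by move=> z z' zz'; apply: eq_bigr => A _; apply: (VP A).2 => t; exact: zz'.
have LS z : L (S z) by apply: (gm_Lsum gM) => A _; case: (fP A).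
exists S; split=> // g s us ss x z.
have cs : #|[set t in s]%SET| = k.+1 by rewrite -ss cardsE; exact/card_uniqP.
rewrite (diffs_perm _ _ us (perm_enum_seq us)) !diffsB diffs_act dS //.
have wg := wc g ([set t in s]%SET, (z, x)) Logic.I.
rewrite /symbol /= cs eqxx in wg; rewrite wg.
rewrite (diffs_perm _ _ _ (perm_enum_imset _ (mulgI (rho g)^-1)));
    last by rewrite map_inj_uniq ?enum_uniq //; exact: mulgI.
have -> : (fun t => (i \o x) (rho g * t)) = i \o (fun t => x (rho g * t)) by [].
rewrite dS; last by rewrite card_imset //; exact: mulgI.
have -> : act g^-1 ([set t in s]%SET, (z, x)) =
   ([set (rho g)^-1 * t | t in [set t in s]]%SET, (aZ g^-1%g z, fun t => x (rho g * t))).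
  by rewrite /act /actO /= rhoV invgK.
by rewrite subrr.
Qed.

(** [c] is a cocycle up to the constants [k], which differences of positive order do not see; so its
    symbol is an exact cocycle in every positive degree. The degree starts at [#|H|] and [lower]
    decreases it; in degree 0 each [c g] is itself constant. *)
Theorem tensor_induced_coboundary (c : G -> (H -> U) -> M) :
  (forall g, lcZ (c g)) -> (forall g z, L (c g z)) ->
  (forall g h, exists k, forall z,
     c (g * h) z = (c g z + a g (c h (actZ rho kappa g^-1%g z)) + k)%R) ->
  (exists N, opn N /\ forall n z z', N n -> c n z = c n z') ->
  exists S : (H -> U) -> M, [/\ lcZ S, forall z, L (S z) &
    forall g, exists k, forall z,
      c g z = (a g (S (actZ rho kappa g^-1%g z)) - S z + k)%R].
Proof.
suff H0 j : forall c, (forall g, lcZ (c g)) -> (forall g z, L (c g z)) ->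
    (forall g h, exists k, forall z, c (g * h) z = (c g z + a g (c h (aZ g^-1%g z)) + k)%R) ->
    (exists N, opn N /\ forall n z z', N n -> c n z = c n z') ->
    (forall g, deg_le j (c g)) ->
    exists S, [/\ lcZ S, forall z, L (S z) & cobound c S].
  move=> lc_c Lc cM cN; apply: (H0 #|H|) lc_c Lc cM cN _ => g s us ss.
  by have := max_card (mem s); rewrite (card_uniqP us) ss ltnn.
elim: j => [|j IH] {}c lc_c Lc cM cN dc.
  exists (fun=> 0%R); split; first by exists setT; split=> //; exact: opnT.
    by move=> z; exact: (gm_L0 gM).
  move=> g; exists (c g (fun=> 1)) => z; rewrite (gm_0 gM) subr0 add0r.
  apply: (@indep_off _ _ _ pred0) => // t _; apply: (lcZ_indep pp Ufree (lc_c g)) => z' x.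
  exact: (dc g [:: t] isT erefl (fun=> x) z').
have [S [lS LS dS]] := lower lc_c Lc cM cN dc.
pose c' g z := (c g z - (a g (S (aZ g^-1%g z)) - S z))%R.
have [|||||S' [lS' LS' cS']] := IH c'.
- by move=> g; apply: lcZB => //; apply: lcZB => //; exact: lcZ_act.
- move=> g z; apply: (gm_LB gM) => //; apply: (gm_LB gM) => //; exact: (gm_La gM).
- move=> g h; have [k ck] := cM g h; exists k => z.
  rewrite /c' ck !(gm_B gM) -(gm_M gM) invgM.
  by rewrite /aZ -(actZ_M rhoM kappaM); exact: cocycle_shift.
- have [N [oN cN']] := cN; have [N' [oN' SN']] := lcZ_smooth lS LS.
  exists (N `&` N'); split; first exact: opnI.
  by move=> n z z' [Nn N'n]; rewrite /c' !SN' // !subrr !subr0; exact: cN'.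
- exact: dS.
exists (fun z => S z + S' z)%R; split.
- have lS0 : lcZ (fun z => 0 - S' z)%R by apply: lcZB => //; exists setT; split=> //; exact: opnT.
  have [N [oN SN]] := lcZB lS lS0; exists N; split=> // z z' zz'.
  by have := SN z z' zz'; rewrite !sub0r !opprK.
- by move=> z; exact: (gm_LD gM).
- move=> g; have [k ck] := cS' g; exists k => z.
  have := ck z; rewrite /c' => /eqP; rewrite subr_eq => /eqP ->.
  rewrite (gm_D gM) opprD [(_ + k + _)%R]addrAC; congr (_ + _)%R.
  by rewrite addrC addrACA.
Qed.

End TensorInduced.

(** * Coefficient modules *)

Section Coefficients.
Variables (p : nat) (G : topologicalGroupType) (H : finGroupType) (rho : G -> H) (F : set G).
Hypothesis rhoM : {morph rho : x y / x * y}.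
Hypothesis oF : opn F.
Hypothesis rhoF : forall n, F n -> rho n = 1.
Hypothesis pG : profinite_space G.
Variables (O : Type) (act : G -> O -> O) (B : set (set O)).
Hypothesis bO : bspace act B.
Hypothesis fixO : forall E, is_subgroup E -> (forall e, E e -> rho e = 1 -> e = 1) ->
  (forall e, E e -> e = 1) \/ exists y0,
    (forall e, E e -> indist B y0 (act e y0)) /\
    (forall e y, E e -> e <> 1 -> indist B y (act e y) -> indist B y0 y).

Let MH : zmodType := (H -> 'F_p)%type.
Let MO : zmodType := (O * O * H -> 'F_p)%type.
Let ME : zmodType := (O * H -> 'F_p)%type.

Let rhoV g : rho g^-1 = (rho g)^-1. Proof. exact: homV. Qed.

(** Close to a point [x] of the closure, all elements of [E] have the same image [rho x], so there
    is only one of them and it must be [x]. *)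
Lemma discrete_subgroup_closed (E : set G) :
  is_subgroup E -> (forall e, E e -> rho e = 1 -> e = 1) -> closed E.
Proof.
move=> sE E1 x clx.
have near N : opn N -> exists e, [/\ E e, N (x^-1 * e) & rho e = rho x].
  move=> oN; have [e [Ee [Ne Fe]]] := clx _ (@nbhs_coset G (N `&` F) x
    (proj1 (opnI oN oF)) (opn1 (opnI oN oF))).
  exists e; split=> //; have := rhoF Fe; rewrite rhoM rhoV => /eqP.
  by rewrite -eq_mulVg1 => /eqP.
have [e [Ee _ re]] := near setT (opnT G).
suff -> : x = e by [].
apply: contrapT => xe; have [|N [oN nN]] := @opn_sep G pG (x^-1 * e).
  by apply/eqP => xe1; apply: xe; apply: (mulgI x^-1); rewrite xe1 mulVg.
have [e' [Ee' Ne' re']] := near N oN.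
apply: nN; suff -> : e = e' by [].
apply: (mulgI e'^-1); rewrite mulVg; apply: E1.
  by apply: subM => //; exact: subV.
by rewrite rhoM rhoV re re' mulVg.
Qed.

Definition aH (g : G) (m : MH) : MH := fun h => m ((rho g)^-1 * h).

Definition aD (g : G) (m : MO) : MO :=
  fun x => m (act g^-1 x.1.1, act g^-1 x.1.2, (rho g)^-1 * x.2).

Definition aE (g : G) (m : ME) : ME := fun x => m (act g^-1 x.1, (rho g)^-1 * x.2).

Definition submoduleH (L : MH -> Prop) :=
  [/\ L 0%R, forall m m', L m -> L m' -> L (m - m')%R & forall g m, L m -> L (aH g m)].

Lemma gmoduleH L : submoduleH L -> gmodule aH L.
Proof.
move=> [L0 LB La]; split=> //.
- by move=> m; apply/funext => h; rewrite /aH (hom1 rhoM) invg1 mul1g.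
- by move=> g g' m; apply/funext => h; rewrite /aH rhoM invgM mulgA.
- move=> m _; exists F; split=> // n Fn; apply/funext => h.
  by rewrite /aH (rhoF Fn) invg1 mul1g.
Qed.

(* The quotient of the locally constant functions [O -> L] by the constant
   ones, realized by the differences of values at two points. *)
Definition DL (L : MH -> Prop) (m : MO) := exists f : O -> MH,
  [/\ lcB B f, forall y y', L (f y' - f y)%R & forall y y' h, m (y, y', h) = (f y' h - f y h)%R].

Let subC (x y u v : 'F_p) : (x - y - (u - v) = (x - u) - (y - v))%R.
Proof. by rewrite !opprB [LHS]addrACA [RHS]addrACA; congr (_ + _)%R; exact: addrC. Qed.

Lemma gmoduleD L : submoduleH L -> gmodule aD (DL L).
Proof.
move=> [L0 LB La]; split.
- move=> m; apply/funext => -[[y y'] h].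
  by rewrite /aD /= invg1 !(bs_act1 bO) (hom1 rhoM) invg1 mul1g.
- move=> g g' m; apply/funext => -[[y y'] h].
  by rewrite /aD /= rhoM !invgM !(bs_actM bO) mulgA.
- by [].
- exists (fun=> 0%R); split; first exact: (lcB_cst bO).
    by move=> y y'; rewrite subr0; exact: L0.
  by move=> y y' h; rewrite subrr.
- move=> m m' [f [lf Lf mf]] [f' [lf' Lf' mf']].
  exists (fun y => f y - f' y)%R; split.
  + exact: (lcB_comp2 bO (fun u v : MH => u - v)%R lf lf').
  + move=> y y'; have -> : (f y' - f' y' - (f y - f' y) = (f y' - f y) - (f' y' - f' y))%R.
      by apply/funext => h; exact: subC.
    exact: LB.
  + move=> y y' h; have -> : (m - m')%R (y, y', h) = (m (y, y', h) - m' (y, y', h))%R by [].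
    by rewrite mf mf'; exact: subC.
- move=> g m [f [lf Lf mf]]; exists (fun y => aH g (f (act g^-1 y))); split.
  + exact: lcB_comp (lcB_act bO _ lf).
  + by move=> y y'; exact: (La g _ (Lf (act g^-1 y) (act g^-1 y'))).
  + by move=> y y' h; rewrite /aD /= mf.
- move=> m [f [lf _ mf]]; have [N [oN fN]] := lcB_smooth bO lf.
  exists (N `&` F); split; first exact: opnI.
  move=> n [Nn Fn]; apply/funext => -[[y y'] h].
  by rewrite /aD /= !mf (rhoF Fn) invg1 mul1g !fN //; exact: opnV.
Qed.

(** Normalizing at the fixed point [y0] lifts a cocycle modulo constants to an exact cocycle [c] of
    functions that vanish at [y0]. Away from [y0] the stabilizers in [E] are trivial, so the
    local-global principle solves it. *)
Lemma H1van_DL L E : submoduleH L -> is_subgroup E ->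
  (forall e, E e -> rho e = 1 -> e = 1) -> H1van aD (DL L) E.
Proof.
move=> sL sE E1; have gD := gmoduleD sL; have gH := gmoduleH sL.
have [Et|[y0 [y0E y0u]]] := fixO sE E1; first exact: H1van_trivial.
move=> al alL alM.
pose c (e : G) (y : O) : MH := fun h => al e (y0, y, h).
have cE e y y' h : E e -> al e (y, y', h) = (c e y' h - c e y h)%R.
  by move=> Ee; have [f [_ _ mf]] := alL e Ee; rewrite /c !mf opprB addrA subrK.
have clc e : E e -> lcB B (c e).
  move=> Ee; have [f [lf _ mf]] := alL e Ee.
  rewrite (_ : c e = (fun m => m - f y0)%R \o f); first exact: lcB_comp.
  by apply/funext => y; apply/funext => h; rewrite /c mf.
have c0 e y : E e -> indist B y0 y -> c e y = 0%R.
  move=> Ee y0y; rewrite (lcB_indist (clc e Ee) y0y); apply/funext => h.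
  by rewrite /c -[RHS](subrr (c e y0 h)) cE.
have [||||||||w [lw Lw w0 wc]] := local_coboundary bO pG sE (discrete_subgroup_closed sE E1) gH
  (Os := indist B y0) _ _ (c := c).
- move=> o no; have [A [bA Ay0 nAo]] : exists A, [/\ B A, A y0 & ~ A o].
    apply: contrapT => nA; apply: no => A bA Ay0; apply: contrapT => nAo.
    by apply: nA; exists A.
  exists (~` A); split=> //; first exact: (bsC bO).
  by move=> o' nAo' ind; apply: nAo'; exact: ind.
- move=> g o Eg y0o; apply: indist_trans (y0E _ Eg) _; exact: (indist_act bO).
- exact: clc.
- by move=> e y Ee; have [f [_ Lf mf]] := alL e Ee;
    rewrite (_ : c e y = (f y - f y0)%R) //; apply/funext => h; rewrite /c mf.
- exact: c0.
- move=> e e' y Ee Ee'; apply/funext => h.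
  have ->: (c e y + aH e (c e' (act e^-1%g y)))%R h =
    (c e y h + c e' (act e^-1%g y) ((rho e)^-1 * h)%g)%R by [].
  rewrite /c alM //; congr (_ + _)%R; rewrite /aD /= [LHS]cE //.
  have y0e : indist B y0 (act e^-1 y0) by exact: y0E (subV sE Ee).
  by rewrite (c0 e' _ Ee' y0e) subr0.
- have [N [oN EN]] : exists N, opn N /\ forall n, N n -> E n -> n = 1.
    by exists F; split=> // n /rhoF rn /E1; apply.
  exists N; split=> // n o Nn En; rewrite (EN n Nn En).
  have c1 := c0 1 y0 (sub1 sE) (fun _ _ => id).
  apply/funext => h; have := cE 1 y0 o h (sub1 sE); rewrite c1 /c.
  have := alM 1 1 (sub1 sE) (sub1 sE); rewrite mulg1 (gm_1 gD) => /eqP.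
  by rewrite -subr_eq0 opprD addrA subrr sub0r oppr_eq0 => /eqP ->.
- move=> o no; apply: H1van_trivial => // e [Ee oe]; apply: contrapT => e1.
  by apply: no; exact: (y0u e o).
exists (fun x => (w x.1.2 x.2 - w x.1.1 x.2)%R); split.
  by exists w; split=> // y y'; case: sL => _ LB _; exact: LB.
move=> e Ee; apply/funext => -[[y y'] h].
by rewrite cE // !wc // -[RHS]/(_ - _ - (_ - _))%R subC.
Qed.

(** [rho] embeds [E] in [H], so the functions on [H] form a coinduced [E]-module. The solution is
    explicit: [s h] in [E] carries the representative [r h] of the [E]-orbit of [h] to [h], and
    [- al (s h) h] works by the cocycle identity for [s h = e * s ((rho e)^-1 * h)]. *)
Lemma H1van_regular E : is_subgroup E ->
  (forall e, E e -> rho e = 1 -> e = 1) -> H1van aH (fun=> True) E.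
Proof.
move=> sE E1 al _ alM.
pose r h := odflt 1 [pick r | `[< exists2 e, E e & rho e * r = h >]].
have rP h : exists2 e, E e & rho e * r h = h.
  rewrite /r; case: pickP => [t /asboolP //|/(_ h)].
  by rewrite asboolT //; exists 1; [exact: sub1|rewrite (hom1 rhoM) mul1g].
have rE e h : E e -> r ((rho e)^-1 * h) = r h.
  move=> Ee; rewrite /r; congr odflt; apply: eq_pick => t; apply: asbool_equiv_eq; split.
    by move=> [e' Ee' eh]; exists (e * e'); [exact: subM|rewrite rhoM -mulgA eh mulKVg].
  move=> [e' Ee' <-]; exists (e^-1 * e'); last by rewrite rhoM rhoV mulgA.
  by apply: subM => //; exact: subV.
have /choice [s sP] : forall h, exists e, E e /\ rho e * r h = h.
  by move=> h; have [e Ee eh] := rP h; exists e.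
exists (fun h => - al (s h) h)%R; split=> // e Ee; apply/funext => h.
have -> : (aH e (fun h => - al (s h) h) - (fun h => - al (s h) h))%R h =
  (- al (s ((rho e)^-1 * h)%g) ((rho e)^-1 * h)%g + al (s h) h)%R.
  by rewrite -[al (s h) h in RHS]opprK.
have [Es sh] := sP h; have [Es' sh'] := sP ((rho e)^-1 * h).
have se : s h = e * s ((rho e)^-1 * h).
  suff H0 : (e * s ((rho e)^-1 * h))^-1 * s h = 1.
    by apply: (mulgI (e * s ((rho e)^-1 * h))^-1); rewrite H0 mulVg.
  apply: E1; first by apply: subM => //; apply: subV => //; exact: subM.
  rewrite rhoM rhoV rhoM; move: sh'; rewrite rE // => /(canRL (mulgK _)) ->.
  by move: sh => /(canRL (mulgK _)) ->; rewrite -mulgA mulKVg mulVg.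
rewrite se alM //; set x := al (s _) _.
by rewrite -[RHS]/(- x + (al e h + x))%R addrCA addNr addr0.
Qed.

Definition LE (m : ME) := lcB B (fun y h => m (y, h)).
Definition LEc (m : ME) := forall y y' h, m (y, h) = m (y', h).

Lemma gmoduleE : gmodule aE LE.
Proof.
split.
- by move=> m; apply/funext => -[y h]; rewrite /aE /= invg1 (bs_act1 bO) (hom1 rhoM) invg1 mul1g.
- by move=> g g' m; apply/funext => -[y h]; rewrite /aE /= rhoM !invgM (bs_actM bO) mulgA.
- by [].
- exact: (lcB_cst bO (0%R : MH)).
- by move=> m m' lm lm'; exact: (lcB_comp2 bO (fun u v : MH => u - v)%R lm lm').
- by move=> g m lm; have H0 := lcB_comp (aH g) (lcB_act bO g^-1 lm); exact: H0.
- move=> m lm; have [N [oN fN]] := lcB_smooth bO lm.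
  exists (N `&` F); split; first exact: opnI.
  move=> n [Nn Fn]; apply/funext => -[y h].
  rewrite /aE /= (rhoF Fn) invg1 mul1g.
  exact: (congr1 (fun f => f h) (fN _ y (opnV oN Nn))).
Qed.

Lemma gmoduleEc : gmodule aE LEc.
Proof.
have g1 := gmoduleE.
split; [exact: gm_1 g1|exact: gm_M g1|exact: gm_B g1|by []| | |].
- by move=> m m' cm cm' y y' h; congr (_ - _)%R; [exact: cm|exact: cm'].
- by move=> g m cm y y' h; exact: cm.
- move=> m cm; exists F; split=> // n Fn; apply/funext => -[y h].
  by rewrite /aE /= (rhoF Fn) invg1 mul1g; exact: cm.
Qed.

Lemma H1van_Ec E (o : O) : is_subgroup E ->
  (forall e, E e -> rho e = 1 -> e = 1) -> H1van aE LEc E.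
Proof.
move=> sE E1 al alL alM.
have [||d [_ dP]] := H1van_regular sE E1 (al := fun e h => al e (o, h)).
- by [].
- by move=> e e' Ee Ee'; rewrite alM //; apply/funext => h; congr (_ + _)%R; exact: (alL e').
exists (fun x => d x.2); split=> // e Ee; apply/funext => -[y h].
by rewrite (alL _ Ee y o); exact: (congr1 (fun f => f h) (dP e Ee)).
Qed.

End Coefficients.

(** * Acyclicity *)

Section Acyclicity.
Variables (p : nat) (G U : topologicalGroupType) (X : ptopologicalType) (i : X -> U).
Hypothesis pp : prime p.
Hypothesis pX : profinite_space X.
Hypothesis Ufree : is_free_pro_p_on p i.
Variables (H : finGroupType) (rho : G -> H) (F : set G) (kappa : G -> H -> U).
Hypothesis rhoM : {morph rho : x y / x * y}.
Hypothesis oF : opn F.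
Hypothesis rhoF : forall n, F n -> rho n = 1.
Hypothesis pG : profinite_space G.
Hypothesis kappaM : forall g g' h, kappa (g * g') h = kappa g (rho g' * h) * kappa g' h.
Hypothesis kappa_smooth : forall N, opn N ->
  exists N', [/\ opn N', N' `<=` F & forall n h, N' n -> N (kappa n h)].
Hypothesis kappa_inj : forall g h, rho g = 1 -> kappa g h = 1 -> g = 1.

Let pU : is_pro_p p U. Proof. by case: Ufree. Qed.
Let cX : compact [set: X]. Proof. by case: pX. Qed.
Let aZ := actZ rho kappa.
Let vanishing (P : Type) (a : G -> (P -> 'F_p) -> P -> 'F_p) (L : (P -> 'F_p) -> Prop) :=
  forall E, is_subgroup E -> (forall e, E e -> rho e = 1 -> e = 1) ->
    @H1van G (P -> 'F_p)%type a L E.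

Section Lifting.
Variable P : Type.
Let M : zmodType := (P -> 'F_p)%type.
Variable a : G -> M -> M.

(** The local-global principle for the constant functions [c g] on the part [A = [set: H]] of the
    space of partial sections, where stabilizers meet the kernel of [rho] trivially. All other [A]
    are put into [Os], and the directions are finally frozen at the base point. *)
Lemma coinduced_vanishing (L : M -> Prop) (c : G -> M) :
  gmodule a L -> vanishing a L ->
  (forall g, L (c g)) -> (forall g h, c (g * h) = (c g + a g (c h))%R) ->
  (exists N, opn N /\ forall n, N n -> c n = 0%R) ->
  exists v : (H -> U) -> M, [/\ lcZ v, forall z, L (v z) &
    forall g z, c g = (a g (v (aZ g^-1%g z)) - v z)%R].
Proof.
move=> gM van cL cM [N [oN cN]].
have bO := BO_bspace rhoM rhoF pU.1 cX kappaM kappa_smooth.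
have full g : [set rho g * t | t in [set: H]]%SET = [set: H]%SET.
  by apply/eqP; rewrite eqEcard finset.subsetT /= card_imset //; exact: mulgI.
have fullE g (A : {set H}) : ([set rho g * t | t in A]%SET == [set: H]%SET) = (A == [set: H]%SET).
  apply/eqP/eqP => [|->]; last exact: full.
  by move=> eA; apply: (imset_inj (mulgI (rho g))); rewrite [LHS]eA [RHS]full.
pose Os : set ({set H} * ((H -> U) * (H -> X))) := [set o | o.1 != [set: H]%SET].
have [||||||||||w [lw Lw _ wc]] := local_coboundary bO pG (Gam := setT) _ _ gM (Os := Os) _ _
  (c := fun g o => if o.1 == [set: H]%SET then c g else 0%R).
- by apply/subgroupP.
- exact: closedT.
- move=> o /negP; rewrite negbK => /eqP oT.
  exists [set o' | o'.1 = [set: H]%SET]; split=> //.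
    exists setT, unit, (fun=> tt); split=> //; [exact: opnT|exact: lc_cst].
  by move=> o' oT'; apply/negP; rewrite negbK; apply/eqP.
- by move=> g [A v] _; rewrite /Os /= fullE.
- move=> g _; apply: (@level_lcB U X H _ _ setT unit (fun=> tt)) => //; last exact: lc_cst.
  exact: opnT.
- by move=> g o _; case: ifP => // _; exact: (gm_L0 gM).
- by move=> g o _ /negbTE ->.
- move=> g h [A v] _ _ /=; rewrite fullE.
  by case: ifP => _; rewrite ?cM // (gm_0 gM) addr0.
- by exists N; split=> // n o Nn _; rewrite cN //; case: ifP.
- move=> [A [z x]] /negP; rewrite negbK => /eqP /= ->.
  apply: van; first by apply: (stab_subgroup _ bO); apply/subgroupP.
  move=> e; apply: (stab_free pU.1 kappa_inj).
  by apply/finset.set0Pn; exists 1; rewrite finset.in_setT.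
have [N1 [K [cl [oN1 lcl wN]]]] := lcB_level rhoM rhoF pU.1 cX kappaM kappa_smooth lw.
exists (fun z => w ([set: H]%SET, (z, fun=> point))); split=> //.
- by exists N1; split=> // z z' zz'; apply: wN => t _; split=> //; exact: zz'.
- move=> g z; have := wc g ([set: H]%SET, (z, fun=> point)) Logic.I.
  by rewrite /= eqxx /actO /= full.
Qed.

(* If [c] is, modulo [L1] and over the free space [H -> U], the coboundary of
   [v], then [c] and [v] can be corrected by elements of [L1] so that this
   holds exactly. *)
Lemma coinduced_lift (L L1 : M -> Prop) (c : G -> M) (v : (H -> U) -> M) :
  gmodule a L -> gmodule a L1 -> vanishing a L1 ->
  lcZ v -> (forall z, L (v z)) ->
  (forall g z, L1 (c g - (a g (v (aZ g^-1%g z)) - v z))%R) ->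
  exists v' : (H -> U) -> M, [/\ lcZ v', forall z, L1 (v' z - v z)%R &
    forall g, exists m, L1 (m - c g)%R /\ forall z, m = (a g (v' (aZ g^-1%g z)) - v' z)%R].
Proof.
move=> gL gM van lv Lv cv.
pose r g z := (c g - (a g (v (aZ g^-1%g z)) - v z))%R.
have aZM g h z : aZ h^-1 (aZ g^-1 z) = aZ (g * h)^-1 z.
  by rewrite /aZ -(actZ_M rhoM kappaM) invgM.
have [||||s [ls Ls sr]] := tensor_induced_coboundary pp pX Ufree rhoM rhoF pG kappaM
  kappa_smooth kappa_inj gM van (c := r).
- move=> g; apply: lcZB; last by apply: lcZB => //; exact: (@lcZ_act p G U H rho kappa P a g v lv).
  by exists setT; split=> //; exact: opnT.
- exact: cv.
- move=> g h; exists (c (g * h)%g - (c g + a g (c h)))%R => z.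
  rewrite /r !(gm_B gM) aZM -(gm_M gM).
  set x := c (g * h)%g; set y := c g; set y' := a g (c h).
  set u := a (g * h)%g _; set u' := a g (v _); set u'' := v z.
  transitivity (y + y' + (x - (y + y')) - (u - u''))%R; last exact: cocycle_shift.
  by rewrite [(y + y' + _)%R]addrC subrK.
- have [N [oN vN]] := lcZ_smooth pp Ufree rhoM rhoF kappa_smooth gL lv Lv.
  by exists N; split=> // n z z' Nn; rewrite /r !vN // !subrr.
exists (fun z => v z + s z)%R; split.
- have : lcZ (fun z => v z - (0 - s z))%R.
    apply: lcZB => //; apply: lcZB => //; exists setT; split=> //; exact: opnT.
  by move=> [N [oN vN]]; exists N; split=> // z z' /vN; rewrite !sub0r !opprK.
- by move=> z; rewrite addrC addKr.
- move=> g; have [k rk] := sr g.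
  exists (c g - k)%R; split.
    rewrite addrC addKr; apply: (gm_LN gM).
    have z : H -> U := fun=> 1.
    rewrite (_ : k = r g z - (a g (s (aZ g^-1%g z)) - s z))%R; last by rewrite rk addrC addKr.
    exact: (gm_LB gM (cv g z) (gm_LB gM (gm_La gM g (Ls _)) (Ls z))).
  move=> z; have := rk z; rewrite /r (gm_D gM) => /eqP; rewrite subr_eq => /eqP ->.
  by rewrite opprD addrAC addrK [RHS]addrACA [RHS]addrC.
Qed.

End Lifting.

Variables (O : Type) (act : G -> O -> O) (B : set (set O)).
Hypothesis bO : bspace act B.
Hypothesis stabO : forall o e, stab act B setT o e -> rho e = 1 -> e = 1.
Hypothesis fixO : forall E, is_subgroup E -> (forall e, E e -> rho e = 1 -> e = 1) ->
  (forall e, E e -> e = 1) \/ exists y0,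
    (forall e, E e -> indist B y0 (act e y0)) /\
    (forall e y, E e -> e <> 1 -> indist B y (act e y) -> indist B y0 y).

Let MH : zmodType := (H -> 'F_p)%type.
Let MO : zmodType := (O * O * H -> 'F_p)%type.
Let ME : zmodType := (O * H -> 'F_p)%type.
Let aHp : G -> MH -> MH := aH rho.
Let aDp : G -> MO -> MO := aD rho act.
Let aEp : G -> ME -> ME := aE rho act.

Let Lcst (m : MH) := forall h h', m h = m h'.
Let Lsum (m : MH) := (\sum_h m h = 0)%R.
Let Lall (m : MH) := True.

Let s_cst : submoduleH rho Lcst.
Proof.
split=> // [m m' cm cm' h h'|g m cm h h']; last exact: cm.
by congr (_ - _)%R; [exact: cm|exact: cm'].
Qed.

Let sum_act (m : MH) g : (\sum_h aHp g m h = \sum_h m h)%R.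
Proof.
rewrite [RHS](reindex_inj (mulgI (rho g)^-1)).
by apply: eq_bigr => h _.
Qed.

Let s_sum : submoduleH rho Lsum.
Proof.
split=> [|m m' cm cm'|g m cm].
- by rewrite /Lsum big1.
- transitivity (\sum_h m h - \sum_h m' h)%R; last by rewrite cm cm' subr0.
  by rewrite -sumrB; apply: eq_bigr.
- by rewrite /Lsum sum_act.
Qed.

Let s_all : submoduleH rho Lall. Proof. by []. Qed.

Let sum_at (t : H) (x : 'F_p) : (\sum_h (if h == t then x else 0) = x)%R.
Proof. by rewrite -big_mkcond big_pred1_eq. Qed.

Let DLsum (m : MO) : DL B Lall m -> (forall y y', \sum_h m (y, y', h) = 0)%R -> DL B Lsum m.
Proof.
move=> [f [lf _ mf]] m0; exists f; split=> // y y'.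
by rewrite /Lsum -[RHS](m0 y y'); apply: eq_bigr => h _; rewrite mf.
Qed.

Let DLall L (m : MO) : DL B L m -> DL B Lall m.
Proof. by move=> [f [lf _ mf]]; exists f. Qed.

(** A section of the sum map from ['F_p^H] to ['F_p]. It is not equivariant, but its defect has sum
    zero, that is, lies in [Lsum]. *)
Let at1 (m : MO) : MO := fun x => if x.2 == 1 then m (x.1, 1) else 0%R.

Let DLat1 L m : DL B L m -> DL B Lall (at1 m).
Proof.
move=> [f [lf _ mf]]; exists (fun y h => if h == 1 then f y 1 else 0%R); split=> //.
  exact: (lcB_comp (fun (m : MH) h => if h == 1 then m 1 else 0%R) lf).
by move=> y y' h; rewrite /at1 /=; case: ifP => _; rewrite ?mf ?subrr.
Qed.

(** [cD] is an exact cocycle of functions modulo constants and becomes the coboundary of [v] over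
    [U^H]. The first [coinduced_lift] lifts it from coefficients ['F_p] to ['F_p^H], correcting by
    [Lsum]; the second lifts from functions modulo constants to functions, correcting by [LEc]. The
    result [m3] has regular coefficients and is solved on [O] itself; summing over [H] returns to
    ['F_p]. *)
Theorem acyclic (c : G -> O -> 'F_p) : (forall g, lcB B (c g)) ->
  (forall g h, exists k, forall y, c (g * h) y = (c g y + c h (act g^-1%g y) + k)%R) ->
  (exists N, opn N /\ forall n y y', N n -> c n y = c n y') ->
  exists w, lcB B w /\ forall g, exists k, forall y, c g y = (w (act g^-1%g y) - w y + k)%R.
Proof.
move=> lc_c cM [N [oN cN]].
have [[o1 _]|nO] := pselect (exists o : O, True); last first.
  exists (fun=> 0%R); split; first exact: (lcB_cst bO (0%R : 'F_p)).
  by move=> g; exists 0%R => y; case: nO; exists y.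
have gD L sL := @gmoduleD p G H rho F rhoM oF rhoF O act B bO L sL.
have vD L (sL : submoduleH rho L) : vanishing aDp (DL B L).
  by move=> E sE E1; apply: (H1van_DL rhoM oF rhoF pG bO fixO sL sE E1).
pose cD g : MO := fun x => (c g x.1.2 - c g x.1.1)%R.
have [|||v [lv Lv cv]] := coinduced_vanishing (gD _ s_cst) (vD _ s_cst) (c := cD).
- move=> g; exists (fun y _ => c g y); split=> //.
  exact: (lcB_comp (fun t (_ : H) => t) (lc_c g)).
- move=> g h; have [k ck] := cM g h; apply/funext => -[[y y'] t].
  have -> : (cD g + aDp g (cD h))%R (y, y', t) =
    ((c g y' - c g y) + (c h (act g^-1%g y') - c h (act g^-1%g y)))%R by [].
  by rewrite /cD /= !ck opprD addrACA subrr addr0 opprD addrACA.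
- by exists N; split=> // n Nn; apply/funext => -[[y y'] t]; rewrite /cD /= (cN n y y') ?subrr.
have v_at1 z : DL B Lall (at1 (v z)) := DLat1 (Lv z).
have [|||v' [lv' Lv' cv']] := coinduced_lift (c := fun g => at1 (cD g)) (v := fun z => at1 (v z))
  (gD _ s_all) (gD _ s_sum) (vD _ s_sum).
- by move: lv => [V [oV vV]]; exists V; split=> // z z' /vV ->.
- exact: v_at1.
- move=> g z; apply: DLsum.
    apply: (gm_LB (gD _ s_all)).
      apply: (@DLat1 Lcst); exists (fun y _ => c g y); split=> //.
      exact: (lcB_comp (fun t (_ : H) => t) (lc_c g)).
    apply: (gm_LB (gD _ s_all)) => //; exact: (gm_La (gD _ s_all)).
  move=> y y'; set z' := aZ g^-1 z.
  transitivity (cD g (y, y', 1%g) - (v z' (act g^-1%g y, act g^-1%g y', 1%g) - v z (y, y', 1%g)))%R.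
    rewrite -[X in _ = (X - _)%R](sum_at 1) -[X in _ = (_ - (X - _))%R](sum_at (rho g)).
    rewrite -[X in _ = (_ - (_ - X))%R](sum_at 1) -!sumrB; apply: eq_bigr => h _.
    congr (_ - (_ - _))%R; rewrite /at1 /aDp /aD /=.
    by rewrite -eq_mulVg1 eq_sym.
  have [f [_ Lf mf]] := Lv z'.
  rewrite (cv g z) -/z'.
  have -> : (aDp g (v z') - v z)%R (y, y', 1%g) =
    (v z' (act g^-1%g y, act g^-1%g y', (rho g)^-1 * 1)%g - v z (y, y', 1%g))%R by [].
  rewrite (_ : v z' (_, _, _ * _) = v z' (act g^-1%g y, act g^-1%g y', 1%g)) ?subrr //.
  by rewrite !mf; exact: Lf.
have {cv'} [c2 c2P] := choice cv'.
have Lv'a z : DL B Lall (v' z).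
  by rewrite -[v' z](subrK (at1 (v z))); apply: (gm_LD (gD _ s_all)) => //; exact: DLall (Lv' z).
(* Fixing the first point to be [o1] picks a function out of each class modulo constants. This
   choice is equivariant up to functions constant on [O], which is why [LEc] is the module of
   corrections. *)
pose V z : ME := fun x => v' z (o1, x.1, x.2).
pose c3 g : ME := fun x => c2 g (o1, x.1, x.2).
have gE := @gmoduleE p G H rho F rhoM oF rhoF O act B bO.
have gEc := @gmoduleEc p G H rho F rhoM oF rhoF O act B bO.
have LEcE (m : ME) : LEc m -> LE B m.
  by move=> cm o; exists setT; split=> //; [exact: (bsT bO)|move=> o' _; apply/funext => h; exact: cm].
have LV z : LE B (V z).
  have [f [lf _ mf]] := Lv'a z.
  have := lcB_comp (fun m : MH => m - f o1)%R lf.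
  by rewrite (_ : _ \o _ = fun y h => V z (y, h)) //; apply/funext => y; apply/funext => h; rewrite /V /= mf.
have [|||V' [lV' LV' cV']] := coinduced_lift (c := c3) (v := V) gE gEc
  (fun E sE E1 => H1van_Ec rhoM o1 sE E1).
- by move: lv' => [W [oW vW]]; exists W; split=> // z z' /vW zz'; rewrite /V zz'.
- exact: LV.
- move=> g z y y' h; set z' := aZ g^-1 z.
  have [_ c2g] := c2P g.
  have E0 x : (c3 g - (aEp g (V z') - V z))%R (x, h) =
      v' z' (act g^-1%g o1, o1, (rho g)^-1 * h)%g.
    have -> : (c3 g - (aEp g (V z') - V z))%R (x, h) = (c2 g (o1, x, h) -
      (v' z' (o1, act g^-1%g x, (rho g)^-1 * h)%g - v' z (o1, x, h)))%R by [].
    rewrite (c2g z) -/z'.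
    have -> : (aDp g (v' z') - v' z)%R (o1, x, h) =
      (v' z' (act g^-1%g o1, act g^-1%g x, (rho g)^-1 * h)%g - v' z (o1, x, h))%R by [].
    have [f [_ _ mf]] := Lv'a z'.
    by rewrite opprB addrA subrK !mf opprB addrC addrA subrK.
  by rewrite !E0.
have {cV'} [m3 m3P] := choice cV'.
have LV'E z : LE B (V' z).
  rewrite -[V' z](subrK (V z)); apply: (gm_LD gE) => //; apply: LEcE; exact: LV'.
have z0 : H -> U := fun=> 1.
have [||||||||||w [lw _ _ wc]] := local_coboundary bO pG (Gam := setT) _ _
  (gmoduleH rhoM oF rhoF s_all) (Os := set0) _ _ (c := fun g y h => m3 g (y, h)).
- by apply/subgroupP.
- exact: closedT.
- by move=> o _; exists setT; split=> [||o' _ []] //; exact: (bsT bO).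
- by [].
- move=> g _; have [_ m3g] := m3P g.
  suff : LE B (m3 g) by [].
  by rewrite (m3g z0); apply: (gm_LB gE (gm_La gE _ _)); exact: LV'E.
- by [].
- by [].
- move=> g h o _ _; apply/funext => t.
  suff -> : m3 (g * h) = (m3 g + aEp g (m3 h))%R by [].
  have [_ m3gh] := m3P (g * h)%g; have [_ m3g] := m3P g; have [_ m3h] := m3P h.
  rewrite (m3gh z0) (m3g z0) (m3h (aZ g^-1 z0)) /aEp (gm_B gE) -(gm_M gE).
  rewrite (_ : aZ h^-1 (aZ g^-1 z0) = aZ (g * h)^-1 z0).
    by rewrite [RHS]addrC addrA subrK.
  by rewrite /aZ -(actZ_M rhoM kappaM) invgM.
- have [N' [oN' VN']] := lcZ_smooth pp Ufree rhoM rhoF kappa_smooth gE lV' LV'E.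
  exists N'; split=> // n o Nn _; have [_ m3n] := m3P n.
  by rewrite (m3n z0) VN' // subrr.
- move=> o _; apply: (H1van_regular rhoM); last exact: stabO.
  by apply: (stab_subgroup _ bO); apply/subgroupP.
exists (fun y => \sum_h w y h)%R; split; first exact: (lcB_comp (fun m : MH => \sum_h m h)%R lw).
move=> g; exists (c g o1 - (\sum_h (m3 g - c3 g)%R (o1, h)))%R => y.
have [L3 _] := m3P g; have [[f [_ Lf mf]] _] := c2P g.
have sc3 : (\sum_h c3 g (y, h) = c g y - c g o1)%R.
  rewrite -(sum_at 1 (c g y - c g o1)%R); apply/eqP; rewrite -subr_eq0 -sumrB; apply/eqP.
  rewrite -[RHS](Lf o1 y); apply: eq_bigr => h _; rewrite -[RHS]mf.
  by rewrite /c3 /at1 /cD /=.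
have sm3 : (\sum_h m3 g (y, h) = \sum_h w (act g^-1%g y) h - \sum_h w y h)%R.
  rewrite -(sum_act (w (act g^-1%g y)) g) -sumrB; apply: eq_bigr => h _.
  exact: (congr1 (fun m : MH => m h) (wc g y Logic.I)).
have -> : (\sum_h (m3 g - c3 g)%R (o1, h) = \sum_h m3 g (y, h) - \sum_h c3 g (y, h))%R.
  by rewrite -sumrB; apply: eq_bigr => h _; exact: (L3 o1 y).
rewrite -sm3 sc3; set S := (\sum_h _)%R.
by rewrite opprB addrA [(_ - _ - S)%R]addrC addrACA subrr add0r addrC subrK.
Qed.

End Acyclicity.

(** * Finite subgroups *)

Lemma finite_powers_torsion (G : groupType) (x : G) (A : set G) :
  finite_set A -> (forall n, A (x ^+ n)) -> torsion x.
Proof.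
move=> fA Ax; apply: contrapT => nt.
have inj : injective (fun n => x ^+ n).
  suff H n m : (n < m)%N -> x ^+ n <> x ^+ m.
    by move=> n m xnm; case: (ltngtP n m) => // [/H|/H]; [case|case; exact/esym].
  move=> nm xnm; apply: nt; exists (m - n)%N; split; first by rewrite subn_gt0.
  by apply: (mulgI (x ^+ n)); rewrite -expgnDr subnKC 1?ltnW // mulg1.
apply: infinite_nat; have fr : finite_set (range (fun n => x ^+ n)).
  by apply: sub_finite_set fA => _ [n _ <-].
rewrite -(eq_finite_set (@inj_card_eq _ _ setT (fun n => x ^+ n) _)) //.
by move=> n m _ _; exact: inj.
Qed.

Section FiniteSubgroups.
Variables (p : nat) (G : topologicalGroupType) (H : finGroupType) (rho : G -> H).
Hypothesis pH : p.-group [set: H]%G.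
Hypothesis rhoM : {morph rho : x y / x * y}.
Hypothesis tfree : forall x, rho x = 1 -> torsion x -> x = 1.
Hypothesis centG : forall x : G, torsion x -> x <> 1 -> finite_set (centralizer x).

Let rhoV g : rho g^-1 = (rho g)^-1. Proof. exact: homV. Qed.
Let rho1 : rho 1 = 1. Proof. exact: hom1. Qed.
Let rhoX g n : rho (g ^+ n) = rho g ^+ n.
Proof. by elim: n => [|n IH]; rewrite ?expg0 // !expgS rhoM IH. Qed.

(** [H] is finite and the kernel of [rho] has no torsion, so these are exactly the finite subgroups
    of [G]. *)
Definition free_of_kernel (E : set G) :=
  is_subgroup E /\ forall e, E e -> rho e = 1 -> e = 1.

Lemma fok_inj E (x y : G) : free_of_kernel E -> E x -> E y -> rho x = rho y -> x = y.
Proof.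
move=> [sE E1] Ex Ey xy; apply: (mulIg y^-1); rewrite mulgV.
apply: E1; first by apply: subM => //; exact: subV.
by rewrite rhoM rhoV xy mulgV.
Qed.

Lemma subX E (x : G) n : is_subgroup E -> E x -> E (x ^+ n).
Proof.
move=> sE Ex; elim: n => [|n IH]; first by rewrite expg0; exact: sub1.
by rewrite expgS; exact: subM.
Qed.

Lemma rho_card (x : G) : rho (x ^+ #|H|) = 1.
Proof. by rewrite rhoX; apply/eqP; rewrite -order_dvdn -cardsT order_dvdG ?finset.in_setT. Qed.

Lemma fok_torsion E (x : G) : free_of_kernel E -> E x -> torsion x.
Proof.
move=> [sE E1] Ex; exists #|H|; split; first by rewrite -cardsT cardG_gt0.
by apply: E1; [exact: subX|exact: rho_card].
Qed.

Lemma torsion_card (x : G) : torsion x -> x ^+ #|H| = 1.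
Proof.
move=> [n [n0 xn]]; apply: tfree; first exact: rho_card.
by exists n; split=> //; rewrite -expgnA mulnC expgnA xn expg1n.
Qed.

(** The powers of [e] stay in the finite centralizer of [t], so [e] is torsion, and the kernel of
    [rho] has no torsion. *)
Lemma centralizer_kernel (t e : G) : torsion t -> t <> 1 -> commute t e -> rho e = 1 -> e = 1.
Proof.
move=> tt t1 te re; apply: tfree => //; apply: (finite_powers_torsion (centG tt t1)) => n.
by rewrite /centralizer /=; exact: commuteX.
Qed.

Definition image_group (E : set G) : {set H} := [set h | `[< exists2 e, E e & rho e = h >]]%SET.

Lemma image_groupP E h : reflect (exists2 e, E e & rho e = h) (h \in image_group E).
Proof. by rewrite inE; exact: asboolP. Qed.

Lemma image_group_set E : is_subgroup E -> group_set (image_group E).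
Proof.
move=> sE; apply/group_setP; split.
  by apply/image_groupP; exists 1; [exact: sub1|].
move=> _ _ /image_groupP [x Ex <-] /image_groupP [y Ey <-].
by apply/image_groupP; exists (x * y); [exact: subM|rewrite rhoM].
Qed.

Definition normalizer (S : set G) : set G :=
  [set x | forall s, S s -> S (x^-1 * s * x) /\ S (x * s * x^-1)].

(** Conjugation by an element of the kernel does not change [rho], and [rho] is injective on [S]; so
    an element of the kernel that normalizes [S] centralizes [s]. *)
Lemma normalizer_fok S (s : G) : free_of_kernel S -> S s -> s <> 1 ->
  free_of_kernel (normalizer S).
Proof.
move=> fS Ss s1; have [sS S1] := fS; split.
  apply/subgroupP; split; first by move=> t St; rewrite invg1 !mulg1 !mul1g.
  move=> x y nx ny t St; rewrite !invgM !invgK; split.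
    have [_] := ny _ (nx t St).1; by rewrite !mulgA.
  have [+ _] := ny t St; move=> /(nx _) [_]; by rewrite !mulgA.
move=> e ne re; apply: (@centralizer_kernel s) => //; first exact: fok_torsion fS Ss.
suff es : e^-1 * s * e = s by rewrite /commute -[in RHS]es !mulgA mulgV mul1g.
apply: (fok_inj fS) => //; first by case: (ne s Ss).
by rewrite !rhoM rhoV re invg1 mul1g mulg1.
Qed.

Lemma normalizer_grows (D E : set G) : free_of_kernel D -> free_of_kernel E ->
  D `<=` E -> ~ E `<=` D ->
  exists x, [/\ E x, normalizer D x & ~ D x].
Proof.
move=> fD fE sDE nED.
have [sD _] := fD; have [sE _] := fE.
pose gD := Group (image_group_set sD); pose gE := Group (image_group_set sE).
have pDE : gD \proper gE.
  apply/properP; split.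
    by apply/fintype.subsetP => _ /image_groupP [x Dx <-]; apply/image_groupP; exists x => //; exact: sDE.
  have [x Ex nDx] : exists2 x, E x & ~ D x.
    by apply: contrapT => no; apply: nED => x Ex; apply: contrapT => nDx; apply: no; exists x.
  exists (rho x); first by apply/image_groupP; exists x.
  apply/image_groupP => [] [y Dy yx]; apply: nDx.
  by rewrite (fok_inj fE Ex (sDE _ Dy)).
have nE : nilpotent gE.
  by apply: pgroup_nil (pgroupS _ pH); exact: finset.subsetT.
have /properP [_ [h /setIP [/image_groupP [x Ex xh] nh] nDh]] := nilpotent_proper_norm nE pDE.
exists x; split=> //; last by move=> Dx; case/negP: nDh; apply/image_groupP; exists x.
have key y : E y -> rho y \in 'N(gD) -> forall s, D s -> D (y^-1 * s * y).
  move=> Ey ny s Ds; have /image_groupP [d Dd dE] : rho s ^ rho y \in image_group D.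
    by rewrite (memJ_norm (rho s) ny); apply/image_groupP; exists s.
  suff -> : y^-1 * s * y = d by [].
  apply: (fok_inj fE) => //; [|exact: sDE|by rewrite dE !rhoM rhoV conjgE mulgA].
  by apply: subM => //; apply: subM => //; [exact: subV|exact: sDE].
move=> s Ds; split; first by apply: key; rewrite ?xh.
rewrite -{1}[x]invgK; apply: key => //; first exact: subV.
by rewrite rhoV groupV xh.
Qed.

(* Trivial intersection, by downward induction on the size of the
   intersection [D]: when [D] is proper in both subgroups they both meet the
   normalizer of [D], again free of the kernel, in more than [D]. *)
Lemma common_overgroup E E' (x : G) : free_of_kernel E -> free_of_kernel E' ->
  E x -> E' x -> x <> 1 ->
  exists K, [/\ free_of_kernel K, E `<=` K & E' `<=` K].
Proof.
move=> + + + + x1; have [m] := ubnP (#|H| - #|image_group (E `&` E')|).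
elim: m E E' => [//|m IH] E E' cEE' fE fE' Ex E'x.
have [sEE'|nEE'] := pselect (E `<=` E'); first by exists E'; split.
have [sE'E|nE'E] := pselect (E' `<=` E); first by exists E; split.
set D := E `&` E' in cEE'.
have fD : free_of_kernel D.
  case: fE fE' => sE E1 [sE' _]; split; last by move=> e [Ee _]; exact: E1.
  apply/subgroupP; split; first by split; exact: sub1.
  by move=> y z [Ey E'y] [Ez E'z]; split; apply: subM => //; exact: subV.
have fN := normalizer_fok fD (conj Ex E'x) x1.
have DN : D `<=` normalizer D.
  move=> y Dy s Ds; have [sD _] := fD.
  by split; apply: subM => //; [apply: subM => //|exact: subM|]; exact: subV.
have grow A : free_of_kernel A -> (D `<=` A) -> ~ A `<=` D ->
    (#|image_group D| < #|image_group (A `&` normalizer D)|)%N.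
  move=> fA DA nAD; have [y [Ay Ny nDy]] := normalizer_grows fD fA DA nAD.
  apply: proper_card; apply/properP; split.
    by apply/fintype.subsetP => _ /image_groupP [z Dz <-]; apply/image_groupP; exists z;
      [split; [exact: DA|exact: DN]|].
  exists (rho y); first by apply/image_groupP; exists y.
  by apply/image_groupP => [] [z Dz zy]; apply: nDy; rewrite (fok_inj fA Ay (DA _ Dz)).
have mono A A' : A `<=` A' -> (#|image_group A| <= #|image_group A'|)%N.
  move=> AA'; apply: subset_leq_card; apply/fintype.subsetP => _ /image_groupP [z Az <-].
  by apply/image_groupP; exists z => //; exact: AA'.
have IH' A A' : (#|image_group D| < #|image_group (A `&` A')|)%N ->
    free_of_kernel A -> free_of_kernel A' -> A x -> A' x ->
    exists K, [/\ free_of_kernel K, A `<=` K & A' `<=` K].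
  move=> cA; apply: IH; apply: leq_trans (_ : _ <= #|H| - #|image_group D|)%N _; last by [].
  have := max_card (mem (image_group (A `&` A'))).
  move=> le_cA; apply: ltn_sub2l (cA); exact: leq_trans cA le_cA.
have [K1 [fK1 EK1 NK1]] : exists K, [/\ free_of_kernel K, E `<=` K & normalizer D `<=` K].
  apply: IH' => //; last by apply: DN.
  by apply: grow => // [y []//|ED]; apply: nEE' => y /ED [].
have [K2 [fK2 EK2 NK2]] : exists K, [/\ free_of_kernel K, E' `<=` K & normalizer D `<=` K].
  apply: IH' => //; last by apply: DN.
  by apply: grow => // [y []//|ED]; apply: nE'E => y /ED [].
have [|||||K [fK K1K K2K]] := IH' K1 K2; rewrite //; try by [exact: EK1|exact: EK2].
  apply: leq_trans (mono (E `&` normalizer D) _ _).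
    by apply: grow => // [y []//|ED]; apply: nEE' => y /ED [].
  by move=> y [_ Ny]; split; [exact: NK1|exact: NK2].
by exists K; split=> // y Ay; [apply: K1K; exact: EK1|apply: K2K; exact: EK2].
Qed.

End FiniteSubgroups.

(** * The space of finite subgroups *)

Lemma closed_preimage (X Y : topologicalType) (f : X -> Y) (A : set Y) :
  continuous f -> closed A -> closed [set x | A (f x)].
Proof. by move=> /continuous_closedP cf; exact: cf. Qed.

Lemma compact_image_closed (X Y : topologicalType) (f : X -> Y) (A : set X) :
  compact [set: X] -> hausdorff_space Y -> continuous f -> closed A -> closed (f @` A).
Proof.
move=> cX hY cf cA; apply: compact_closed => //; apply: continuous_compact.
  exact: continuous_subspaceT.
exact: subclosed_compact cX _.
Qed.

Lemma zero_dimensional_hausdorff (X : topologicalType) :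
  zero_dimensional X -> hausdorff_space X.
Proof.
move=> zX; rewrite open_hausdorff => x y /zX [C [[oC cC] Cx nCy]].
exists (C, ~` C) => /=; first by split; apply/mem_set.
by split=> //; [exact: closed_openC|rewrite setICr].
Qed.

Lemma zero_dimensional_profinite (X : topologicalType) :
  compact [set: X] -> zero_dimensional X -> profinite_space X.
Proof.
move=> cX zX; split=> //; first exact: zero_dimensional_hausdorff.
exact: zero_dimension_totally_disconnected.
Qed.

Lemma profinite_prod (X Y : topologicalType) :
  profinite_space X -> profinite_space Y -> profinite_space (X * Y)%type.
Proof.
move=> [cX hX tX] [cY hY tY]; apply: zero_dimensional_profinite.
  by rewrite -setXTT; exact: compact_setX.
have clp (Z : topologicalType) (f : X * Y -> Z) C : continuous f -> clopen C -> clopen (f @^-1` C).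
  move=> cf [oC cC]; split; last exact: closed_preimage.
  by apply: open_comp => // z _; exact: cf.
move=> [x y] [x' y'] /eqP ne; have [xx'|/eqP xx'] := pselect (x = x').
  have /eqP yy' : y <> y' by move=> yy'; apply: ne; rewrite xx' yy'.
  have [C [cC Cy nCy]] := profinite_zero_dimensional cY hY tY yy'.
  by exists (snd @^-1` C); split=> //; apply: clp => //; exact: (@continuous_snd X Y).
have [C [cC Cx nCx]] := profinite_zero_dimensional cX hX tX xx'.
by exists (fst @^-1` C); split=> //; apply: clp => //; exact: (@continuous_fst X Y).
Qed.

Section TorsionSpace.
Variables (p : nat) (G : topologicalGroupType) (H : finGroupType) (rho : G -> H) (F : set G).
Hypothesis pH : p.-group [set: H]%G.
Hypothesis rhoM : {morph rho : x y / x * y}.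
Hypothesis oF : opn F.
Hypothesis rhoF : forall n, F n <-> rho n = 1.
Hypothesis pG : profinite_space G.
Hypothesis tfree : forall x, rho x = 1 -> torsion x -> x = 1.
Hypothesis centG : forall x : G, torsion x -> x <> 1 -> finite_set (centralizer x).

Let rhoV g : rho g^-1 = (rho g)^-1. Proof. exact: homV. Qed.
Let rho1 : rho 1 = 1. Proof. exact: hom1. Qed.
Let rhoX g n : rho (g ^+ n) = rho g ^+ n.
Proof. by elim: n => [|n IH]; rewrite ?expg0 // !expgS rhoM IH. Qed.
Let hG : hausdorff_space G. Proof. by case: pG. Qed.
Let cG : compact [set: G]. Proof. by case: pG. Qed.
Let lrho : lc rho. Proof. by apply: (lc_hom oF rhoM) => x /rhoF. Qed.
Let cst_c (X Y : topologicalType) (y : Y) : continuous (fun _ : X => y).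
Proof. by move=> x; exact: cst_continuous. Qed.

Definition nontrivial_torsion : set G := [set t | torsion t /\ t <> 1].
Let Tor := nontrivial_torsion.

Definition linked (t t' : G) := exists K, [/\ free_of_kernel rho K, K t & K t'].

Lemma linked_sym t t' : linked t t' -> linked t' t.
Proof. by move=> [K [fK Kt Kt']]; exists K. Qed.

Lemma linked_trans t t' t'' : t' <> 1 -> linked t t' -> linked t' t'' -> linked t t''.
Proof.
move=> t1 [K [fK Kt Kt']] [K' [fK' K't' K't'']].
have [K0 [fK0 KK0 KK0']] := common_overgroup pH rhoM tfree centG fK fK' Kt' K't' t1.
by exists K0; split=> //; [exact: KK0|exact: KK0'].
Qed.

Lemma linked_conj g t t' : linked t t' -> linked (g * t * g^-1) (g * t' * g^-1).
Proof.
move=> [K [[sK K1] Kt Kt']]; exists [set x | K (g^-1 * x * g)].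
have conjK x : g^-1 * (g * x * g^-1) * g = x by rewrite !mulgA mulVg mul1g mulgVK.
split; rewrite /= ?conjK //; split.
  apply/subgroupP; split; first by rewrite /= mulg1 mulVg; exact: sub1.
  move=> x y /= Kx Ky; have := subM sK Kx (subV sK Ky).
  by rewrite !invgM invgK !mulgA mulgK.
move=> e /= Ke re; have e1 : g^-1 * e * g = 1.
  by apply: K1 => //; rewrite !rhoM re rhoV mulg1 mulVg.
have -> : e = g * (g^-1 * e * g) * g^-1 by rewrite !mulgA mulgV mul1g mulgK.
by rewrite e1 mulg1 mulgV.
Qed.

Lemma linked_eq t t' : linked t t' -> rho t = rho t' -> t = t'.
Proof. by move=> [K [fK Kt Kt']]; exact: fok_inj fK Kt Kt'. Qed.

Let word (s : seq bool) (z : G * G) : G :=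
  foldr (fun b x => (if b then z.1 else z.2) * x) 1 s.

Let word_cat s s' z : word (s ++ s') z = word s z * word s' z.
Proof. by elim: s => [|b s IH]; rewrite /= ?mul1g // IH mulgA. Qed.

Let word_continuous s : continuous (word s).
Proof.
elim: s => [|b s IH]; first exact: cst_c.
case: b; apply: continuousM => //.
  exact: continuous_fst.
exact: continuous_snd.
Qed.

(** The words in [t] and [t'] form a monoid; if they meet the kernel trivially, each has order
    dividing [#|H|] and the monoid is a group. This splits being linked into one closed condition
    per word, whence the relation is closed. *)
Let linkedP t t' : linked t t' <->
  forall s, rho (word s (t, t')) = 1 -> word s (t, t') = 1.
Proof.
split=> [[K [[sK K1] Kt Kt']] s|w1].
  apply: K1; elim: s => [|b s IH] /=; first exact: sub1.
  by apply: subM => //; case: b.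
exists [set x | exists s, word s (t, t') = x]; split; [|by exists [:: true]; rewrite /= mulg1|
  by exists [:: false]; rewrite /= mulg1].
split; last by move=> _ [s <-]; exact: w1.
have wX s n : exists s', word s' (t, t') = word s (t, t') ^+ n.
  elim: n => [|n [s' IH]]; first by exists [::].
  by exists (s ++ s'); rewrite word_cat IH expgS.
apply/subgroupP; split; first by exists [::].
move=> _ _ [s <-] [s' <-]; have [s'' E] := wX s' #|H|.-1.
exists (s ++ s''); rewrite word_cat E; congr (_ * _).
apply: (mulgI (word s' (t, t'))); rewrite -expgS mulgV prednK; last by rewrite -cardsT cardG_gt0.
have [s1 E1] := wX s' #|H|; rewrite -E1; apply: w1.
by rewrite E1; exact: rho_card.
Qed.

Let linked_closed : closed [set z : G * G | linked z.1 z.2].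
Proof.
rewrite (_ : mkset _ = \bigcap_(s in [set: seq bool])
    ([set z | rho (word s z) <> 1] `|` [set z | word s z = 1])).
  apply: closed_bigI => s _; apply: closedU.
    have [_ ] := lc_preimage_clopen (fun h => h <> 1) (lc_continuous (@word_continuous s) lrho).
    by [].
  apply: (@closed_preimage _ _ (word s) [set 1] (@word_continuous s)).
  exact: accessible_closed_set1 (hausdorff_accessible hG) 1.
apply/seteqP; split=> -[t t'] /=.
  move=> /linkedP w s _ /=; have [r1|] := pselect (rho (word s (t, t')) = 1); last by left.
  by right; exact: w.
by move=> w; apply/linkedP => s r1; case: (w s Logic.I).
Qed.

Let Tor_closed : closed Tor.
Proof.
rewrite (_ : Tor = [set t | t ^+ #|H| = 1] `&` ~` F).
  apply: closedI; last by apply: open_closedC; case: oF.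
  apply: (@closed_preimage _ _ (fun t : G => t ^+ #|H|) [set 1]).
    elim: #|H| => [|n IH]; first exact: cst_c.
    rewrite (_ : (fun t => _) = (fun t : G => t * t ^+ n)); last by apply/funext => t; rewrite expgS.
    apply: continuousM => //; exact: continuous_id.
  exact: accessible_closed_set1 (hausdorff_accessible hG) 1.
apply/seteqP; split=> t /=.
  by move=> [tt t1]; split; [exact: torsion_card tt|move=> /rhoF /tfree /(_ tt)].
move=> [tH nFt]; split; last by move=> t1; apply: nFt; rewrite t1; exact: opn1.
by exists #|H|; split=> //; rewrite -cardsT cardG_gt0.
Qed.

Let linked_refl t : torsion t -> linked t t.
Proof.
move=> tt; apply/linkedP => s r1; apply: tfree => //; exists #|H|.
split; first by rewrite -cardsT cardG_gt0.
have -> : word s (t, t) = t ^+ size s.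
  by elim: s {r1} => [|b s IH]; rewrite ?expg0 //= IH expgS; case: b.
by rewrite -expgnA mulnC expgnA (torsion_card rhoM tfree) // expg1n.
Qed.

Let sat (W : set G) : set G := [set t | Tor t /\ exists2 w, W w & linked w t].

Let sat_closed W : closed W -> closed (sat W).
Proof.
move=> cW; rewrite (_ : sat W = Tor `&`
    (snd @` ([set z : G * G | W z.1] `&` [set z | linked z.1 z.2]))).
  apply: closedI => //; apply: compact_image_closed => //.
  - by rewrite -setXTT; exact: compact_setX.
  - exact: continuous_snd.
  - by apply: closedI => //; exact: (@closed_preimage _ _ fst W (@continuous_fst G G)).
apply/seteqP; split=> t /= [Tt]; first by move=> [w Ww wt]; split=> //; exists (w, t).
by move=> [[w t'] /= [Ww wt] E]; split=> //; exists w => //; rewrite -E.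
Qed.

Let saturated (P : set G) := [/\ closed P, P `<=` Tor &
  forall t t', P t -> Tor t' -> linked t t' -> P t'].

Let sat_saturated W : closed W -> W `<=` Tor -> saturated (sat W).
Proof.
move=> cW WT; split; [exact: sat_closed|by move=> t []|].
move=> t t' [[_ t1] [w Ww wt]] Tt' tt'; split=> //; exists w => //.
exact: linked_trans wt tt'.
Qed.

Let saturatedU P Q : saturated P -> saturated Q -> saturated (P `|` Q).
Proof.
move=> [cP PT Ps] [cQ QT Qs]; split; first exact: closedU.
  by move=> t [/PT|/QT].
by move=> t t' [Pt|Qt] Tt' tt'; [left; exact: Ps tt'|right; exact: Qs tt'].
Qed.

(* A class of linked torsion elements has at most one element of each colour
   [rho t = c], so the colours can be distributed one after the other. *)
Let separate_torsion P Q : saturated P -> saturated Q -> P `&` Q = set0 ->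
  exists P' Q', [/\ saturated P', saturated Q', P `<=` P', Q `<=` Q' & P' `&` Q' = set0] /\
    Tor `<=` P' `|` Q'.
Proof.
move=> sP sQ PQ0.
suff [P' [Q' [A H0]]] : exists P' Q',
    [/\ saturated P', saturated Q', P `<=` P', Q `<=` Q' & P' `&` Q' = set0] /\
    forall t, Tor t -> rho t \in enum H -> (P' `|` Q') t.
  by exists P', Q'; split=> // t Tt; apply: H0; rewrite ?mem_enum.
elim: (enum H) => [|c s [P1 [Q1 [[sP1 sQ1 PP1 QQ1 PQ1] PQs]]]].
  by exists P, Q; split; [split|].
have [cP1 P1T P1s] := sP1; have [cQ1 Q1T Q1s] := sQ1.
have [_ _ tG] := pG.
have [C [[oC cC] P1C CQ1]] := clopen_separate cG hG tG cP1 cQ1 PQ1.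
pose Tc := Tor `&` [set t | rho t = c].
have cTc : closed Tc.
  by apply: closedI => //; case: (lc_preimage_clopen (fun h => h = c) lrho).
have s1 : saturated (sat (Tc `&` C)).
  by apply: sat_saturated; [exact: closedI|move=> t [[]]].
have s2 : saturated (sat (Tc `&` ~` C)).
  by apply: sat_saturated; [apply: closedI => //; exact: open_closedC|move=> t [[]]].
exists (P1 `|` sat (Tc `&` C)), (Q1 `|` sat (Tc `&` ~` C)); split; last first.
  move=> t Tt; rewrite inE => /orP [/eqP tc|ts]; last first.
    by case: (PQs t Tt ts); [left; left|right; left].
  have [Ct|nCt] := pselect (C t); [left|right]; right; split=> //; exists t => //;
    apply: linked_refl; exact: (proj1 Tt).
split; [exact: saturatedU|exact: saturatedU|by move=> t /PP1; left|by move=> t /QQ1; left|].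
have no A B' : A `&` B' = set0 -> forall t, A t -> B' t -> False.
  by move=> AB0 t At Bt; have : (A `&` B') t by []; rewrite AB0.
apply/seteqP; split=> // t [] [P1t|[Tt [w [[Tw wc] Cw] wt]]] [Q1t|[Tt' [w' [[Tw' w'c] nCw'] w't]]].
- exact: no PQ1 _ P1t Q1t.
- by apply: nCw'; apply: P1C; apply: P1s P1t Tw' (linked_sym w't).
- apply: no CQ1 _ Cw _; apply: Q1s Q1t Tw (linked_sym wt).
- apply: nCw'; rewrite (_ : w' = w) //; apply: linked_eq; last by rewrite w'c wc.
  by apply: linked_trans w't (linked_sym wt); case: Tt.
Qed.

(* The [G]-space [G * G] in which [(u, t)] and [(u', t')] are identified when
   [t] and [t'] are non-trivial torsion elements of a common finite subgroup:
   every non-trivial finite subgroup then fixes exactly one point. *)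
Definition actT (g : G) (o : G * G) : G * G := (g * o.1, g * o.2 * g^-1).

Definition BT : set (set (G * G)) := [set A | clopen A /\
  forall u u' t t', nontrivial_torsion t -> nontrivial_torsion t' -> linked t t' ->
    A (u, t) -> A (u', t')].

Lemma torsion_conj (g t : G) : torsion t -> torsion (g * t * g^-1).
Proof.
move=> [n [n0 tn]]; exists n; split=> //.
have -> : (g * t * g^-1) ^+ n = g * t ^+ n * g^-1; last by rewrite tn mulg1 mulgV.
elim: n {n0 tn} => [|n IH]; first by rewrite !expg0 mulg1 mulgV.
by rewrite !expgS IH !mulgA mulgVK.
Qed.

Lemma actT_continuous : continuous (fun z : G * (G * G) => actT z.1 z.2).
Proof.
have c1 : continuous (fun z : G * (G * G) => z.1) by exact: continuous_fst.
have c2 : continuous (fun z : G * (G * G) => z.2.1).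
  by apply: continuous_compose (@continuous_fst G G); exact: continuous_snd.
have c3 : continuous (fun z : G * (G * G) => z.2.2).
  by apply: continuous_compose (@continuous_snd G G); exact: continuous_snd.
apply: continuous_pair; first exact: continuousM.
by apply: continuousM; [exact: continuousM|exact: continuousV].
Qed.

Let conj1 (g t : G) : g * t * g^-1 = 1 -> t = 1.
Proof. by move=> E; apply: (mulgI g); apply: (mulIg g^-1); rewrite E mulg1 mulgV. Qed.

Let cGG : compact [set: G * G].
Proof. by rewrite -setXTT; exact: compact_setX. Qed.

Let lc_clopen (X : topologicalType) (A : set X) : clopen A -> lc A.
Proof.
move=> [oA cA] x; have [Ax|nAx] := pselect (A x).
  have : nbhs x A by exact: open_nbhs_nbhs.
  by apply: filterS => y Ay /=; apply/propext.
have : nbhs x (~` A) by apply: open_nbhs_nbhs; split=> //; exact: closed_openC.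
by apply: filterS => y nAy /=; apply/propext.
Qed.

Lemma BT_bspace : bspace actT BT.
Proof.
split.
- by split; first exact: clopenT.
- move=> A [cA sA]; split; first exact: clopenC.
  by move=> u u' t t' Tt Tt' lk nA A'; apply: nA; exact: sA (linked_sym lk) A'.
- move=> A A' [cA sA] [cA' sA']; split; first exact: clopenI.
  move=> u u' t t' Tt Tt' lk [Au A'u]; split; [exact: (sA u u' t t')|exact: (sA' u u' t t')].
- move=> I W bW cW; have [|k|o _|n [u uP]] := @compact_fin_cover _ I setT W.
  + exact: cGG.
  + by case: (bW k) => -[].
  + exact: cW.
  + by exists n, u => o; exact: uP.
- by move=> [u t]; rewrite /actT /= !mul1g invg1 mulg1.
- by move=> g h [u t]; rewrite /actT /= invgM !mulgA.
- move=> g A [[oA cA] sA].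
  have cg : continuous (actT g).
    apply: (@continuous_compose _ _ _ (fun o : G * G => (g, o)) (fun z => actT z.1 z.2)).
      by apply: continuous_pair; [exact: cst_c|exact: continuous_id].
    exact: actT_continuous.
  split; first by split; [exact: (open_comp (fun x _ => cg x))|exact: closed_preimage].
  by move=> u u' t t' [tt t1] [tt' t1'] lk; apply: sA; [| |exact: linked_conj];
    (split; [exact: torsion_conj|by move=> /conj1]).
- move=> A [cA sA].
  have [|N [oN NA]] := @lc_smooth G pG (G * G)%type actT Prop A cGG actT_continuous _ (lc_clopen cA).
    by move=> [u t]; rewrite /actT /= !mul1g invg1 mulg1.
  by exists N; split=> // n o Nn; rewrite NA.
Qed.

(** Linked elements with the same image under [rho] are equal, so [e] centralizes [t]. *)
Let linked_free t e : Tor t -> linked t (e * t * e^-1) -> rho e = 1 -> e = 1.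
Proof.
move=> [tt t1] lk re; apply: (centralizer_kernel tfree centG tt t1) => //.
have := linked_eq lk; rewrite !rhoM rhoV re invg1 mulg1 mul1g => /(_ erefl) te.
by rewrite /commute {1}te mulgVK.
Qed.

(** Otherwise the classes of [o.2] and [o'.2] extend to disjoint saturated sets [P'] and [Q'] that
    cover all non-trivial torsion. A clopen set containing [o] and the points over [P'], and missing
    [o'] and those over [Q'], respects the identifications and so belongs to [BT]. *)
Lemma indist_BT o o' : indist BT o o' ->
  o = o' \/ [/\ nontrivial_torsion o.2, nontrivial_torsion o'.2 & linked o.2 o'.2].
Proof.
move=> ind; apply: contrapT => no.
have oo' : o <> o' by move=> E; apply: no; left.
have nlk : Tor o.2 -> Tor o'.2 -> ~ linked o.2 o'.2 by move=> To To' lk; apply: (no); right.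
have c1 (x : G) : closed [set x] by exact: accessible_closed_set1 (hausdorff_accessible hG) _.
pose P x : set G := if pselect (Tor x) then sat [set x] else set0.
have sP x : saturated (P x).
  rewrite /P; case: pselect => Tx; last by split=> //; exact: closed0.
  by apply: sat_saturated => // y ->.
have Pself x : Tor x -> P x x.
  move=> Tx; rewrite /P; case: pselect => [Tx'|//]; split=> //; exists x => //.
  by apply: linked_refl; case: Tx.
have [|P' [Q' [[sP' sQ' PP' QQ' PQ'] TPQ]]] := separate_torsion (sP o.2) (sP o'.2).
  apply/seteqP; split=> // t []; rewrite /P; case: pselect => // To; case: pselect => // To'.
  move=> [Tt [_ -> lk]] [_ [_ -> lk']]; apply: (nlk To To').
  by apply: linked_trans lk (linked_sym lk'); case: Tt.
have dPQ t : P' t -> Q' t -> False by move=> Pt Qt; have : (P' `&` Q') t by []; rewrite PQ'.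
pose PP := [set o] `|` [set x : G * G | P' x.2]; pose QQ := [set o'] `|` [set x : G * G | Q' x.2].
have cl2 (x : G * G) : closed [set x].
  rewrite (_ : [set x] = [set y | [set x.1] y.1] `&` [set y | [set x.2] y.2]).
    apply: closedI; first exact: (@closed_preimage _ _ fst _ (@continuous_fst G G)).
    exact: (@closed_preimage _ _ snd _ (@continuous_snd G G)).
  by apply/seteqP; split=> [_ ->//|[y1 y2] /= [-> ->]]; case: x.
have clT P0 : saturated P0 -> closed [set x : G * G | P0 x.2].
  by move=> [cP _ _]; exact: (@closed_preimage _ _ snd _ (@continuous_snd G G)).
have QT x : saturated x -> x `<=` Tor by case.
have PQ0 : PP `&` QQ = set0.
  apply/seteqP; split=> // x [[->|P'x] [E|Q'x]].
  - exact: oo'.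
  - by apply: (dPQ o.2 _ Q'x); apply: PP'; apply: Pself; exact: (QT _ sQ').
  - by apply: (dPQ o'.2); [rewrite -E|apply: QQ'; apply: Pself; rewrite -E; exact: (QT _ sP')].
  - exact: dPQ P'x Q'x.
have [_ hGG tGG] := profinite_prod pG pG.
have cPP : closed PP by apply: closedU => //; exact: clT.
have cQQ : closed QQ by apply: closedU => //; exact: clT.
have [C [cC PC CQ]] := clopen_separate cGG hGG tGG cPP cQQ PQ0.
have nCQ x : C x -> QQ x -> False by move=> Cx Qx; have : (C `&` QQ) x by []; rewrite CQ.
apply: (nCQ o'); last by left.
apply: (ind C); last by apply: PC; left.
split=> // u u' t t' Tt Tt' lk Cu; case: (TPQ _ Tt) => [P't|Q't].
  by apply: PC; right => /=; case: sP' => _ _; apply; [exact: P't| |].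
by case: (nCQ _ Cu); right.
Qed.

Lemma stab_actT o e : stab actT BT setT o e -> rho e = 1 -> e = 1.
Proof.
move=> [_ /indist_BT [E _|[To _ lk]]]; last exact: linked_free To lk.
by apply: (mulIg o.1); rewrite mul1g; have := congr1 fst E.
Qed.

(** The fixed point is the class of any non-trivial [t0] in [E]. If a non-trivial [e] in [E] fixes
    the class of [(u, t)], then [e] lies in the stabilizer [S] of the class of [t], a finite
    subgroup that contains [t]. As [E] and [S] share [e], they lie in one finite subgroup, which
    links [t0] to [t]. *)
Lemma fixed_actT E : is_subgroup E -> (forall e, E e -> rho e = 1 -> e = 1) ->
  (forall e, E e -> e = 1) \/ exists y0,
    (forall e, E e -> indist BT y0 (actT e y0)) /\
    (forall e y, E e -> e <> 1 -> indist BT y (actT e y) -> indist BT y0 y).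
Proof.
move=> sE E1; have fE : free_of_kernel rho E by [].
have [|/existsNP [t0 /not_implyP [Et0 t01]]] := pselect (forall e, E e -> e = 1); first by left.
right; exists (1, t0).
have T0 : Tor t0 by split=> //; exact: fok_torsion fE Et0.
split=> [e Ee A [_ sA] A0|e [u t] Ee e1 /indist_BT [Ee1|[/= Tt _ lk]]].
- apply: sA A0 => //; last first.
    by exists E; split=> //; apply: subM => //; [exact: subM|exact: subV].
  case: T0 => tt _; split; first exact: torsion_conj.
  by move=> /conj1.
- by case: e1; apply: (mulIg u); rewrite mul1g; have := congr1 fst Ee1.
- move=> A [_ sA]; apply: sA => //.
  pose S := [set x | linked t (x * t * x^-1)].
  have fS : free_of_kernel rho S.
    split; last by move=> x Sx; exact: linked_free Sx.
    apply/subgroupP; split.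
      by rewrite /S /= mul1g invg1 mulg1; apply: linked_refl; case: Tt.
    move=> x y Sx Sy; rewrite /S /=.
    have := linked_conj (x * y^-1) (linked_sym Sy).
    rewrite (_ : _ * (y * t * y^-1) * _ = x * t * x^-1) => [lxy|]; last first.
      by rewrite invgM invgK !mulgA !mulgVK.
    apply: linked_trans Sx lxy.
    by move=> /conj1; case: Tt.
  have [K [fK EK SK]] := common_overgroup pH rhoM tfree centG fE fS Ee lk e1.
  exists K; split=> //; first exact: EK.
  apply: SK; rewrite /S /= mulgK; apply: linked_refl; by case: Tt.
Qed.

End TorsionSpace.

(** * Lifting along central extensions *)

(** By nilpotency the commutator subgroup of [K] and [E] is proper in [K], so it lies in a maximal
    subgroup [M] of [K]. Then [M] is normal in [E] and [K / M] is central of order [p]. *)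
Lemma central_chief_factor (p : nat) (E : finGroupType) (K : {group E}) :
    prime p -> p.-group [set: E]%G -> (K <| [set: E]%G)%g -> K :!=: 1%g ->
  exists (E' : finGroupType) (f : E -> E') (z : E'),
    [/\ {morph f : x y / x * y}, #[z] = p, forall y, commute z y,
        forall x, x \in K -> f x \in <[z]> & exists2 x, x \in K & f x = z].
Proof.
move=> pp pE /andP [sKE nKE] K1.
have pK : p.-group K := pgroupS sKE pE.
have RK : [~: K, [set: E]%G] \proper K.
  apply: nil_comm_properl (pgroup_nil pE) sKE K1 _.
  by rewrite finset.subsetI nKE subxx.
have [RKE|[M maxM RM]] := maximal_exists (proper_sub RK).
  by case/andP: RK => _; rewrite RKE subxx.
have sMK : M \subset K by case/andP: (maxgroupp maxM).
have nME : [set: E]%G \subset 'N(M).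
  by rewrite -commg_subl; apply: fintype.subset_trans RM; exact: commSg.
have nMK : K \subset 'N(M) := fintype.subset_trans sKE nME.
have cardKM : #|K / M| = p by rewrite card_quotient // (p_maximal_index pK maxM).
have /cyclicP [z zE] : cyclic (K / M) by apply: prime_cyclic; rewrite cardKM.
have cent : K / M \subset 'C([set: E]%G / M) by rewrite quotient_cents2.
exists (coset_of M), (coset M), z; split.
- by move=> x y; rewrite morphM //; apply: (fintype.subsetP nME); rewrite finset.in_setT.
- by rewrite /order -zE cardKM.
- move=> y; rewrite -(coset_reprK y); set x := repr y.
  have zK : z \in K / M by rewrite zE cycle_id.
  have xE : coset M x \in [set: E]%G / M by apply: mem_quotient; rewrite finset.in_setT.
  exact: (centP (fintype.subsetP cent _ zK) _ xE).
- by move=> x Kx; rewrite -zE; exact: mem_quotient.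
- have /morphimP [x nx Kx ->] : z \in K / M by rewrite zE cycle_id.
  by exists x.
Qed.

Lemma chain_max (T : Type) (R : T -> T -> Prop) (A : set T) n (u : 'I_n.+1 -> T) :
  (forall r s t, R r s -> R s t -> R r t) -> (forall s t, A s -> A t -> R s t \/ R t s) ->
  (forall k, A (u k)) -> exists k, forall j, R (u j) (u k).
Proof.
move=> Rt Atot; elim: n u => [|n IH] u Au.
  by exists ord0 => j; rewrite (ord1 j); case: (Atot _ _ (Au ord0) (Au ord0)).
have [k kP] := IH (fun j => u (lift ord0 j)) (fun j => Au _).
have R00 : R (u ord0) (u ord0) by case: (Atot _ _ (Au ord0) (Au ord0)).
case: (Atot _ _ (Au ord0) (Au (lift ord0 k))) => H0.
  exists (lift ord0 k) => j; case: (unliftP ord0 j) => [j' ->|-> //]; exact: kP.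
exists ord0 => j; case: (unliftP ord0 j) => [j' ->|-> //].
exact: Rt (kP j') H0.
Qed.

Section PrimeOrderPowers.
Variables (p : nat) (E : finGroupType) (z : E).
Hypothesis pp : prime p.
Hypothesis oz : #[z] = p.

Let zp : z ^+ p = 1. Proof. by rewrite -oz expg_order. Qed.

Lemma expgFp_nat n : z ^+ (n%:R%R : 'F_p) = z ^+ n.
Proof. by rewrite val_Fp_nat // expg_mod. Qed.

Lemma expgFpD (c c' : 'F_p) : z ^+ (c + c')%R = z ^+ c * z ^+ c'.
Proof. by rewrite -expgnDr; apply: expg_mod; rewrite Fp_cast. Qed.

Lemma expgFpB (c c' : 'F_p) : z ^+ (c - c')%R = z ^+ c * (z ^+ c')^-1.
Proof. by apply: (mulIg (z ^+ c')); rewrite mulgVK -expgFpD GRing.subrK. Qed.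

Lemma expgFp_inj : injective (fun c : 'F_p => z ^+ c).
Proof.
move=> c c' /eqP; rewrite eq_expg_mod_order oz !modn_small.
- by move/eqP/val_inj.
- by rewrite -{2}(Fp_cast pp).
- by rewrite -{2}(Fp_cast pp).
Qed.

End PrimeOrderPowers.

Section Lifting.
Variables (p : nat) (G G0 : topologicalGroupType) (O : Type) (act : G -> O -> O).
Variable B : set (set O).
Hypothesis pp : prime p.
Hypothesis bO : bspace act B.
Hypothesis pG0 : is_pro_p p G0.
Variable r : G -> G0.
Hypothesis rM : {morph r : x y / x * y}.
Hypothesis r_smooth : exists N, opn N /\ forall n, N n -> r n = 1.
Hypothesis acyclicO : forall c : G -> O -> 'F_p, (forall g, lcB B (c g)) ->
  (forall g h, exists k, forall y, c (g * h) y = (c g y + c h (act g^-1%g y) + k)%R) ->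
  (exists N, opn N /\ forall n y y', N n -> c n y = c n y') ->
  exists w, lcB B w /\ forall g, exists k, forall y, c g y = (w (act g^-1%g y) - w y + k)%R.

(* When [theta b g y] does not depend on [y], it is a homomorphism in [g];
   [good b V] says that this holds modulo [V]. *)
Definition theta (b : O -> G0) g y := b (act g y) * r g * (b y)^-1.

Definition good (b : O -> G0) (V : set G0) := [/\ opn V,
  forall y, exists A, [/\ B A, A y & forall y', A y' -> V ((b y)^-1 * b y')] &
  forall g y y', V ((theta b g y)^-1 * theta b g y')].

Definition agree (V : set G0) (b b' : O -> G0) := forall y, V ((b y)^-1 * b' y).

Let quo V : opn V -> exists (E : finGroupType) (q : G0 -> E),
  [/\ p.-group [set: E]%G, {morph q : x y / x * y},
      forall x y, V (x^-1 * y) <-> q x = q y & forall e, exists x, q x = e].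
Proof.
move=> oV; have [E [q [pE qM q1 qs]]] := opn_quotient pp pG0 oV.
exists E, q; split=> // x y; rewrite -q1 qM (homV qM); split=> [|->]; last by rewrite mulVg.
by move=> E1; apply: (mulgI (q x)^-1); rewrite E1 mulVg.
Qed.

Let q_theta (E : finGroupType) (q : G0 -> E) b g y : {morph q : x y / x * y} ->
  q (theta b g y) = q (b (act g y)) * q (r g) * (q (b y))^-1.
Proof. by move=> qM; rewrite /theta !qM (homV qM). Qed.

Lemma good_agree b b' V : good b V -> agree V b b' -> good b' V.
Proof.
move=> [oV bl bt] bb'; have [E [q [_ qM qV _]]] := quo oV.
have qb y : q (b y) = q (b' y) by apply/qV.
split=> //.
  move=> y; have [A [bA Ay AV]] := bl y; exists A; split=> // y' Ay'.
  by apply/qV; rewrite -!qb; apply/qV; exact: AV.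
by move=> g y y'; apply/qV; rewrite !q_theta // -!qb -!(@q_theta E q b) //; apply/qV.
Qed.

Lemma goodS b V V' : good b V -> opn V' -> V `<=` V' -> good b V'.
Proof.
move=> [oV bl bt] oV' VV'; split=> //; last by move=> g y y'; exact: VV'.
move=> y; have [A [bA Ay AV]] := bl y; exists A; split=> // y' Ay'.
by apply: VV'; exact: AV.
Qed.

Lemma good_forall b (I : finType) (V : I -> set G0) :
  (forall k, good b (V k)) -> good b [set x | forall k, V k x].
Proof.
move=> gV; split; first by apply: opn_forall => k; case: (gV k).
  move=> y; have /choice [A AP] : forall k, exists A,
      [/\ B A, A y & forall y', A y' -> V k ((b y)^-1 * b y')] by move=> k; case: (gV k).
  exists [set y' | forall k, A k y']; split.
  - by apply: (bs_forall bO) => k; case: (AP k).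
  - by move=> k; case: (AP k).
  - by move=> y' Ay' k; case: (AP k) => _ _; apply.
by move=> g y y' k; case: (gV k).
Qed.

Let core b : set G0 := [set x | forall V, good b V -> V x].

Let core_near b (U : set G0) : open U -> core b `<=` U -> exists W, good b W /\ W `<=` U.
Proof.
move=> oU cU; have [[cG0 _ _] _] := pG0.
pose I := {V : set G0 | good b V}.
have [|k|x nUx|n [u uP]] := @compact_fin_cover G0 I (~` U) (fun k => ~` sval k).
- by apply: subclosed_compact cG0 _ => //; exact: open_closedC.
- by apply: closed_openC; case: k => V [oV _ _] /=; exact: opn_closed.
- apply: contrapT => no; apply: nUx; apply: cU => V gV; apply: contrapT => nVx.
  by apply: no; exists (exist _ V gV).
exists [set x | forall k, sval (u k) x]; split; first by apply: good_forall => k; case: (u k).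
by move=> x Vx; apply: contrapT => /uP [k]; apply.
Qed.

Let le b b' := forall V, good b V -> agree V b b'.

Let le_refl b : le b b.
Proof. by move=> V [oV _ _] y; rewrite mulVg; exact: opn1. Qed.

Let le_trans b b' b'' : le b b' -> le b' b'' -> le b b''.
Proof.
move=> l l' V gV y; have gV' := good_agree gV (l V gV).
have [oV _ _] := gV; have := opnM oV (l V gV y) (l' V gV' y).
by rewrite mulgA mulgK.
Qed.

(** At each [y] the closed cosets [b y V], for [b] in the chain and [V] good for [b], have the
    finite intersection property: any finitely many contain the value at [y] of the largest [b]
    involved. A common point of all of them is the bound at [y]. *)
Let chain_bound (A : set (O -> G0)) b1 : A b1 ->
  (forall s t, A s -> A t -> le s t \/ le t s) -> exists t, forall s, A s -> le s t.
Proof.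
move=> A1 Atot; have [[cG0 _ _] _] := pG0.
suff /choice [t tP] : forall y, exists x, forall b V, A b -> good b V -> V ((b y)^-1 * x).
  by exists t => s As V gV y; exact: (tP y s V As gV).
move=> y; apply: contrapT => no.
pose I := {k : (O -> G0) * set G0 | A k.1 /\ good k.1 k.2}.
have [//|k|x _|n [u uP]] := @compact_fin_cover G0 I setT
    (fun k => [set x | ~ (sval k).2 (((sval k).1 y)^-1 * x)]).
- case: k => -[b V] /= [Ab [oV _ _]].
  have cV : closed [set x | V ((b y)^-1 * x)].
    apply: (@closed_preimage _ _ (fun x => (b y)^-1 * x) V); last exact: opn_closed.
    by apply: continuousM; [move=> x; exact: cst_continuous|exact: continuous_id].
  exact: closed_openC cV.
- apply: contrapT => nx; apply: no; exists x => b V Ab gV; apply: contrapT => nV.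
  by apply: nx; exists (exist _ (b, V) (conj Ab gV)).
case: n u uP => [|n] u uP; first by have [[]] := uP 1 Logic.I.
have [|k kP] := @chain_max _ le A n (fun k => (sval (u k)).1) le_trans Atot.
  by move=> k; case: (u k) => ? [].
have [j nj] := uP ((sval (u k)).1 y) Logic.I; apply: nj.
have := kP j; case: (u j) => -[b V] /= [Ab gV] l; exact: (l V gV y).
Qed.

Lemma lift_maximal b0 : exists b, le b0 b /\ forall b', le b b' -> le b' b.
Proof.
pose T := {b | le b0 b}.
pose R : rel T := fun s t => `[< le (sval s) (sval t) >].
have [|||t tm] := @ZL_preorder T (exist _ b0 (@le_refl b0)) R.
- by move=> t; apply/asboolP; exact: le_refl.
- by move=> s1 s2 s3 /asboolP l1 /asboolP l2; apply/asboolP; exact: le_trans l1 l2.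
- move=> A Atot; have [[s As]|nA] := pselect (exists s, A s); last first.
    by exists (exist _ b0 (@le_refl b0)) => s As; case: nA; exists s.
  have [||t tP] := @chain_bound [set b | exists2 s, A s & sval s = b] (sval s).
  - by exists s.
  - move=> _ _ [s1 A1 <-] [s2 A2 <-].
    by case: (Atot s1 s2 A1 A2) => [/asboolP l|/asboolP l]; [left|right].
  have l0 : le b0 t by apply: le_trans (svalP s) _; apply: tP; exists s.
  by exists (exist _ t l0) => s' As'; apply/asboolP => /=; apply: tP; exists s'.
exists (sval t); split; first exact: (svalP t).
move=> b' tb'; have l0 : le b0 b' := le_trans (svalP t) tb'.
by have := tm (exist _ b' l0); move=> /(_ (introT (asboolP _) tb')) /asboolP.
Qed.

(* If some [V] is not good for a maximal [b], then it does not contain the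
   intersection [K] of the good subgroups. A chief factor [<[z]>] of a finite
   quotient [q] lying in the image of [K] is central of order [p], and the
   obstruction to making [b] good for [q] is a cocycle with values in [<[z]>],
   which acyclicity trivializes by multiplying [b] with elements of [K]. *)
Lemma maximal_good b V : (forall b', le b b' -> le b' b) -> opn V -> good b V.
Proof.
move=> bmax oV; apply: contrapT => nV.
have [y1 _] : exists y : O, True.
  apply: contrapT => nO; apply: nV; split=> // [y|g y y']; by case: nO; exists y.
pose K := core b.
have [x0 [Kx0 nVx0]] : exists x, K x /\ ~ V x.
  apply: contrapT => no; apply: nV.
  have [|W [gW WV]] := core_near (b := b) (proj1 oV).
    by move=> x Kx; apply: contrapT => nVx; apply: no; exists x.
  exact: goodS gW oV WV.
have oG W : good b W -> opn W by case.
have K1 : K 1 by move=> W /oG /opn1.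
have KM x y : K x -> K y -> K (x * y).
  by move=> Kx Ky W gW; apply: opnM (oG W gW) (Kx W gW) (Ky W gW).
have KJ x y : K x -> K (y^-1 * (x * y)) by move=> Kx W gW; apply: opnJ (oG W gW) (Kx W gW).
have [E [q [pE qM qV qs]]] := quo oV.
have q1 x : q x = 1 <-> V x.
  by have := qV 1 x; rewrite invg1 mul1g (hom1 qM) => ->; split.
pose qK : {set E} := [set e | `[< exists2 x, K x & q x = e >]]%SET.
have qKP e : reflect (exists2 x, K x & q x = e) (e \in qK) by rewrite inE; exact: asboolP.
have gqK : group_set qK.
  apply/group_setP; split; first by apply/qKP; exists 1; rewrite ?(hom1 qM).
  move=> _ _ /qKP [x Kx <-] /qKP [y Ky <-].
  by apply/qKP; exists (x * y); [exact: KM|rewrite qM].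
have nqK : Group gqK <| [set: E]%G.
  apply/andP; split; first exact: finset.subsetT.
  apply/normsP => e _; apply/eqP; rewrite eqEcard cardJg leqnn andbT.
  apply/fintype.subsetP => _ /imsetP [_ /qKP [x Kx <-] ->].
  have [y <-] := qs e; apply/qKP; exists (y^-1 * (x * y)); first exact: KJ.
  by rewrite !qM (homV qM) conjgE.
have qK1 : qK != 1%g.
  apply/eqP => qK1; apply: nVx0; apply/q1; apply/set1P.
  by rewrite -[[set 1]%SET]/(1%g : {set E}) -qK1; apply/qKP; exists x0.
have [E' [f [z [fM oz zc fK [e0 e0K fe0]]]]] := central_chief_factor pp pE nqK qK1.
have /qKP [k0 Kk0 qk0] := e0K.
pose q' x := f (q x).
have q'M : {morph q' : x y / x * y} by move=> x y; rewrite /q' qM fM.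
have q'k0 : q' k0 = z by rewrite /q' qk0.
have lq' : lc q' by apply: (lc_hom oV q'M) => x /q1; rewrite /q' => ->; exact: hom1 fM.
(* Goodness modulo [W] confines the dependence of [theta] on [y] to [<[z]>] once [q'] is applied. *)
have [||W [gW Wz]] := core_near (b := b) (U := [set x | (q' x \in <[z]>)]).
- exact: (lc_preimage_open (fun e => e \in <[z]>) lq').
- by move=> x Kx; apply: fK; apply/qKP; exists x.
have [oW bWl bWt] := gW.
have KW x : K x -> W x by move=> Kx; exact: Kx.
have [EW [qW [_ qWM qWW qWs]]] := quo oW.
have qW1 x : W x -> qW x = 1.
  by move=> Wx; rewrite -(hom1 qWM); apply/esym/qWW; rewrite invg1 mul1g.
have qW1' x : qW x = 1 -> W x.
  by rewrite -(hom1 qWM) => /esym /qWW; rewrite invg1 mul1g.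
have [sec secP] := choice qWs.
(* [b] is locally constant only modulo [W]; replacing it by a representative of its class makes the
   functions [c g] below locally constant. *)
pose bt y := sec (qW (b y)).
have qWbt y : qW (bt y) = qW (b y) by rewrite /bt secP.
have lbt : lcB B bt.
  apply: (lcB_comp sec) => y; have [A [bA Ay AW]] := bWl y.
  by exists A; split=> // y' Ay'; apply/esym/qWW; exact: AW.
have qWt b2 g y : (forall y, qW (b2 y) = qW (b y)) -> qW (theta b2 g y) = qW (theta b g y).
  by move=> e2; rewrite !q_theta // !e2.
have qWtt g y y' : qW (theta b g y) = qW (theta b g y') by apply/qWW; exact: bWt.
have ltheta g : lcB B (theta bt g).
  exact: (lcB_comp2 bO (fun u v => u * r g * v^-1) (lcB_act bO g lbt) lbt).
have zpow x : W x -> exists c : 'F_p, z ^+ c = q' x.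
  by move=> /Wz /cycleP [n ->]; exists (n%:R)%R; exact: expgFp_nat.
have [c cP] : exists c : G -> O -> 'F_p, forall g y,
    z ^+ (c g y) * q' (theta bt g y1) = q' (theta bt g y).
  have H0 : forall gy : G * O, exists c : 'F_p,
      z ^+ c * q' (theta bt gy.1 y1) = q' (theta bt gy.1 gy.2).
    move=> [g y]; have [|c0 c0P] := zpow (theta bt g y * (theta bt g y1)^-1).
      apply: qW1'; rewrite qWM (homV qWM) (qWt bt) // (qWt bt) // (qWtt g y y1).
      by rewrite mulgV.
    by exists c0; rewrite c0P -q'M mulgVK.
  have [c0 c0P] := choice H0; exists (fun g y => c0 (g, y)) => g y; exact: (c0P (g, y)).
have thetaM b2 g h y : theta b2 (g * h) y = theta b2 g (act h y) * theta b2 h y.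
  by rewrite /theta (bs_actM bO) rM !mulgA mulgVK.
have lcc g : lcB B (c g).
  move=> y; have [A [bA Ay At]] := ltheta g y; exists A; split=> // y' /At E1.
  apply: (expgFp_inj pp oz); apply: (mulIg (q' (theta bt g y1))).
  by rewrite /= !cP E1.
have zX n x : x * z ^+ n = z ^+ n * x by exact: commuteX (esym (zc x)).
have zXV n x : x * (z ^+ n)^-1 = (z ^+ n)^-1 * x by exact: commuteV (zX n x).
have cM g h y : c (g * h) y = (c g (act h y) + c h y +
    (c (g * h)%g y1 - (c g (act h y1) + c h y1)))%R.
  have D y' : z ^+ (c (g * h)%g y' - (c g (act h y') + c h y'))%R =
      q' (theta bt g y1) * q' (theta bt h y1) * (q' (theta bt (g * h) y1))^-1.
    rewrite expgFpB //; apply: (mulIg (z ^+ (c g (act h y') + c h y')%R)); rewrite mulgVK.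
    apply: (mulIg (q' (theta bt (g * h) y1))); rewrite cP thetaM q'M -(cP g (act h y')) -(cP h y').
    rewrite expgFpD //; set t := q' (theta bt (g * h) y1).
    set u := q' (theta bt g y1); set v := q' (theta bt h y1).
    rewrite -expgnDr (zX _ (u * v * t^-1)) -(mulgA _ _ t) mulgVK expgnDr.
    by rewrite !mulgA -[in LHS](mulgA _ u) (zX _ u) !mulgA.
  have E2 : (c (g * h)%g y - (c g (act h y) + c h y) =
      c (g * h)%g y1 - (c g (act h y1) + c h y1))%R.
    by apply: (expgFp_inj pp oz); rewrite /= !D.
  by rewrite -E2 GRing.addrC GRing.subrK.
have actK g y : act g (act g^-1 y) = y by rewrite -(bs_actM bO) mulgV (bs_act1 bO).
have actVK g y : act g^-1 (act g y) = y by rewrite -(bs_actM bO) mulVg (bs_act1 bO).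
have [|||w [lw wP]] := acyclicO (c := fun g y => c g (act g^-1 y)).
- by move=> g; exact: (lcB_act bO g^-1 (lcc g)).
- move=> g h; exists (c (g * h)%g y1 - (c g (act h y1) + c h y1))%R => y.
  by rewrite cM invgM (bs_actM bO) actK.
- have [N [oN bN]] := lcB_smooth bO lbt; have [N' [oN' rN']] := r_smooth.
  exists (N `&` N'); split; first exact: opnI.
  have c1 n y : N n -> N' n -> z ^+ (c n y) = 1.
    move=> Nn N'n; apply: (mulIg (q' (theta bt n y1))); rewrite cP.
    by rewrite /theta !bN // rN' // !mulg1 !mulgV mul1g.
  by move=> n y y' [Nn N'n]; apply: (expgFp_inj pp oz); rewrite /= !c1.
have KX n : K (k0 ^+ n) by elim: n => [|n IH]; rewrite ?expg0 // expgS; exact: KM.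
have q'X n : q' (k0 ^+ n) = z ^+ n.
  by elim: n => [|n IH]; rewrite ?expg0 ?(hom1 q'M) // !expgS q'M IH q'k0.
pose bh y := bt y * k0 ^+ (w y).
have qWbh y : qW (bh y) = qW (b y).
  by rewrite /bh qWM qWbt (qW1 _ (KW _ (KX _))) mulg1.
have q'bh g : exists e, forall y, q' (theta bh g y) = e.
  have [k kP] := wP g; exists (z ^+ k * q' (theta bt g y1)) => y.
  have ck := kP (act g y); rewrite actVK in ck.
  have -> : k = (w (act g y) - w y + c g y)%R.
    by rewrite ck GRing.addrA GRing.addrA GRing.subrK GRing.subrr GRing.add0r.
  rewrite expgFpD // expgFpB // -mulgA cP !q_theta // /bh !q'M !q'X zX invgM !mulgA.
  by rewrite [in LHS](zXV (w y) (_ * _ * _)) [in RHS](zXV (w y) (z ^+ _)) !mulgA.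
have /choice [m mP] : forall y, exists m : 'F_p, z ^+ m = q' ((b y)^-1 * bh y).
  by move=> y; apply: zpow; apply/qWW; rewrite qWbh.
(* [bh] agrees with [b] only modulo [W]. Multiplying [b] itself by powers of [k0], which lies in the
   core, gives the same image under [q'] and also [le b b']. *)
pose b' y := b y * k0 ^+ (m y).
have q'b' y : q' (b' y) = q' (bh y) by rewrite /b' q'M q'X mP -q'M mulKVg.
have qWb' y : qW (b' y) = qW (b y) by rewrite /b' qWM (qW1 _ (KW _ (KX _))) mulg1.
pose V2 := W `&` [set x | q' x = 1].
have oV2 : opn V2.
  apply: opnI => //; split; first exact: (lc_preimage_open (fun e => e = 1) lq').
  split; first apply/subgroupP; first split.
  - exact: hom1.
  - by move=> x y /= x1 y1'; rewrite q'M (homV q'M) x1 y1' mulgV.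
  - by move=> x y /= x1; rewrite conjgE !q'M (homV q'M) x1 mul1g mulVg.
have V2P x y : qW x = qW y -> q' x = q' y -> V2 (x^-1 * y).
  by move=> /qWW Wxy q'xy; split=> //=; rewrite q'M (homV q'M) q'xy mulVg.
have gb' : good b' V2.
  split=> //.
    move=> y; have [A [bA Ay Ab]] := lcB_comp2 bO (fun u (v : 'F_p) => u * k0 ^+ v) lbt lw y.
    exists A; split=> // y' /Ab E1; apply: V2P.
      by rewrite !qWb' -!qWbh /bh E1.
    by rewrite !q'b' /bh E1.
  move=> g y y'; apply: V2P; first by rewrite !(qWt b') //; exact: qWtt.
  rewrite !q_theta // !q'b' -!(@q_theta _ q' bh) //.
  by have [e eP] := q'bh g; rewrite !eP.
have lbb' : le b b'.
  by move=> V' gV' y; rewrite /b' mulKg; exact: KX.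
(* By maximality [b] is then good for [V2] as well, so [k0] lies in [V2] and [z = q' k0] is trivial,
   against its order being [p]. *)
have gV2 : good b V2 := good_agree gb' (bmax b' lbb' V2 gb').
have [_ /= k01] := Kk0 V2 gV2.
by have := prime_gt1 pp; rewrite -oz -q'k0 k01 order1.
Qed.

Theorem lift_good b0 : exists b,
  (forall V, good b0 V -> agree V b0 b) /\ forall V, opn V -> good b V.
Proof.
have [b [b0b bm]] := lift_maximal b0; exists b; split; first exact: b0b.
by move=> V oV; exact: maximal_good.
Qed.

End Lifting.

(** * Free pro-p groups and products *)

Lemma continuous_to_prod (X : topologicalType) (I : Type) (T : I -> topologicalType)
    (f : X -> prod_topology T) :
  (forall i, continuous (fun x => f x i)) -> continuous f.
Proof.
move=> cf x; apply/cvg_sup => i A [_ [[B oB <-] Bfx sBA]].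
by apply: filterS sBA _; apply: (cf i x); exact: open_nbhs_nbhs.
Qed.

Lemma compact_subgroup_type (G : topologicalGroupType) (A : set G) (hA : is_subgroup A) :
  compact A -> compact [set: subgroup_type hA].
Proof.
move=> cA F PF _; pose v : subgroup_type hA -> G := val.
have FA : F (v @^-1` A).
  by apply: (@filterS _ F _ setT _ _ filterT) => x _; have := valP x; rewrite inE.
have [a [Aa cla]] := cA (v @ F) _ FA.
exists (SigSub (mem_set Aa) : subgroup_type hA); split=> // S V FS [_ [[W oW <-] Wa sWV]].
have FS' : (v @ F) (v @` S).
  by apply: (@filterS _ F _ S _ _ FS) => x Sx; exists x.
have [_ [[x Sx <-] Wx]] := cla _ _ FS' (open_nbhs_nbhs (conj oW Wa)).
by exists x; split=> //; exact: sWV.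
Qed.

Lemma cayley (E : finGroupType) : exists n (Q : {group 'S_n}) (c : E -> subg_of Q),
  [/\ {morph c : x y / x * y}, injective c & #|{: subg_of Q}| = #|E|].
Proof.
pose s (e : E) (i : 'I_#|E|) := enum_rank (enum_val i * e).
have sI e : injective (s e).
  by move=> i i' /enum_rank_inj /mulIg /enum_val_inj.
pose c e := perm (@sI e).
have cM : {morph c : x y / x * y}.
  move=> e e'; apply/permP => i; rewrite permM !permE /s enum_rankK.
  by rewrite mulgA.
have cI : injective c.
  move=> e e' /permP /(_ (enum_rank 1)); rewrite !permE /s => /enum_rank_inj.
  by rewrite enum_rankK !mul1g.
have gQ : group_set [set c e | e in [set: E]]%SET.
  apply/group_setP; split; first by apply/imsetP; exists 1; rewrite ?finset.in_setT ?(hom1 cM).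
  move=> _ _ /imsetP [e _ ->] /imsetP [e' _ ->]; rewrite -cM.
  by apply: imset_f; rewrite finset.in_setT.
have cQ e : c e \in Group gQ by apply/imsetP; exists e; rewrite ?finset.in_setT.
exists #|E|, (Group gQ), (fun e => subg (Group gQ) (c e)); split.
- by move=> e e'; rewrite cM subgM.
- by move=> e e' /(congr1 sgval); rewrite !subgK // => /cI.
- by rewrite card_sub; have := card_imset [set: E]%SET cI; rewrite cardsT; exact.
Qed.

(** * The free pro-p product of a finite group and a free group, inside a product of finite
    p-groups *)

Section MarkedGroups.
Variables (p : nat) (X : ptopologicalType) (H : finGroupType).

(* Generators [X] and a homomorphism from [H] in a finite p-group; taking
   groups of permutations keeps this type small. *)
Record marked := Marked {
  mk_n : nat;
  mk_Q : {group 'S_mk_n};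
  mk_X : X -> subg_of mk_Q;
  mk_H : H -> subg_of mk_Q;
  mk_pgroup : p.-group [set: subg_of mk_Q]%G;
  mk_lc : lc mk_X;
  mk_pt : mk_X point = 1;
  mk_morph : {morph mk_H : x y / x * y}
}.

Definition mk_group (j : marked) : finGroupType := subg_of (mk_Q j).

Definition marked_product : Type :=
  prod_topology (fun j : {classic marked} => discrete_group (mk_group j)).

HB.instance Definition _ := Topological.on marked_product.

Let mulP (x y : marked_product) : marked_product := fun j => x j * y j.
Let oneP : marked_product := fun j => 1.
Let invP (x : marked_product) : marked_product := fun j => (x j)^-1.
Let mulPA : associative mulP.
Proof. by move=> x y z; apply: functional_extensionality_dep => j; exact: mulgA. Qed.
Let mul1P : left_id oneP mulP.
Proof. by move=> x; apply: functional_extensionality_dep => j; exact: mul1g. Qed.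
Let mulP1 : right_id oneP mulP.
Proof. by move=> x; apply: functional_extensionality_dep => j; exact: mulg1. Qed.
Let mulVP : left_inverse oneP invP mulP.
Proof. by move=> x; apply: functional_extensionality_dep => j; exact: mulVg. Qed.
Let mulPV : right_inverse oneP invP mulP.
Proof. by move=> x; apply: functional_extensionality_dep => j; exact: mulgV. Qed.

HB.instance Definition _ :=
  isGroup.Build marked_product mulPA mul1P mulP1 mulVP mulPV.

Lemma coord_continuous (j : {classic marked}) : continuous (fun x : marked_product => x j).
Proof. exact: (@continuous_eval _ (fun j : {classic marked} => discrete_group (mk_group j)) j). Qed.

Lemma marked_mul_continuous :
  continuous (fun xy : marked_product * marked_product => xy.1 * xy.2).
Proof.
apply: continuous_to_prod => j; apply: continuousM.
  apply: (@continuous_compose _ _ _ fst (fun x : marked_product => x j)); last exact: coord_continuous.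
  exact: continuous_fst.
apply: (@continuous_compose _ _ _ snd (fun x : marked_product => x j)); last exact: coord_continuous.
exact: continuous_snd.
Qed.

Lemma marked_inv_continuous : continuous (fun x : marked_product => x^-1).
Proof. by apply: continuous_to_prod => j; apply: continuousV; exact: coord_continuous. Qed.

HB.instance Definition _ :=
  PreTopologicalGroup_isTopologicalGroup.Build marked_product
    marked_mul_continuous marked_inv_continuous.


Lemma coord_lc (j : {classic marked}) : lc (fun x : marked_product => x j : mk_group j).
Proof. exact: (discrete_lc (@coord_continuous j)). Qed.

Lemma marked_of (E : finGroupType) (f : X -> E) (g : H -> E) :
  p.-group [set: E]%G -> lc f -> f point = 1 -> {morph g : x y / x * y} ->
  exists (j : marked) (c : E -> mk_group j), [/\ {morph c : x y / x * y}, injective c,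
    forall x, mk_X j x = c (f x) & forall h, mk_H j h = c (g h)].
Proof.
move=> pE lf f1 gM; have [n [Q [c [cM cI cQ]]]] := cayley E.
have pQ : p.-group [set: subg_of Q]%G by rewrite /pgroup cardsT cQ -cardsT.
have c1 : c (f point) = 1 by rewrite f1; exact: hom1.
have cgM : {morph c \o g : x y / x * y} by move=> x y; rewrite /= gM cM.
by exists (Marked pQ (lc_comp c lf) c1 cgM), c.
Qed.

Lemma marked_pair (j j' : marked) : exists (k : marked) (c : mk_group j * mk_group j' -> mk_group k),
  [/\ {morph c : x y / x * y}, injective c,
    forall x, mk_X k x = c (mk_X j x, mk_X j' x) & forall h, mk_H k h = c (mk_H j h, mk_H j' h)].
Proof.
have [|||h h'|k [c [cM cI cX cH]]] := @marked_of (mk_group j * mk_group j')%type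
  (fun x => (mk_X j x, mk_X j' x)) (fun h => (mk_H j h, mk_H j' h)).
- have -> : [set: mk_group j * mk_group j']%G = setX_group [set: mk_group j]%G [set: mk_group j']%G.
    by apply/val_inj/setP => -[x y]; rewrite /= !inE.
  by rewrite pgroupE /= cardsX pnatM; apply/andP; split; exact: mk_pgroup.
- by apply: lc_comp2; exact: mk_lc.
- by rewrite !mk_pt.
- by rewrite !mk_morph.
by exists k, c.
Qed.

Section Words.
Variables (K : groupType) (f : X -> K) (g : H -> K).

Definition wordg (w : seq (X + H)) : K :=
  foldr (fun a k => (match a with inl x => f x | inr h => g h end) * k) 1 w.

Lemma wordg_cat w w' : wordg (w ++ w') = wordg w * wordg w'.
Proof. by elim: w => [|a w IH]; rewrite /= ?mul1g // IH mulgA. Qed.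

End Words.

Lemma wordg_morph (K K' : groupType) (q : K -> K') f g w : {morph q : x y / x * y} ->
  q (wordg f g w) = wordg (q \o f) (q \o g) w.
Proof. by move=> qM; elim: w => [|a w IH]; rewrite /= ?(hom1 qM) // qM IH; case: a. Qed.

Definition word_at (j : marked) w : mk_group j := wordg (@mk_X j) (@mk_H j) w.
Arguments word_at : clear implicits.

(** The closure of the subgroup generated by the images of [X] and [H], tested on finitely many
    coordinates at a time. *)
Definition marked_limit : set marked_product := [set x |
  forall n (u : 'I_n -> marked), exists w, forall k, x (u k) = word_at (u k) w].

(** Words have no inverse letters; the product [m] of the orders of the groups involved is a common
    exponent, so the power [m.-1] of a word inverts it everywhere. *)
Lemma word_inv n (u : 'I_n -> marked) w : exists w', forall k, word_at (u k) w' = (word_at (u k) w)^-1.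
Proof.
pose m := (\prod_(k < n) #|mk_group (u k)|)%N.
have wX i : exists w', forall k, word_at (u k) w' = word_at (u k) w ^+ i.
  elim: i => [|i [w' IH]]; first by exists [::].
  by exists (w ++ w') => k; rewrite /word_at wordg_cat -/(word_at _ _) -/(word_at _ w') IH expgS.
have [w' w'P] := wX m.-1; exists w' => k.
apply: (mulgI (word_at (u k) w)); rewrite w'P -expgS mulgV prednK; last first.
  by apply: prodn_gt0 => k'; apply/card_gt0P; exists 1.
by rewrite /m (bigD1 k) //= expgnA -cardsT expg_cardG ?expg1n // finset.in_setT.
Qed.

Lemma marked_limit_subgroup : is_subgroup marked_limit.
Proof.
apply/subgroupP; split; first by move=> n u; exists [::].
move=> x y Ux Uy n u; have [w wP] := Ux n u; have [w' w'P] := Uy n u.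
have [w'' w''P] := word_inv u w'.
exists (w ++ w'') => k; rewrite /word_at wordg_cat -/(word_at _ _) -/(word_at _ w'').
by rewrite w''P -wP -w'P.
Qed.

Definition free_group : topologicalGroupType := subgroup_type marked_limit_subgroup.

Definition coord (j : marked) (x : free_group) : mk_group j := val x j.

Lemma coordM j : {morph coord j : x y / x * y}. Proof. by []. Qed.

Lemma coord_eq (x y : free_group) : (forall j, coord j x = coord j y) -> x = y.
Proof. by move=> xy; apply: val_inj; apply: functional_extensionality_dep => j; exact: xy. Qed.

Lemma coord_val_continuous j : continuous (fun x : free_group => val x j : discrete_group (mk_group j)).
Proof.
apply: (@continuous_compose _ _ _ (val : free_group -> marked_product) (fun x : marked_product => x j)).
  exact: subgroup_val_continuous.
exact: coord_continuous.
Qed.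

Lemma coord_is_lc j : lc (coord j).
Proof. exact: (discrete_lc (@coord_val_continuous j)). Qed.

Lemma coord_word n (u : 'I_n -> marked) (x : free_group) :
  exists w, forall k, coord (u k) x = word_at (u k) w.
Proof. by have := valP x; rewrite inE; exact. Qed.

Lemma free_group_profinite : profinite_space free_group.
Proof.
apply: zero_dimensional_profinite.
  apply: compact_subgroup_type; apply: (@subclosed_compact _ _ setT).
  - move=> x clx n u.
    have nx : nbhs x [set y : marked_product | forall k, y (u k) = x (u k)].
      have nQ k : nbhs x [set y : marked_product | y (u k) = x (u k)] by exact: coord_lc.
      exact: (@filter_forall _ 'I_n _ _ _ nQ).
    have [y [Uy yx]] := clx _ nx; have [w wP] := Uy n u.
    by exists w => k; rewrite -yx; exact: wP.
  - have := @tychonoff _ (fun j : {classic marked} => discrete_group (mk_group j)) (fun=> setT).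
    rewrite (_ : mkset _ = setT); last by apply/seteqP; split.
    by apply => j; case: (discrete_profinite (mk_group j)).
  - by [].
move=> x y /eqP xy; have [j jxy] : exists j, coord j x <> coord j y.
  by apply: contrapT => no; apply: xy; apply: coord_eq => j; apply: contrapT => jxy; apply: no; exists j.
exists [set z | coord j z = coord j x]; split=> //; last by move=> E; apply: jxy.
exact: (lc_preimage_clopen (fun e => e = coord j x) (@coord_is_lc j)).
Qed.

(** Compactness leaves finitely many coordinates to control, and [marked_pair] merges them into
    one. *)
Lemma free_group_kernel (N : set free_group) : open N -> N 1 ->
  exists j, forall x, coord j x = 1 -> N x.
Proof.
move=> oN N1; have [cU _ _] := free_group_profinite.
have [|j|x nNx|n [u uP]] := @compact_fin_cover free_group marked (~` N) (fun j => [set x | coord j x <> 1]).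
- by apply: subclosed_compact cU _ => //; exact: open_closedC.
- exact: (lc_preimage_open (fun e => e <> 1) (@coord_is_lc j)).
- apply: contrapT => no; apply: nNx; rewrite (_ : x = 1) //; apply: coord_eq => j.
  by apply: contrapT => jx; apply: no; exists j.
suff [j jP] : exists j, forall x : free_group, coord j x = 1 -> forall k, coord (u k) x = 1.
  exists j => x /jP jx; apply: contrapT => /uP [k]; apply; exact: jx.
elim: n u {uP} => [|n IH] u.
  have [|||h h'|j _] := @marked_of 'S_0 (fun=> 1) (fun=> 1).
  - by rewrite /pgroup cardsT card_Sn.
  - exact: lc_cst.
  - by [].
  - by rewrite mulg1.
  by exists j => x _ [].
have [j jP] := IH (fun k => u (lift ord0 k)).
have [k [c [cM cI cX cH]]] := marked_pair (u ord0) j.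
exists k => x kx.
(* A single word represents [x] at the merged group and at both of its factors, which ties the three
   coordinates together. *)
have [w wP] := coord_word (fun i : 'I_3 => nth k [:: k; u ord0; j] i) x.
have kw : word_at k w = c (word_at (u ord0) w, word_at j w).
  rewrite /word_at; elim: w {wP} => [|a w IHw] /=; first exact: (esym (hom1 cM)).
  by rewrite IHw; case: a => [y|h]; rewrite ?cX ?cH -cM.
have [w0 wj] : word_at (u ord0) w = 1 /\ word_at j w = 1.
  have : c (word_at (u ord0) w, word_at j w) = c 1.
    by rewrite (hom1 cM) -kw -(wP ord0).
  by move=> /cI [].
move=> i; case: (unliftP ord0 i) => [i' ->|->].
  by apply: jP; have := wP (inord 2); rewrite /= inordK // => ->.
by have := wP (inord 1); rewrite /= inordK // => ->.
Qed.


Lemma free_group_pro_p : is_pro_p p free_group.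
Proof.
split; first exact: free_group_profinite.
move=> N oN [sN _]; have [j jN] := free_group_kernel oN (sub1 sN).
exact: (cosets_card (mk_pgroup j) sN (@coordM j) jN).
Qed.

Let genX_in x : marked_limit (fun j => mk_X j x).
Proof. by move=> n u; exists [:: inl x] => k; rewrite /word_at /= mulg1. Qed.

Let genH_in h : marked_limit (fun j => mk_H j h).
Proof. by move=> n u; exists [:: inr h] => k; rewrite /word_at /= mulg1. Qed.

Definition genX (x : X) : free_group := SigSub (mem_set (genX_in x)).
Definition genH (h : discrete_group H) : free_group := SigSub (mem_set (genH_in h)).

Lemma genX_continuous : continuous genX.
Proof.
apply: continuous_to_subgroup; apply: continuous_to_prod => j.
exact: (lc_discrete (mk_lc j)).
Qed.

Lemma genX_point : genX point = 1.
Proof. by apply: coord_eq => j; exact: mk_pt. Qed.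

Lemma genH_hom : continuous_hom genH.
Proof.
split; first by move=> h h'; apply: coord_eq => j; exact: mk_morph.
  move=> h A /nbhs_singleton Ah.
  by apply: (@filterS _ (nbhs h) _ [set h] _ _ (@discrete_set1 (discrete_group H) h)) => _ ->.
Qed.

(** The words are dense, since every open neighbourhood of 1 contains the kernel of one coordinate,
    and [f] and [g] agree on a closed set. *)
Lemma hom_eq (K : topologicalGroupType) (f g : free_group -> K) : hausdorff_space K ->
  continuous_hom f -> continuous_hom g ->
  (forall x, f (genX x) = g (genX x)) -> (forall h, f (genH h) = g (genH h)) -> f = g.
Proof.
move=> hK [fM cf] [gM cg] fgX fgH; apply/funext => x.
have fgw w : f (wordg genX genH w) = g (wordg genX genH w).
  elim: w => [|a w IH] /=; first by rewrite (hom1 fM) (hom1 gM).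
  by rewrite fM gM IH; case: a => [y|h]; rewrite ?fgX ?fgH.
have wc w j : coord j (wordg genX genH w) = word_at j w.
  by rewrite (wordg_morph _ _ _ (@coordM j)).
have cD : closed [set y : free_group | f y = g y].
  rewrite (_ : mkset _ = [set y | [set 1] ((f y)^-1 * g y)]).
    apply: (@closed_preimage _ _ (fun y => (f y)^-1 * g y)); last first.
      exact: accessible_closed_set1 (hausdorff_accessible hK) 1.
    by apply: continuousM => //; exact: continuousV.
  apply/seteqP; split=> y /= E; first by rewrite E mulVg.
  by apply: (mulgI (f y)^-1); rewrite E mulVg.
apply: cD => A /= [_ [[W oW <-] Wx sWA]].
pose W' : set free_group := [set n | W (val (x * n^-1))].
have oW' : open W'.
  have cc : continuous (fun n : free_group => x * n^-1).
    by apply: continuousM; [move=> ?; exact: cst_continuous|apply: continuousV; exact: continuous_id].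
  apply: (@open_comp _ _ (fun n : free_group => x * n^-1) (val @^-1` W)) => [n _|]; first exact: cc.
  by exists W.
have [|j jW] := free_group_kernel oW'; first by rewrite /W' /= invg1 mulg1.
have [w wP] := coord_word (fun _ : 'I_1 => j) x.
exists (wordg genX genH w); split; first exact: fgw.
apply: sWA => /=; have := jW ((wordg genX genH w)^-1 * x); rewrite /W' /= invgM invgK mulKVg; apply.
by rewrite coordM (homV (@coordM j)) wc -(wP ord0) mulVg.
Qed.

(** A finite quotient of [K], with the images of [phi] and [psi], is a marked group up to
    isomorphism, so [x] prescribes the image of [f x] in every finite quotient. Finitely many
    prescriptions are met by the value of a word, and all of them by compactness; finite quotients
    separate points. *)
Lemma universal (K : topologicalGroupType) (phi : X -> K) (psi : H -> K) :
    prime p -> is_pro_p p K -> continuous phi -> phi point = 1 ->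
    {morph psi : x y / x * y} ->
  exists f : free_group -> K,
    [/\ continuous_hom f, forall x, f (genX x) = phi x & forall h, f (genH h) = psi h].
Proof.
move=> pp pK cphi phi1 psiM; have [[cK hK _] _] := pK.
pose compat (j : marked) (q : K -> mk_group j) := [/\ {morph q : x y / x * y}, lc q,
  forall x, mk_X j x = q (phi x) & forall h, mk_H j h = q (psi h)].
have quo V : opn V -> exists (j : marked) (q : K -> mk_group j), compat j q /\ forall k, q k = 1 -> V k.
  move=> oV; have [E [q [pE qM qV _]]] := opn_quotient pp pK oV.
  have lq : lc q by apply: (lc_hom oV qM) => k /qV.
  have [||||j [c [cM cI cX cH]]] := @marked_of E (q \o phi) (q \o psi).
  - exact: pE.
  - exact: lc_continuous cphi lq.
  - by rewrite /= phi1; exact: hom1.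
  - by move=> h h'; rewrite /= psiM qM.
  exists j, (c \o q); split; last first.
    by move=> k /= ck; apply/qV; apply: cI; rewrite ck; exact: (esym (hom1 cM)).
  by split=> //; [move=> k k'; rewrite /= qM cM|exact: lc_comp].
have sep k k' : (forall j q, compat j q -> q k = q k') -> k = k'.
  move=> H0; apply: contrapT => kk'; have [|V [oV nV]] := opn_sep pK.1 (x := k^-1 * k').
    by apply/eqP => E; apply: kk'; apply: (mulgI k^-1); rewrite E mulVg.
  have [j [q [cq qV]]] := quo V oV; apply: nV; apply: qV; have [qM _ _ _] := cq.
  by rewrite qM (homV qM) (H0 j q cq) mulVg.
have wq j q w : compat j q -> q (wordg phi psi w) = word_at j w.
  move=> [qM _ qX qH]; rewrite (wordg_morph _ _ _ qM) /word_at.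
  by congr (wordg _ _ w); apply/funext => ?; rewrite ?qX ?qH.
have /choice [f fP] : forall x : free_group, exists k, forall j q, compat j q -> q k = coord j x.
  move=> x; apply: contrapT => no.
  pose I := {j : marked & {q : K -> mk_group j | compat j q}}.
  have [//|[j [q cq]]|k _|n [u uP]] := @compact_fin_cover K I setT
      (fun a => [set k | sval (projT2 a) k <> coord (projT1 a) x]).
  - by have [_ lq _ _] := cq; exact: (lc_preimage_open (fun e => e <> coord j x) lq).
  - apply: contrapT => nk; apply: no; exists k => j q cq; apply: contrapT => qk.
    by apply: nk; exists (existT _ j (exist _ q cq)).
  have [w wP] := coord_word (fun k => projT1 (u k)) x.
  have [k /= nk] := uP (wordg phi psi w) Logic.I; apply: nk.
  rewrite wP; move: (u k) => [j [q cq]] /=; exact: wq.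
exists f; split.
- split.
    move=> x y; apply: sep => j q cq; have [qM _ _ _] := cq.
    by rewrite qM !(fP _ _ _ cq) coordM.
  move=> x A nA; have [V [oV VA]] : exists V, opn V /\ [set k | V ((f x)^-1 * k)] `<=` A.
    move: nA; rewrite nbhsE => -[W [oW Wx] WA].
    have oW' : open [set k | W (f x * k)].
      apply: (@open_comp _ _ (fun k => f x * k)) => // k _.
      by apply: continuousM; [move=> ?; exact: cst_continuous|exact: continuous_id].
    have [|V [oV VW]] := opn_basis pK.1 oW'; first by rewrite /= mulg1.
    by exists V; split=> // k /VW /=; rewrite mulKVg; exact: WA.
  have [j [q [cq qV]]] := quo V oV; have [qM _ _ _] := cq.
  apply: filterS (coord_is_lc j x) => y /= yx; apply: VA => /=; apply: qV.
  by rewrite qM (homV qM) !(fP _ _ _ cq) yx mulVg.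
- move=> x; apply: sep => j q cq; have [_ _ qX _] := cq.
  by rewrite (fP _ _ _ cq) -qX.
- move=> h; apply: sep => j q cq; have [_ _ _ qH] := cq.
  by rewrite (fP _ _ _ cq) -qH.
Qed.

End MarkedGroups.

Section FreeProduct.
Variables (p : nat) (X : ptopologicalType).
Hypothesis pp : prime p.
Hypothesis pX : profinite_space X.

(** The free pro-p group is the same construction with a trivial finite factor, for which ['S_0]
    serves. *)
Lemma free_on_generators : is_free_pro_p_on p (@genX p X ('S_0 : finGroupType)).
Proof.
have H1 (h : 'S_0) : h = 1 by apply/permP => -[].
split; [exact: free_group_pro_p|exact: genX_continuous|exact: genX_point|].
move=> K phi pK cphi phi1.
have [|h [hc hX _]] := universal (H := 'S_0) (psi := fun=> 1) pp pK cphi phi1.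
  by move=> ? ?; rewrite mulg1.
exists h; split; first by split=> //; apply/funext => x; exact: hX.
move=> h' [h'c h'X]; apply: hom_eq => //; first by case: pK => -[].
  by move=> x; rewrite hX -h'X.
move=> t; rewrite (H1 t); have [gM _] := @genH_hom p X 'S_0.
have -> : @genH p X 'S_0 1 = 1 by exact: (hom1 gM).
by rewrite (hom1 hc.1) (hom1 h'c.1).
Qed.

Lemma coproduct_exists (H : finGroupType) : p.-group [set: H]%G ->
  exists iF : free_group p X 'S_0 -> free_group p X H,
    (forall x, iF (genX _ _ x) = genX _ _ x) /\ is_free_pro_p_product p iF (@genH p X H).
Proof.
move=> pH; have [_ _ _ Fu] := free_on_generators.
have pG0 := @free_group_pro_p p X H.
have [iF [[iFc iFX] _]] := Fu _ _ pG0 (@genX_continuous p X H) (@genX_point p X H).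
exists iF; split; first by move=> x; exact: (congr1 (fun f => f x) iFX).
split=> //; first exact: genH_hom.
move=> K f g pK fc gc; have hK : hausdorff_space K by case: pK => -[].
have cfX : continuous (f \o @genX p X 'S_0).
  by apply: continuous_compose (@genX_continuous p X 'S_0) fc.2.
have f1 : (f \o @genX p X 'S_0) point = 1 by rewrite /= genX_point; exact: hom1 fc.1.
have [h [hc hX hH]] := universal pp pK cfX f1 gc.1.
have ex h' : continuous_hom h' -> (h' \o iF = f <-> forall x, h' (genX _ _ x) = f (genX _ _ x)).
  move=> h'c; split=> [<- x|hx]; first by rewrite /= -[in LHS](congr1 (fun f => f x) iFX).
  apply/funext => y; have [k [_ ku]] := Fu K _ pK cfX f1.
  have e1 : continuous_hom (h' \o iF).
    split; first by move=> a b; rewrite /= iFc.1 h'c.1.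
    exact: continuous_compose iFc.2 h'c.2.
  have -> : h' \o iF = k.
    apply/esym/ku; split=> //; apply/funext => x /=.
    by rewrite -hx -[in RHS](congr1 (fun f => f x) iFX).
  by rewrite (ku f).
exists h; split; first by split=> //; [apply/ex|apply/funext].
move=> h' [h'c h'F h'H]; apply: hom_eq => //.
  by move=> x; rewrite hX; move/(ex h' h'c): h'F => ->.
by move=> t; rewrite hH -h'H.
Qed.

End FreeProduct.

(** * The embedding *)

(** With trivial stabilizers, two elements of [Gam] that carry a point into the same slice differ by
    an element of [N]; so [q g] is well defined on the translates of the slice, and the local maps
    glue. *)
Lemma free_equivariant_map (G : topologicalGroupType) (O : Type) (act : G -> O -> O)
    (B : set (set O)) (Gam N : set G) (E : finGroupType) (q : G -> E) :
    bspace act B -> profinite_space G -> is_subgroup Gam -> closed Gam -> opn N ->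
    {morph q : x y / x * y} -> (forall n, N n -> q n = 1) ->
    (forall o e, stab act B Gam o e -> e = 1) ->
  exists R : O -> E, lcB B R /\ forall g o, Gam g -> R (act g o) = q g * R o.
Proof.
move=> bO pG sGam cGam oN qM qN st.
have actK g o : act g (act g^-1 o) = o by rewrite -(bs_actM bO) mulgV (bs_act1 bO).
have actVK g o : act g^-1 (act g o) = o by rewrite -(bs_actM bO) mulVg (bs_act1 bO).
have GV g : Gam g -> Gam g^-1 by exact: subV.
have GM g h : Gam g -> Gam h -> Gam (g * h) by exact: subM.
pose Loc (w : O -> E) o := (exists A, [/\ B A, A o & forall o', A o' -> w o' = w o]) /\
  forall g, Gam g -> w (act g o) = q g * w o.
suff [R RP] : exists w, forall o, Loc w o.
  by exists R; split=> [o|g o]; case: (RP o) => // _; apply.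
apply: (bs_glue bO (Gam := Gam)).
  move=> V w w' o bV iV ww' Vo [[A [bA Ao wA]] wg]; split.
    exists (A `&` V); split=> //; first exact: (bsI bO).
    by move=> o' [Ao' Vo']; rewrite -!ww' // wA.
  by move=> g Gg; rewrite -!ww' //; [exact: wg|apply/iV].
move=> o; have [W [bW Wo Wsl]] := slice bO pG sGam cGam o oN.
have [N3 [oN3 N3W]] := bs_smooth bO bW.
have [m [v [Gv vP]]] := coset_reps pG sGam oN3.
pose V := [set o' | exists g, Gam g /\ W (act g^-1 o')].
have bV : B V.
  rewrite (_ : V = [set o' | exists j, W (act (v j)^-1 o')]).
    by apply: (bs_exists bO (W := fun j => [set o' | W (act (v j)^-1 o')])) => j; exact: (bs_act bO).
  apply/seteqP; split=> o' /=; last by move=> [j Wj]; exists (v j).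
  move=> [g [Gg]]; have [j [n [Nn Gn ->]]] := vP g Gg.
  by rewrite invgM (bs_actM bO) => /N3W Wj; exists j; apply: Wj; exact: opnV.
have key o' g g1 : Gam g -> Gam g1 -> W (act g^-1 o') -> W (act g1^-1 o') -> q g = q g1.
  move=> Gg Gg1 Wg Wg1.
  have [||e [n [se Nn Gn gen]]] := Wsl (g^-1 * g1) (act g1^-1 o') _ Wg1.
  - by apply: GM => //; exact: GV.
  - by rewrite (bs_actM bO) actK.
  have -> : g1 = g * n by rewrite -[n]mul1g -(st _ _ se) -gen mulKVg.
  by rewrite qM (qN _ Nn) mulg1.
pose w o' : E := if pselect (V o') is left Vo' then q (sval (cid Vo')) else 1.
have wE o' g : Gam g -> W (act g^-1 o') -> w o' = q g.
  move=> Gg Wg; rewrite /w; case: pselect => [Vo'|]; last by case; exists g.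
  by case: (cid Vo') => g' [Gg' Wg'] /=; exact: key Wg' Wg.
exists V, w; split=> //.
- move=> h o' Gh; split=> [] [g [Gg Wg]].
    by exists (h^-1 * g); split; [apply: GM => //; exact: GV|rewrite invgM invgK (bs_actM bO)].
  by exists (h * g); split; [exact: GM|rewrite invgM (bs_actM bO) actVK].
- by exists 1; split; [exact: sub1|rewrite invg1 (bs_act1 bO)].
move=> o' [g [Gg Wg]]; split.
  exists [set o'' | W (act g^-1 o'')]; split=> //; first exact: (bs_act bO).
  by move=> o'' Wo''; rewrite !(wE _ g).
move=> f Gf; rewrite (wE o' g) // (wE _ (f * g)) ?qM //; first exact: GM.
by rewrite invgM (bs_actM bO) actVK.
Qed.

(* The points with [true] form a copy of [T * T]; the others only provide a
   base point outside of it. *)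
Definition pointed_space (T : Type) := (T * T * bool)%type.

HB.instance Definition _ (G : topologicalGroupType) := Topological.on (pointed_space G).
HB.instance Definition _ (G : topologicalGroupType) :=
  isPointed.Build (pointed_space G) ((1, 1), false).

Lemma pointed_space_profinite (G : topologicalGroupType) :
  profinite_space G -> profinite_space (pointed_space G).
Proof.
move=> pG; apply: profinite_prod; first exact: profinite_prod.
apply: zero_dimensional_profinite; last exact: discrete_zero_dimension.
by apply: finite_compact; exact: (@finite_finset bool).
Qed.

Section Embedding.
Variables (p : nat) (G : topologicalGroupType) (H : finGroupType) (rho : G -> H) (F : set G).
Hypothesis pp : prime p.
Hypothesis pG : is_pro_p p G.
Hypothesis oF : opn F.
Hypothesis pH : p.-group [set: H]%G.
Hypothesis rhoM : {morph rho : x y / x * y}.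
Hypothesis rhoF : forall x, rho x = 1 <-> F x.
Variable s : H -> G.
Hypothesis sK : forall h, rho (s h) = h.
Let O := (G * G)%type.
Let act := @actT G.
Let B := BT rho.
Hypothesis bO : bspace act B.
Hypothesis stabO : forall o e, stab act B setT o e -> rho e = 1 -> e = 1.
Hypothesis acyclicO : forall c : G -> O -> 'F_p, (forall g, lcB B (c g)) ->
  (forall g h, exists k, forall y, c (g * h) y = (c g y + c h (act g^-1%g y) + k)%R) ->
  (exists N, opn N /\ forall n y y', N n -> c n y = c n y') ->
  exists w, lcB B w /\ forall g, exists k, forall y, c g y = (w (act g^-1%g y) - w y + k)%R.

Let G0 := free_group p (pointed_space G) H.
Let r (g : G) : G0 := genH p (pointed_space G) (rho g : discrete_group H).
Let b0 (y : O) : G0 := genX p H ((y, true) : pointed_space G).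
Let rho1 : rho 1 = 1. Proof. exact: hom1. Qed.
Let rhoV g : rho g^-1 = (rho g)^-1. Proof. exact: homV. Qed.

Let lcB_lc (T : Type) (f : O -> T) : lcB B f -> lc f.
Proof.
move=> lf y; have [A [[[oA _] _] Ay fA]] := lf y.
by apply: filterS (open_nbhs_nbhs (conj oA Ay)) => y' /fA.
Qed.

Let rM : {morph r : x y / x * y}.
Proof. by move=> x y; rewrite /r rhoM; have [-> //] := @genH_hom p (pointed_space G) H. Qed.

Let r_smooth : exists N, opn N /\ forall n, N n -> r n = 1.
Proof.
exists F; split=> // n /rhoF rn; rewrite /r rn.
by have [gM _] := @genH_hom p (pointed_space G) H; exact: hom1.
Qed.

(* [v y h] is [(q (s h))^-1 * R (act (s h) y)] for an equivariant map [R], so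
   that sending [b0 y] to [(1, v y)] and [h] to [(h, 1)] sends [theta] to
   [(rho g, q g)], which detects [g] modulo [N]. *)
Lemma wreath_detects (N : set G) : opn N -> exists (W : finGroupType) (Q : G0 -> W),
  [/\ {morph Q : x y / x * y}, good act B r b0 [set x | Q x = 1] &
      forall g y, Q (theta act r b0 g y) = 1 -> N g].
Proof.
move=> oN; have [E [q [pE qM qN _]]] := opn_quotient pp pG oN.
have [sF _] := oF; have sgF : is_subgroup F by case: oF => _ [].
have [R [lR RF]] : exists R : O -> E, lcB B R /\ forall g o, F g -> R (act g o) = q g * R o.
  apply: (free_equivariant_map bO pG.1 sgF (opn_closed oF) oN qM).
    by move=> n /qN.
  by move=> o e [Fe oe]; apply: (stabO (o := o)) => //; exact/rhoF.
pose v y : {ffun H -> E} := [ffun h => (q (s h))^-1 * R (act (s h) y)].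
have lv : lcB B v.
  move=> y; have [A [bA Ay AP]] := lcB_forall bO y (fun h => lcB_act bO (s h) lR).
  by exists A; split=> // y' /AP E1; apply/ffunP => h; rewrite !ffunE; congr (_ * _); exact: E1.
pose W := wreath H E.
pose phi (x : pointed_space G) : discrete_group W := if x.2 then (1, v x.1) else 1.
have cphi : continuous phi.
  apply: lc_discrete => -[y b]; have : nbhs y [set y' | v y' = v y] := lcB_lc lv y.
  move=> nv; exists ([set y' | v y' = v y], [set b' | b' = b]) => /=.
    by split=> //; exact: discrete_set1.
  by move=> [y' b'] /= [vy ->]; rewrite /phi /= vy.
pose psi (h : H) : discrete_group W := (h, [ffun=> 1]).
have psiM : {morph psi : x y / x * y}.
  move=> h h'; rewrite [RHS]wr_mulE; congr pair; apply/ffunP => t.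
  by rewrite !ffunE mulg1.
have pW : is_pro_p p (discrete_group W) by apply: discrete_is_pro_p; exact: wr_pgroup.
have [Q [[QM cQ] QX QH]] := universal pp pW cphi erefl psiM.
have Qt g y : Q (theta act r b0 g y) = (rho g, [ffun=> q g]).
  have -> : Q (theta act r b0 g y) = Q (b0 (act g y)) * Q (r g) * (Q (b0 y))^-1.
    by rewrite /theta !QM (homV QM).
  rewrite QX QH QX /phi /=; apply: (mulIg ((1, v y) : W)); rewrite mulgVK.
  rewrite !wr_mulE /= mul1g mulg1; congr pair; apply/ffunP => h; rewrite !ffunE /=.
  rewrite mulg1; set h' := h * rho g.
  have Ff : F (s h * g * (s h')^-1) by apply/rhoF; rewrite !rhoM rhoV !sK mulgV.
  rewrite -(bs_actM bO) -[s h * g](mulgVK (s h')) (bs_actM bO) (RF _ _ Ff).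
  by rewrite !qM (homV qM) !mulgA mulVg mul1g.
exists W, Q; split; first exact: QM.
- have lQ : lc Q by exact: discrete_lc.
  split.
  + split; first exact: (lc_preimage_open (fun e => e = 1) lQ).
    split; first apply/subgroupP; first split.
    * exact: hom1.
    * by move=> x y /= x1 y1; rewrite QM (homV QM) x1 y1 mulgV.
    * by move=> x y /= x1; rewrite conjgE !QM (homV QM) x1 mul1g mulVg.
  + move=> y; have [A [bA Ay AP]] := lv y; exists A; split=> // y' /AP E1.
    by rewrite /= QM (homV QM) !QX /phi /= E1 mulVg.
  + by move=> g y y'; rewrite /= QM (homV QM) !Qt mulVg.
- by move=> g y; rewrite Qt => -[_ /ffunP /(_ 1)]; rewrite !ffunE => /qN.
Qed.

(** Correcting [b0] to [b] does not spoil the detection: the kernel of the detecting map [Q] is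
    already good for [b0], so [b] agrees with [b0] modulo it and [Q] takes the same values on both
    versions of [theta]. *)
Lemma embedding_exists : exists e : G -> G0, is_embedding e.
Proof.
have pG0 := @free_group_pro_p p (pointed_space G) H.
have [b [bb0 bg]] := lift_good pp bO pG0 rM r_smooth acyclicO b0.
pose y1 : O := (1, 1).
pose e g := theta act r b g y1.
have indep g y : theta act r b g y = e g.
  apply: contrapT => ne; have [|V [oV nV]] := opn_sep pG0.1 (x := (theta act r b g y)^-1 * e g).
    by apply/eqP => E1; apply: ne; apply: (mulgI (theta act r b g y)^-1); rewrite mulVg E1.
  by apply: nV; case: (bg V oV) => _ _; apply.
have eM : {morph e : x y / x * y}.
  move=> g h; rewrite -(indep g (act h y1)) /e /theta (bs_actM bO) rM !mulgA.
  by rewrite mulgVK.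
have eN V : opn V -> exists N, opn N /\ forall n, N n -> V (e n).
  move=> oV; have [_ bl _] := bg V oV; have [N [oN Nr]] := r_smooth.
  have [E [q [_ qM qV _]]] := opn_quotient pp pG0 oV.
  have lq : lcB B (q \o b).
    move=> y; have [A [bA Ay AP]] := bl y; exists A; split=> // y' /AP /qV.
    by rewrite qM (homV qM) /= => E1; apply: (mulgI (q (b y))^-1); rewrite E1 mulVg.
  have [N' [oN' N'b]] := lcB_smooth bO lq.
  exists (N `&` N'); split; first exact: opnI.
  move=> n [Nn N'n]; apply/qV; rewrite /e /theta (Nr _ Nn) mulg1 qM (homV qM).
  by have /= -> := N'b n y1 N'n; rewrite mulgV.
exists e; split; first split=> //.
- move=> g A; rewrite nbhsE => -[W [oW Wg] WA].
  have oW' : open [set k | W (e g * k)].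
    apply: (@open_comp _ _ (fun k => e g * k)) => // k _.
    by apply: continuousM; [move=> ?; exact: cst_continuous|exact: continuous_id].
  have [|V [oV VW]] := opn_basis pG0.1 oW'; first by rewrite /= mulg1.
  have [N [oN NV]] := eN V oV.
  apply: filterS (@nbhs_coset G N g (proj1 oN) (opn1 oN)) => x /= Nx.
  by apply: WA; rewrite -[x](mulKVg g) eM; apply: VW; exact: NV.
- have e1 g : e g = 1 -> g = 1.
    move=> eg; apply: contrapT => /eqP g1; have [N [oN nN]] := opn_sep pG.1 g1.
    apply: nN; have [W [Q [QM gQ QN]]] := wreath_detects oN.
    have Qb y : Q (b y) = Q (b0 y).
      have := bb0 _ gQ y; rewrite /= QM (homV QM) => E1.
      by apply: (mulgI (Q (b0 y))^-1); rewrite E1 mulVg.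
    apply: (QN g y1).
    have : Q (theta act r b g y1) = 1 by rewrite -/(e g) eg; exact: hom1.
    by rewrite /theta !QM !(homV QM) !Qb.
  move=> g h egh; apply: (mulgI g^-1); rewrite mulVg; apply/esym/e1.
  by rewrite eM (homV eM) egh mulVg.
Qed.

End Embedding.

Theorem theorem1p4 (p : nat) (p_prime : prime p) (G : topologicalGroupType)
    (G_vfree : is_virtually_free_pro_p p G)
    (G_centralizers :
      forall x : G, torsion x -> x <> 1 -> finite_set (centralizer x)) :
  exists (H : finGroupType) (F0 G0 : topologicalGroupType)
      (iF0 : F0 -> G0) (iH : discrete_group H -> G0) (e : G -> G0),
    [/\ p.-group [set: H]%G, is_free_pro_p p F0,
        is_free_pro_p_product p iF0 iH & is_embedding e].
Proof.
have [pG [U [hU [oU [X [i [pX Ufree]]]]]]] := G_vfree.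
have [|F [oF FU]] := opn_basis pG.1 oU; first exact: sub1.
have [H [rho [pH rhoM rhoF rho_surj]]] := opn_quotient p_prime pG oF.
have [s sK] := choice rho_surj.
have rhoV g : rho g^-1 = (rho g)^-1 by exact: homV.
have cX : compact [set: X] by case: pX.
have tfree x : rho x = 1 -> torsion x -> x = 1.
  move=> /rhoF /FU Ux [n [n0 xn]].
  pose x' : subgroup_type hU := SigSub (mem_set Ux).
  have valX m : val (x' ^+ m) = x ^+ m by elim: m => [|m IH]; rewrite ?expg0 // !expgS -IH.
  have -> : x = val x' by [].
  rewrite (free_torsion_free p_prime cX Ufree (x := x')) //.
  by exists n; split=> //; apply: val_inj; rewrite valX xn.
(* The cocycle of left multiplication by [g] with respect to the section [s]. It lies in the kernel
   [F] of [rho], hence in [U], so the default value 1 is never taken. *)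
pose kappa (g : G) (h : H) : subgroup_type hU :=
  insubd (1 : subgroup_type hU) ((s (rho g * h))^-1 * g * s h).
have kappaE g h : val (kappa g h) = (s (rho g * h))^-1 * g * s h.
  rewrite /kappa insubdK // inE; apply: FU; apply/rhoF.
  by rewrite !rhoM rhoV !sK -mulgA mulVg.
have kappaM g g' h : kappa (g * g') h = kappa g (rho g' * h) * kappa g' h.
  apply: val_inj; rewrite -[RHS]/(val (kappa g _) * val (kappa g' _)) !kappaE rhoM.
  by rewrite !mulgA mulgK.
have kappa_smooth N : opn N ->
    exists N', [/\ opn N', N' `<=` F & forall n h, N' n -> N (kappa n h)].
  move=> oN; have [[W oW WN] _] := oN.
  have [|N0 [oN0 N0W]] := opn_basis pG.1 oW.
    by have := opn1 oN; rewrite -WN.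
  exists (N0 `&` F); split; [exact: opnI|by move=> n []|].
  move=> n h [N0n /rhoF rn]; rewrite -WN; apply: (N0W (val (kappa n h))).
  by rewrite kappaE rn mul1g -mulgA; exact: opnJ.
have kappa_inj g h : rho g = 1 -> kappa g h = 1 -> g = 1.
  move=> rg kg; have := kappaE g h; rewrite kg rg mul1g => E1.
  by apply: (mulgI (s h)^-1); apply: (mulIg (s h)); rewrite -E1 mulg1 mulVg.
have rhoF' n : F n <-> rho n = 1 by rewrite rhoF.
have rhoF1 n : F n -> rho n = 1 by move/rhoF.
have bO := BT_bspace rhoM pG.1.
have st := stab_actT pH rhoM oF rhoF' pG.1 tfree G_centralizers.
have fx := fixed_actT pH rhoM oF rhoF' pG.1 tfree G_centralizers.
have ac := acyclic p_prime pX Ufree rhoM oF rhoF1 pG.1 kappaM kappa_smooth kappa_inj bO st fx.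
have [e eE] := embedding_exists p_prime pG oF pH rhoM rhoF sK bO st ac.
have pX0 := pointed_space_profinite pG.1.
have [iF [_ prod]] := coproduct_exists (pointed_space G) p_prime pH.
exists H, (free_group p (pointed_space G) 'S_0), (free_group p (pointed_space G) H), iF,
  (@genH p (pointed_space G) H), e.
split=> //; exists (pointed_space G), (@genX p (pointed_space G) 'S_0); split=> //.
exact: free_on_generators.
Qed.
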